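(* Let $\alpha\in(0,1]$, let $D\subset\mathbb{C}^d$ be a domain and let $p\in\partial D$ be a $\mathcal{C}^{2,\alpha}$-smooth strongly pseudoconvex boundary point of $D$. Then there exists a neighborhood $U$ of $p$ such that for any $\varepsilon\in(0,1]$ one may find a constant $c=c(\varepsilon)>0$ such that if $z,w\in D\cap U$ and $|(z-w)_N|\ge\varepsilon|z-w|$, then $$k_D(z,w)\ge\log\left(1+\frac{c\,|(z-w)_N|}{\delta_D(z)^{1/2}\,\delta_D(w)^{1/2}}\right).$$
   Context: $\Delta$ is the open unit disc in $\mathbb{C}$, $\mathcal{O}(\Delta,D)$ is the set of holomorphic maps $\Delta\to D$, and $\tanh^{-1}t=\frac12\log\frac{1+t}{1-t}$. The Lempert function of $D$ is $l_D(z,w)=\inf\{\tanh^{-1}|\alpha|:\exists\varphi\in\mathcal{O}(\Delta,D)\text{ with }\varphi(0)=z,\ \varphi(\alpha)=w\}$, and the Kobayashi distance $k_D$ is the largest pseudodistance on $D$ not exceeding $l_D$. $\delta_D(z)=\operatorname{dist}(z,\partial D)$ is the Euclidean distance to the boundary. For $z\in D$ near $p$, let $p(z)\in\partial D$ be the closest boundary point to $z$ (unique for $z$ close to $p$). $X_N$ denotes the projection of $X\in\mathbb{C}^d$ on the complex normal line to $\partial D$ at $p(z)$; equivalently $|X_N|=|\langle X,\nu_{p(z)}\rangle|$, where $\nu_{p(z)}$ is the unit outward normal to $\partial D$ at $p(z)$ and $\langle\cdot,\cdot\rangle$ is the standard Hermitian product. In the expression $(z-w)_N$ the projection is taken at $p(z)$.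 A $\mathcal{C}^{2,\alpha}$-smooth strongly pseudoconvex boundary point $p$ is one near which $\partial D$ is $\mathcal{C}^{2,\alpha}$-smooth and at which the Levi form of a defining function is positive definite on the complex tangent space. *)

(* Defs.v *)
From HB Require Import structures.
From mathcomp Require Import all_boot all_order all_algebra.
From mathcomp Require Import all_classical all_reals all_analysis.
From mathcomp Require Import complex.

Set Implicit Arguments.
Unset Strict Implicit.
Unset Printing Implicit Defensive.

Import Order.TTheory GRing.Theory Num.Theory numFieldNormedType.Exports.

Local Open Scope classical_set_scope.
Local Open Scope ring_scope.
Local Open Scope complex_scope.

(* The alias [^o] gives the coefficients the topology of [R[i]].  The norm that
   the library puts on row vectors is the sup norm: it is used only for the
   topology, lengths being measured by [enorm] below. *)
Notation Cn R d := 'rV[(complex R)^o]_d.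

Section Euclidean.
Context {R : realType} {d : nat}.
Implicit Types (X Y z : Cn R d) (D : set (Cn R d)).

(* Linear in the first argument, conjugate-linear in the second. *)
Definition hdot X Y : R[i] := dotmx (X : 'rV[R[i]]_d) (Y : 'rV[R[i]]_d).

Definition enorm X : R := Num.sqrt (complex.Re (hdot X X)).

Definition domain D := [/\ D !=set0, open D & connected D].

Definition boundary D : set (Cn R d) := closure D `\` interior D.

Definition bdist D z : R := inf [set enorm (z - q) | q in boundary D].

(* A choice of minimizer; it is unique for [z] close to a smooth boundary
   point. *)
Definition closest_bdpt D z : Cn R d :=
  get [set q | boundary D q /\ enorm (z - q) = bdist D z].

End Euclidean.

Section Kobayashi.
Context {R : realType} {d : nat}.
Implicit Types (D : set (Cn R d)) (z w : Cn R d).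

Definition cabs (a : R[i]) : R := complex.Re `|a|.

Definition unit_disc : set (R[i])^o := [set a | cabs a < 1].

Definition artanh (t : R) : R := 2^-1 * ln ((1 + t) / (1 - t)).

(* [derivable _ a 1] is over the scalar field [R[i]], hence it is complex
   differentiability at [a]. *)
Definition holomorphic_disc D (phi : (R[i])^o -> Cn R d) :=
  forall a, unit_disc a -> D (phi a) /\ derivable phi a 1.

Definition lempert D z w : \bar R :=
  ereal_inf [set (artanh (cabs a))%:E | a in
    [set a | unit_disc a /\
       exists phi, [/\ holomorphic_disc D phi, phi 0 = z & phi a = w]]].

Definition pseudodistance D (k : Cn R d -> Cn R d -> R) :=
  [/\ forall x, D x -> k x x = 0,
      forall x y, D x -> D y -> 0 <= k x y,
      forall x y, D x -> D y -> k x y = k y x &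
      forall x y u, D x -> D y -> D u -> k x u <= k x y + k y u].

(* A pointwise supremum of pseudodistances is a pseudodistance wherever it is
   finite, so this is the largest pseudodistance not exceeding [lempert D]. *)
Definition kobayashi D z w : \bar R :=
  ereal_sup [set (k z w)%:E | k in
    [set k | pseudodistance D k /\
       forall x y, D x -> D y -> ((k x y)%:E <= lempert D x y)%E]].

End Kobayashi.

Section Smoothness.
Context {R : realType} {d : nat}.
Implicit Types (D V : set (Cn R d)) (v w z p q X : Cn R d) (r : Cn R d -> R).

(* Derivative along the real line through [z] with direction [v]: C^d is a
   real vector space of dimension 2d here. *)
Definition rline r v z : R -> R := fun t => r (z + t%:C *: v).

Definition rderive v r : Cn R d -> R := fun z => derive1 (rline r v z) 0.

Fixpoint Ck (k : nat) V r : Prop :=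
  if k is k'.+1 then
    forall v, (forall z, V z -> derivable (rline r v z) 0 1) /\
              Ck k' V (rderive v r)
  else forall z, V z -> {for z, continuous r}.

Definition C2holder (alpha : R) V r : Prop :=
  Ck 2 V r /\
  forall v w, exists M : R, forall x y, V x -> V y ->
    `|rderive v (rderive w r) x - rderive v (rderive w r) y|
      <= M * enorm (x - y) `^ alpha.

Definition xdir (j : 'I_d) : Cn R d := delta_mx 0 j.
Definition ydir (j : 'I_d) : Cn R d := 'i *: xdir j.

(* The real gradient, R^2d being identified with C^d by x + iy. *)
Definition grad r z : Cn R d :=
  \row_j (rderive (xdir j) r z +i* rderive (ydir j) r z).

Definition local_defining_function D V r : Prop :=
  [/\ open V, forall z, V z -> (D z <-> r z < 0)
    & forall z, V z -> grad r z != 0].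

Definition cderive v (f : Cn R d -> R[i]) : Cn R d -> R[i] := fun z =>
  rderive v (fun x => complex.Re (f x)) z
    +i* rderive v (fun x => complex.Im (f x)) z.

Definition dz j (f : Cn R d -> R[i]) : Cn R d -> R[i] := fun z =>
  2^-1 * (cderive (xdir j) f z - 'i * cderive (ydir j) f z).

Definition dzbar j (f : Cn R d -> R[i]) : Cn R d -> R[i] := fun z =>
  2^-1 * (cderive (xdir j) f z + 'i * cderive (ydir j) f z).

Definition complex_tangent r p X : Prop :=
  \sum_j dz j (fun x => (r x)%:C) p * X 0 j = 0.

(* The sum is real when [r] is C^2. *)
Definition levi_form r p X : R :=
  complex.Re (\sum_j \sum_k
    dz j (dzbar k (fun x => (r x)%:C)) p * X 0 j * (X 0 k : R[i])^*).

Definition strongly_pseudoconvex_bdpt (alpha : R) D p : Prop :=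
  boundary D p /\
  exists V r,
    [/\ V p, C2holder alpha V r, local_defining_function D V r
      & forall X, X != 0 -> complex_tangent r p X -> 0 < levi_form r p X].

(* At a boundary point the value does not depend on the defining function. *)
Definition outer_unit_normal D q : Cn R d :=
  get [set nu | exists V r,
    [/\ V q, Ck 1 V r, local_defining_function D V r
      & nu = ((enorm (grad r q))^-1)%:C *: grad r q]].

(* Orthogonal projection on the complex normal line to the boundary at [q]. *)
Definition normal_proj D q X : Cn R d :=
  hdot X (outer_unit_normal D q) *: outer_unit_normal D q.

End Smoothness.

(* Main.v *)
Require Import Defs.
From HB Require Import structures.
From mathcomp Require Import all_boot all_order all_algebra.
From mathcomp Require Import all_classical all_reals all_analysis.
From mathcomp Require Import complex.
From mathcomp Require Import ring lra.

Set Implicit Arguments.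
Unset Strict Implicit.
Unset Printing Implicit Defensive.

Import Order.TTheory GRing.Theory Num.Theory numFieldNormedType.Exports.

Local Open Scope classical_set_scope.
Local Open Scope ring_scope.

(* If a real function T on D satisfies |T (phi h) - T (phi 0)| <= (1 + e) |h| for small h, for
   all discs phi in D and all e > 0, then |T z - T w| is at most the Kobayashi distance.
   Strong pseudoconvexity gives, for every boundary point q near p, a quadratic polynomial g_q
   (minus a Levi polynomial) with Re (g_q x) >= c (|x - q|^2 + dist (x, bd D)) for x in D near q.
   Since a disc need not stay near q, Schwarz's lemma is localized by means of the barrier
   Re g_q itself: to first order in h,
     |g_q (phi h) - g_q (phi 0)| <= 2 r (1 + 4 r / t) |h|, where r = Re (g_q (phi 0)),
   so that a corrected and truncated -1/2 ln |g_q| is a possible T, a bump at q.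
   Let A = |(z - w)_N|, let q and q' be the boundary points closest to z and w, and let de and
   de' be the distances from z and w to the boundary.  If de and de' are small compared with
   A, then the bumps at q and q' have disjoint supports and their difference gives the bound
   ln (c A / sqrt (de de')).  If de, or de', is not small compared with A, then the bump at q',
   or at q, suffices.  This proves the theorem unless A / sqrt (de de') is bounded, in which case
   |z - w| <= A / eps makes de, de' comparable, and a lower bound linear in A / de is enough.
   For small de it comes from |g_q - g_q z| truncated at a multiple of de, the error
   C |z - w| (|z - w| + de) being absorbed in A; for the other de, from a linear function
   perturbing g_q. *)

(** * Complex differentiability *)

(** The Kobayashi distance is a supremum, so one competitor [|T x - T y|] gives a lower bound, and
    being a competitor can be tested on discs at their centres. The logarithm has this origin: a
    holomorphic map into the right half-plane contracts the Poincare metric |d zeta| / (2 Re zeta),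
    for which 1/2 ln |zeta| is 1-Lipschitz. The obstacle is that g_q maps into the half-plane only
    near q, whereas discs are global and nothing is known of D away from p. The price is the factor
    1 + 4 r / t, which tends to 1 so fast at the boundary that its total effect is bounded: passing
    from 1 / |g| to 1 / |g| + 4 / t inside the logarithm integrates it exactly. One bump sees only
    one of the two points and yields half of the logarithm; the product de de' requires two bumps,
    and the difference of two bumps is free of loss only if their supports are disjoint. The
    assumption A >= eps |z - w| enters when the logarithm is of bounded size: it makes the two
    boundary distances comparable and lets A dominate the quadratic part of g_q. *)

Section ComplexPlane.
Context {R : realType}.
Implicit Types (a b z : R[i]) (F G : R[i] -> R[i]) (e : R).

Lemma cabs_normc a : cabs a = Normc.normc a.
Proof. by case: a. Qed.

Lemma cabsE a : cabs a = Num.sqrt (complex.Re a ^+ 2 + complex.Im a ^+ 2).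
Proof. by case: a. Qed.

Lemma normr_cabs a : `|a| = (cabs a)%:C%C.
Proof. by case: a. Qed.

Lemma cabs_ge0 a : 0 <= cabs a.
Proof. by rewrite cabsE sqrtr_ge0. Qed.

Lemma cabs0 : cabs (0 : R[i]) = 0.
Proof. by rewrite cabs_normc Normc.normc0. Qed.

Lemma cabs1 : cabs (1 : R[i]) = 1.
Proof. by rewrite cabs_normc Normc.normc1. Qed.

Lemma cabs_eq0 a : (cabs a == 0) = (a == 0).
Proof.
apply/eqP/eqP => [|->]; last exact: cabs0.
by rewrite cabs_normc => /Normc.eq0_normc.
Qed.

Lemma cabs_gt0 a : (0 < cabs a) = (a != 0).
Proof. by rewrite lt_def cabs_ge0 andbT cabs_eq0. Qed.

Lemma cabsM a b : cabs (a * b) = cabs a * cabs b.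
Proof. by rewrite !cabs_normc Normc.normcM. Qed.

Lemma cabsV a : cabs a^-1 = (cabs a)^-1.
Proof. by rewrite !cabs_normc Normc.normcV. Qed.

Lemma cabsN a : cabs (- a) = cabs a.
Proof. by rewrite !cabs_normc normcN. Qed.

Lemma cabsB a b : cabs (a - b) = cabs (b - a).
Proof. by rewrite -cabsN opprB. Qed.

Lemma cabsD a b : cabs (a + b) <= cabs a + cabs b.
Proof. by rewrite !cabs_normc le_normcD. Qed.

Lemma cabs_subD a b : cabs (a - b) <= cabs a + cabs b.
Proof. by rewrite (le_trans (cabsD _ _))// cabsN. Qed.

Lemma cabs_sub_ge a b : cabs a - cabs b <= cabs (a - b).
Proof. by rewrite lerBlDr (le_trans _ (cabsD _ _))// subrK. Qed.

Lemma cabs_real (x : R) : cabs (x%:C)%C = `|x|.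
Proof. by rewrite cabsE /= expr0n addr0 sqrtr_sqr. Qed.

Lemma cabs_conj a : cabs (a^*)%C = cabs a.
Proof. by rewrite !cabsE; case: a => x y /=; rewrite sqrrN. Qed.

Lemma sqr_cabs a : cabs a ^+ 2 = complex.Re a ^+ 2 + complex.Im a ^+ 2.
Proof. by rewrite cabsE sqr_sqrtr// addr_ge0 ?sqr_ge0. Qed.

Lemma normRe_le a : `|complex.Re a| <= cabs a.
Proof. by rewrite -sqrtr_sqr cabsE ler_wsqrtr// lerDl sqr_ge0. Qed.

Lemma Re_le_cabs a : complex.Re a <= cabs a.
Proof. exact: le_trans (ler_norm _) (normRe_le a). Qed.

Lemma normIm_le a : `|complex.Im a| <= cabs a.
Proof. by rewrite -sqrtr_sqr cabsE ler_wsqrtr// lerDr sqr_ge0. Qed.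

Lemma cabs_leD a : cabs a <= `|complex.Re a| + `|complex.Im a|.
Proof.
rewrite cabsE -[leRHS]ger0_norm ?addr_ge0// -sqrtr_sqr ler_wsqrtr//.
rewrite sqrrD !real_normK ?num_real// addrAC lerDl mulrn_wge0//.
Qed.

Lemma ReD a b : complex.Re (a + b) = complex.Re a + complex.Re b.
Proof. by case: a b => [? ?] [? ?]. Qed.

Lemma ImD a b : complex.Im (a + b) = complex.Im a + complex.Im b.
Proof. by case: a b => [? ?] [? ?]. Qed.

Lemma ReN a : complex.Re (- a) = - complex.Re a.
Proof. by case: a. Qed.

Lemma ImN a : complex.Im (- a) = - complex.Im a.
Proof. by case: a. Qed.

Lemma ReM a b : complex.Re (a * b) =
  complex.Re a * complex.Re b - complex.Im a * complex.Im b.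
Proof. by case: a b => [? ?] [? ?]. Qed.

Lemma ImM a b : complex.Im (a * b) =
  complex.Re a * complex.Im b + complex.Im a * complex.Re b.
Proof. by case: a b => [? ?] [? ?]. Qed.

Definition ReImE := (ReD, ImD, ReN, ImN, ReM, ImM).

Lemma eqc a b : complex.Re a = complex.Re b ->
  complex.Im a = complex.Im b -> a = b.
Proof. by case: a b => [? ?] [? ?] /= -> ->. Qed.

(** The centre is included, so that [cnear_at] can read off the property at [a] itself. *)
Definition cnear a (P : R[i] -> Prop) :=
  exists2 d : R, 0 < d & forall z, cabs (z - a) < d -> P z.

Lemma cnearS a (P Q : R[i] -> Prop) :
  (forall z, P z -> Q z) -> cnear a P -> cnear a Q.
Proof. by move=> PQ [d d0 h]; exists d => // z /h /PQ. Qed.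

Lemma cnearI a (P Q : R[i] -> Prop) :
  cnear a P -> cnear a Q -> cnear a (fun z => P z /\ Q z).
Proof.
move=> [d d0 h] [d' d'0 h']; exists (Num.min d d'); first by rewrite lt_min d0.
by move=> z; rewrite lt_min => /andP[/h ? /h'].
Qed.

Lemma cnearS2 a (P Q S : R[i] -> Prop) :
  (forall z, P z -> Q z -> S z) -> cnear a P -> cnear a Q -> cnear a S.
Proof.
by move=> h hP hQ; apply: cnearS (cnearI hP hQ) => z [] /h; apply.
Qed.

Lemma cnear_at a (P : R[i] -> Prop) : cnear a P -> P a.
Proof. by move=> [d d0]; apply; rewrite subrr cabs0. Qed.

Lemma cnearT a (P : R[i] -> Prop) : (forall z, P z) -> cnear a P.
Proof. by move=> h; exists 1. Qed.

Lemma cnear_lt a e : 0 < e -> cnear a (fun z => cabs (z - a) < e).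
Proof. by move=> e0; exists e. Qed.

Definition ccont F a := forall e, 0 < e -> cnear a (fun z => cabs (F z - F a) < e).

Lemma ccont_cst b a : ccont (fun=> b) a.
Proof. by move=> e e0; apply: cnearT => z; rewrite subrr cabs0. Qed.

Lemma ccont_id a : ccont id a.
Proof. by move=> e; exact: cnear_lt. Qed.

Lemma ccont_near F G a : cnear a (fun z => F z = G z) -> ccont F a -> ccont G a.
Proof.
move=> FG Fa e e0; have FGa := cnear_at FG.
by apply: cnearS2 FG (Fa _ e0) => z Ez; rewrite FGa Ez.
Qed.

Lemma ccontD F G a : ccont F a -> ccont G a -> ccont (fun z => F z + G z) a.
Proof.
move=> Fa Ga e e0; have e20 : 0 < e / 2 by rewrite divr_gt0.
apply: cnearS2 (Fa _ e20) (Ga _ e20) => z h1 h2.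
by rewrite opprD addrACA (le_lt_trans (cabsD _ _))// [e]splitr ltrD.
Qed.

Lemma ccontN F a : ccont F a -> ccont (fun z => - F z) a.
Proof.
by move=> Fa e /Fa; apply: cnearS => z; rewrite -opprD cabsN.
Qed.

Lemma ccont_bnd F a : ccont F a -> cnear a (fun z => cabs (F z) < cabs (F a) + 1).
Proof.
move=> /(_ 1 ltr01); apply: cnearS => z h; rewrite -ltrBlDl.
exact: le_lt_trans (cabs_sub_ge _ _) h.
Qed.

Lemma ccontM F G a : ccont F a -> ccont G a -> ccont (fun z => F z * G z) a.
Proof.
move=> Fa Ga e e0.
have p1 : 0 < e / 2 / (cabs (G a) + 1).
  by rewrite !divr_gt0// ltr_wpDl// cabs_ge0.
have p2 : 0 < e / 2 / (cabs (F a) + 1).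
  by rewrite !divr_gt0// ltr_wpDl// cabs_ge0.
apply: cnearS2 (Fa _ p1) (cnearI (Ga _ p2) (ccont_bnd Fa)) => z h1 [h2 h3].
have -> : F z * G z - F a * G a = F z * (G z - G a) + (F z - F a) * G a.
  by rewrite mulrBl mulrBr addrA subrK.
rewrite (le_lt_trans (cabsD _ _))// [e]splitr !cabsM ltr_leD//.
  rewrite ltr_pdivlMr ?ltr_wpDl ?cabs_ge0// in h2.
  rewrite (le_lt_trans _ h2)// mulrC ler_wpM2l ?cabs_ge0//; exact: ltW.
rewrite ltr_pdivlMr ?ltr_wpDl ?cabs_ge0// in h1.
rewrite (le_trans _ (ltW h1))// ler_wpM2l ?cabs_ge0// lerDl ler01 //.
Qed.

Lemma ccont_neq0 F a : ccont F a -> F a != 0 ->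
  cnear a (fun z => cabs (F a) / 2 < cabs (F z)).
Proof.
move=> Fa F0; have p : 0 < cabs (F a) / 2 by rewrite divr_gt0 ?cabs_gt0.
apply: cnearS (Fa _ p) => z; rewrite cabsB => h.
have := le_lt_trans (cabs_sub_ge _ _) h; lra.
Qed.

Lemma ccontV F a : ccont F a -> F a != 0 -> ccont (fun z => (F z)^-1) a.
Proof.
move=> Fa F0 e e0; have c0 : 0 < cabs (F a) by rewrite cabs_gt0.
have p : 0 < e * cabs (F a) ^+ 2 / 2 by rewrite !(divr_gt0, mulr_gt0, exprn_gt0).
apply: cnearS2 (Fa _ p) (ccont_neq0 Fa F0) => z h1 h2.
have z0 : F z != 0 by rewrite -cabs_gt0 (lt_trans _ h2)// divr_gt0.
have -> : (F z)^-1 - (F a)^-1 = - ((F z - F a) / (F z * F a)) by field; rewrite F0.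
rewrite cabsN cabsM cabsV cabsM ltr_pdivrMr ?mulr_gt0 ?cabs_gt0//.
rewrite (lt_le_trans h1)//.
have -> : e * cabs (F a) ^+ 2 / 2 = e * (cabs (F a) / 2 * cabs (F a)) by ring.
by rewrite !ler_wpM2l ?(ltW e0)// ler_wpM2r ?ltW.
Qed.

Lemma ccont_comp F G a : ccont G a -> ccont F (G a) -> ccont (fun z => F (G z)) a.
Proof.
move=> Ga Fa e /Fa [d d0 h]; apply: cnearS (Ga _ d0) => z; exact: h.
Qed.

(* Caratheodory's form of complex differentiability. *)
Definition cdiff F a := exists2 Phi, ccont Phi a &
  cnear a (fun z => F z = F a + Phi z * (z - a)).

Lemma cdiff_cst b a : cdiff (fun=> b) a.
Proof.
by exists (fun=> 0); [exact: ccont_cst | apply: cnearT => z; rewrite mul0r addr0].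
Qed.

Lemma cdiff_id a : cdiff id a.
Proof.
by exists (fun=> 1); [exact: ccont_cst | apply: cnearT => z; rewrite mul1r subrKC].
Qed.

Lemma cdiff_near F G a : cnear a (fun z => F z = G z) -> cdiff F a -> cdiff G a.
Proof.
move=> FG [Phi c h]; exists Phi => //; have FGa := cnear_at FG.
by apply: cnearS2 FG h => z <-; rewrite FGa.
Qed.

Lemma cdiff_ccont F a : cdiff F a -> ccont F a.
Proof.
move=> [Phi c h]; have : ccont (fun z => F a + Phi z * (z - a)) a.
  apply: ccontD; first exact: ccont_cst.
  by apply: ccontM => //; apply: ccontD; [exact: ccont_id | exact: ccont_cst].
by apply: ccont_near; apply: cnearS h.
Qed.

Lemma cdiffD F G a : cdiff F a -> cdiff G a -> cdiff (fun z => F z + G z) a.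
Proof.
move=> [P Pc hP] [Q Qc hQ]; exists (fun z => P z + Q z); first exact: ccontD.
by apply: cnearS2 hP hQ => z -> ->; rewrite mulrDl addrACA.
Qed.

Lemma cdiffN F a : cdiff F a -> cdiff (fun z => - F z) a.
Proof.
move=> [P Pc hP]; exists (fun z => - P z); first exact: ccontN.
by apply: cnearS hP => z ->; rewrite opprD mulNr.
Qed.

Lemma cdiffB F G a : cdiff F a -> cdiff G a -> cdiff (fun z => F z - G z) a.
Proof. by move=> Fa Ga; apply: cdiffD => //; exact: cdiffN. Qed.

Lemma cdiffM F G a : cdiff F a -> cdiff G a -> cdiff (fun z => F z * G z) a.
Proof.
move=> Fd [Q Qc hQ]; have Fc := cdiff_ccont Fd; case: Fd => [P Pc hP].
exists (fun z => P z * G a + F z * Q z).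
  apply: ccontD; apply: ccontM => //; exact: ccont_cst.
by apply: cnearS2 hP hQ => z EF ->; rewrite EF; ring.
Qed.

Lemma cdiffV F a : cdiff F a -> F a != 0 -> cdiff (fun z => (F z)^-1) a.
Proof.
move=> Fd F0; have Fc := cdiff_ccont Fd; case: Fd => [P Pc hP].
exists (fun z => - P z * ((F z)^-1 * (F a)^-1)).
  apply: ccontM; first exact: ccontN.
  by apply: ccontM; [exact: ccontV | exact: ccont_cst].
apply: cnearS2 hP (ccont_neq0 Fc F0) => z EF h.
have z0 : F z != 0 by rewrite -cabs_gt0 (le_lt_trans _ h)// divr_ge0// cabs_ge0.
have -> : - P z * ((F z)^-1 / F a) * (z - a) = - (P z * (z - a)) * ((F z)^-1 / F a).
  by ring.
have -> : P z * (z - a) = F z - F a by rewrite EF [in RHS]addrC addKr.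
by field; rewrite F0 z0.
Qed.

Lemma cdiff_comp F G a : cdiff G a -> cdiff F (G a) -> cdiff (fun z => F (G z)) a.
Proof.
move=> Gd [P Pc hP]; have Gc := cdiff_ccont Gd; case: Gd => [Q Qc hQ].
exists (fun z => P (G z) * Q z); first by apply: ccontM => //; exact: ccont_comp.
case: hP => d d0 hP; apply: cnearS2 hQ (Gc _ d0) => z EG h.
by rewrite (hP _ h) EG; ring.
Qed.

Lemma cdiff_sum (I : finType) (F : I -> R[i] -> R[i]) a :
  (forall i, cdiff (F i) a) -> cdiff (fun z => \sum_i F i z) a.
Proof.
move=> h; have : cdiff (\sum_i F i) a.
  elim/big_rec: _ => [|i G _ Gd]; first exact: (cdiff_cst 0).
  exact: cdiffD.
by apply: cdiff_near; apply: cnearT => z; rewrite fct_sumE.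
Qed.

(** The difference quotient with the derivative filled in at [a]. It will be the quotient in
    Schwarz's lemma; continuity at [a] is enough there, because the maximum principle below
    tolerates an exceptional centre. *)
Lemma cdiff_quot F a : cdiff F a -> exists Phi,
  [/\ ccont Phi a, forall z, F z = F a + Phi z * (z - a)
    & forall z, z != a -> Phi z = (F z - F a) / (z - a)].
Proof.
move=> [P Pc hP].
exists (fun z => if z == a then P a else (F z - F a) / (z - a)); split => [|z|z].
- apply: ccont_near Pc; apply: cnearS hP => z Ez; case: eqVneq => [-> //|za].
  by rewrite Ez [F a + _]addrC addrK mulfK// subr_eq0.
- case: eqVneq => [->|za]; first by rewrite subrr mulr0 addr0.
  by rewrite divfK ?subr_eq0// addrC subrK.
- by move=> /negPf ->.
Qed.

End ComplexPlane.

(** * Goursat's theorem *)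

Section Goursat.
Context {R : realType}.
Notation mu := (@lebesgue_measure R).
Implicit Types (f g : R -> R) (P Q : R -> R -> R).

Definition sint f a b : R := (\int[mu]_(x in `[a, b]) f x)%R.

(** Two-sided continuity even at the endpoints: the integrands are differentiable on full
    neighbourhoods of the points of a rectangle. *)
Definition scont f a b := forall x, a <= x <= b -> {for x, continuous f}.

Lemma scont_integrable f a b : scont f a b ->
  mu.-integrable `[a, b] (EFin \o f).
Proof.
move=> fc; apply: continuous_compact_integrable; first exact: segment_compact.
by apply: continuous_in_subspaceT => x; rewrite inE /= in_itv /= => /fc.
Qed.

Lemma scontB f g a b : scont f a b -> scont g a b -> scont (fun x => f x - g x) a b.
Proof. by move=> fc gc x xab; apply: continuousB; [exact: fc|exact: gc]. Qed.

Lemma sint_split f a m b : a <= m -> m <= b -> scont f a b ->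
  sint f a b = sint f a m + sint f m b.
Proof.
move=> am mb fc; have fi := scont_integrable fc.
have := @Rintegral_itvB R f (BLeft a) (BRight b) m fi.
rewrite !bnd_simp => /(_ am mb); rewrite -/(sint f a b) -/(sint f a m) => E.
rewrite -[LHS](subrK (sint f a m)) E addrC; congr (_ + _).
rewrite /sint Rintegral_itv_obnd_cbnd//.
by apply: integrableS fi => // x /=; rewrite !in_itv/= => /andP[/ltW/(le_trans am) -> ->].
Qed.

Lemma sintB f g a b : scont f a b -> scont g a b ->
  sint (fun x => f x - g x) a b = sint f a b - sint g a b.
Proof. by move=> fc gc; rewrite /sint RintegralB//; exact: scont_integrable. Qed.

Lemma sint_cst k a b : a <= b -> sint (fun=> k) a b = k * (b - a).
Proof.
move=> ab; rewrite /sint Rintegral_cst//; congr (_ * _).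
rewrite /= lebesgue_measure_itv/= lte_fin; case: ltP => //= ba.
by rewrite (@le_anti _ _ a b) ?subrr// ab.
Qed.

Lemma le_sint f g a b : scont f a b -> scont g a b ->
  (forall x, a <= x <= b -> f x <= g x) -> sint f a b <= sint g a b.
Proof.
move=> fc gc fg; apply: le_Rintegral => //; exact: scont_integrable.
Qed.

Lemma scont_cst k a b : scont (fun=> k) a b.
Proof. by move=> x _; exact: cst_continuous. Qed.

Lemma sint_ge f k a b : a <= b -> scont f a b ->
  (forall x, a <= x <= b -> k <= f x) -> k * (b - a) <= sint f a b.
Proof.
by move=> ab fc h; rewrite -sint_cst//; apply: le_sint => //; exact: scont_cst.
Qed.

Lemma sint_le f k a b : a <= b -> scont f a b ->
  (forall x, a <= x <= b -> f x <= k) -> sint f a b <= k * (b - a).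
Proof.
by move=> ab fc h; rewrite -sint_cst//; apply: le_sint => //; exact: scont_cst.
Qed.

Lemma sint_close f k e a b : a <= b -> scont f a b ->
  (forall x, a <= x <= b -> `|f x - k| <= e) ->
  `|sint f a b - k * (b - a)| <= e * (b - a).
Proof.
move=> ab fc h.
have h1 : sint f a b <= (k + e) * (b - a).
  by apply: sint_le => // x /h; rewrite ler_distl => /andP[].
have h2 : (k - e) * (b - a) <= sint f a b.
  by apply: sint_ge => // x /h; rewrite ler_distl => /andP[].
by rewrite ler_norml; apply/andP; split; lra.
Qed.

Definition pdiff P x y A B := forall e, 0 < e -> exists2 d, 0 < d &
  forall x' y', `|x' - x| < d -> `|y' - y| < d ->
  `|P x' y' - P x y - A * (x' - x) - B * (y' - y)| <= e * (`|x' - x| + `|y' - y|).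

Lemma pdiff_near P x y A B e : pdiff P x y A B -> 0 < e ->
  exists2 d, 0 < d & forall x' y', `|x' - x| < d -> `|y' - y| < d ->
    `|P x' y' - P x y| < e.
Proof.
move=> /(_ 1 ltr01)[d d0 h] e0.
set K := `|A| + `|B| + 3; have K0 : 0 < K by rewrite ltr_wpDl// addr_ge0.
exists (Num.min d (e / K)); first by rewrite lt_min d0 divr_gt0.
move=> x' y'; rewrite !lt_min => /andP[xd xe] /andP[yd ye].
have := h _ _ xd yd; rewrite mul1r => {}h.
have -> : P x' y' - P x y = (P x' y' - P x y - A * (x' - x) - B * (y' - y)) +
  (A * (x' - x) + B * (y' - y)) by ring.
rewrite (le_lt_trans (ler_normD _ _))//.
apply: le_lt_trans (lerD h (ler_normD _ _)) _; rewrite !normrM.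
apply: (@le_lt_trans _ _ ((2 + `|A| + `|B|) * (e / K))); last first.
  by rewrite mulrCA gtr_pMr// ltr_pdivrMr// mul1r /K; lra.
have h1 := ler_wpM2l (normr_ge0 A) (ltW xe).
have h2 := ler_wpM2l (normr_ge0 B) (ltW ye).
lra.
Qed.

Lemma pdiff_cont1 P x y A B : pdiff P x y A B -> {for x, continuous (P ^~ y)}.
Proof.
move=> h; apply/cvgrPdist_lt => e e0; have [d d0 hd] := pdiff_near h e0.
apply/nbhs_ballP; exists d => //= t; rewrite /ball/= => td.
by rewrite distrC hd// ?subrr ?normr0// distrC.
Qed.

Lemma pdiff_cont2 P x y A B : pdiff P x y A B -> {for y, continuous (P x)}.
Proof.
move=> h; apply/cvgrPdist_lt => e e0; have [d d0 hd] := pdiff_near h e0.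
apply/nbhs_ballP; exists d => //= t; rewrite /ball/= => td.
by rewrite distrC hd// ?subrr ?normr0// distrC.
Qed.

(* The integral of P dx + Q dy along the boundary of [a, a + w] x [c, c + h]. *)
Definition rint P Q a c w h := sint (P ^~ c) a (a + w) - sint (P ^~ (c + h)) a (a + w)
  + (sint (Q (a + w)) c (c + h) - sint (Q a) c (c + h)).

(** The shared [B] is the equation dP/dy = dQ/dx, imposed pointwise, with no continuity of the
    derivatives. *)
Definition closed_form P Q a c w h := forall x y, a <= x <= a + w -> c <= y <= c + h ->
  exists A B E, pdiff P x y A B /\ pdiff Q x y B E.

Section Rectangle.
Variables (P Q : R -> R -> R).

Lemma closed_scont1 a c w h y : closed_form P Q a c w h -> c <= y <= c + h ->
  scont (P ^~ y) a (a + w).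
Proof.
by move=> H yc x xa; have [A [B [E [h1 _]]]] := H x y xa yc; exact: pdiff_cont1 h1.
Qed.

Lemma closed_scont2 a c w h x : closed_form P Q a c w h -> a <= x <= a + w ->
  scont (Q x) c (c + h).
Proof.
by move=> H xa y yc; have [A [B [E [_ h2]]]] := H x y xa yc; exact: pdiff_cont2 h2.
Qed.

Lemma closed_formS a c w h a' c' w' h' : closed_form P Q a c w h ->
  a <= a' -> c <= c' -> a' + w' <= a + w -> c' + h' <= c + h ->
  closed_form P Q a' c' w' h'.
Proof.
move=> H aa cc ww hh x y /andP[x1 x2] /andP[y1 y2]; apply: H.
  by rewrite (le_trans aa)// (le_trans x2).
by rewrite (le_trans cc)// (le_trans y2).
Qed.

Lemma rint_quad a c w h : 0 <= w -> 0 <= h -> closed_form P Q a c (w + w) (h + h) ->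
  rint P Q a c (w + w) (h + h) =
  rint P Q a c w h + rint P Q (a + w) c w h +
  (rint P Q a (c + h) w h + rint P Q (a + w) (c + h) w h).
Proof.
move=> w0 h0 H; rewrite /rint !addrA.
have s1 y : c <= y <= c + (h + h) -> sint (P ^~ y) a (a + w + w) =
    sint (P ^~ y) a (a + w) + sint (P ^~ y) (a + w) (a + w + w).
  move=> yc; rewrite -sint_split ?lerDl//.
  by rewrite -addrA; exact: closed_scont1 H yc.
have s2 x : a <= x <= a + (w + w) -> sint (Q x) c (c + h + h) =
    sint (Q x) c (c + h) + sint (Q x) (c + h) (c + h + h).
  move=> xa; rewrite -sint_split ?lerDl//.
  by rewrite -addrA; exact: closed_scont2 H xa.
rewrite !s1 ?s2; do ?[by apply/andP; split; lra]; ring.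
Qed.

(** Opposite sides are paired. The affine parts of [P] and [Q] contribute [- B * h * w] and
    [B * w * h], which cancel; each pair leaves an error of at most [2 * e * (w + h)] times its
    length. *)
Lemma rint_small a c w h x y A B E d e : 0 <= w -> 0 <= h ->
  closed_form P Q a c w h -> a <= x <= a + w -> c <= y <= c + h -> w < d -> h < d -> 0 < e ->
  (forall x' y', `|x' - x| < d -> `|y' - y| < d ->
  `|P x' y' - P x y - A * (x' - x) - B * (y' - y)| <= e * (`|x' - x| + `|y' - y|)) ->
  (forall x' y', `|x' - x| < d -> `|y' - y| < d ->
  `|Q x' y' - Q x y - B * (x' - x) - E * (y' - y)| <= e * (`|x' - x| + `|y' - y|)) ->
  `|rint P Q a c w h| <= 2 * e * (w + h) ^+ 2.
Proof.
move=> w0 h0 H xa yc wd hd e0 hP hQ.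
have dx x' : a <= x' <= a + w -> `|x' - x| <= w.
  by move=> xa'; rewrite ler_norml; apply/andP; split; lra.
have dy y' : c <= y' <= c + h -> `|y' - y| <= h.
  by move=> yc'; rewrite ler_norml; apply/andP; split; lra.
have aw : a <= a + w by rewrite lerDl.
have ch : c <= c + h by rewrite lerDl.
have cc : c <= c <= c + h by rewrite lexx.
have hh : c <= c + h <= c + h by rewrite lexx andbT.
have aa : a <= a <= a + w by rewrite lexx.
have ww : a <= a + w <= a + w by rewrite lexx andbT.
have rw : rint P Q a c w h = (sint (fun x => P x c - P x (c + h)) a (a + w)) +
   (sint (fun y => Q (a + w) y - Q a y) c (c + h)).
  rewrite /rint !sintB//;
  by [exact: closed_scont1 H _|exact: closed_scont2 H _].
have eb x' y' : a <= x' <= a + w -> c <= y' <= c + h ->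
    e * (`|x' - x| + `|y' - y|) <= e * (w + h).
  by move=> xa' ya'; rewrite ler_wpM2l ?(ltW e0)// lerD ?dx ?dy.
have b1 : `|sint (fun x => P x c - P x (c + h)) a (a + w) - (- B * h) * (a + w - a)|
    <= (e * (w + h) + e * (w + h)) * (a + w - a).
  apply: sint_close => //.
    by apply: scontB; exact: closed_scont1 H _.
  move=> x' xa'.
  have p1 := hP x' c (le_lt_trans (dx _ xa') wd) (le_lt_trans (dy _ cc) hd).
  have p2 := hP x' (c+h) (le_lt_trans (dx _ xa') wd) (le_lt_trans (dy _ hh) hd).
  have {}p1 := le_trans p1 (eb _ _ xa' cc).
  have {}p2 := le_trans p2 (eb _ _ xa' hh).
  apply: le_trans (lerD p1 p2); apply: le_trans (ler_normB _ _).
  by rewrite le_eqVlt; apply/orP; left; apply/eqP; congr (`|_|); ring.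
have b2 : `|sint (fun y => Q (a + w) y - Q a y) c (c + h) - (B * w) * (c + h - c)|
    <= (e * (w + h) + e * (w + h)) * (c + h - c).
  apply: sint_close => //.
    by apply: scontB; exact: closed_scont2 H _.
  move=> y' yc'.
  have p1 := hQ (a + w) y' (le_lt_trans (dx _ ww) wd) (le_lt_trans (dy _ yc') hd).
  have p2 := hQ a y' (le_lt_trans (dx _ aa) wd) (le_lt_trans (dy _ yc') hd).
  have {}p1 := le_trans p1 (eb _ _ ww yc').
  have {}p2 := le_trans p2 (eb _ _ aa yc').
  apply: le_trans (lerD p1 p2); apply: le_trans (ler_normB _ _).
  by rewrite le_eqVlt; apply/orP; left; apply/eqP; congr (`|_|); ring.
rewrite rw.
have -> : forall u v : R, u + v = (u - (- B * h) * (a + w - a)) +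
  (v - (B * w) * (c + h - c)) by move=> u v; ring.
rewrite (le_trans (ler_normD _ _))// (le_trans (lerD b1 b2))//.
by rewrite le_eqVlt; apply/orP; left; apply/eqP; ring.
Qed.

Lemma expr2_half n (W : R) : W / 2 ^+ n = W / 2 ^+ n.+1 + W / 2 ^+ n.+1.
Proof. by rewrite exprS; field; rewrite expf_neq0. Qed.

Lemma half_pow_lt (W d : R) : 0 < d -> exists n, W / 2 ^+ n < d.
Proof.
move=> d0; exists (Num.bound `|W / d|).
rewrite ltr_pdivrMr ?exprn_gt0// -ltr_pdivrMl// mulrC.
rewrite (le_lt_trans (ler_norm _))// (lt_trans (archi_boundP _))//.
by rewrite -natrX ltr_nat ltn_expl.
Qed.

End Rectangle.
End Goursat.

Section GoursatTheorem.
Context {R : realType}.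
Variables (P Q : R -> R -> R).

(** The integral is the sum over the four quarters, so one quarter must keep a fourth of the lower
    bound. *)
Lemma rint_sub a c w h n (W H : R) : 0 <= W -> 0 <= H ->
  w = W / 2 ^+ n -> h = H / 2 ^+ n ->
  closed_form P Q a c w h -> forall K, K / 4 ^+ n < `|rint P Q a c w h| ->
  exists x y, [/\ a <= x, x + W / 2 ^+ n.+1 <= a + w, c <= y, y + H / 2 ^+ n.+1 <= c + h &
    K / 4 ^+ n.+1 < `|rint P Q x y (W / 2 ^+ n.+1) (H / 2 ^+ n.+1)| ].
Proof.
move=> W0 H0 wE hE cf K Kb; set w' := W / 2 ^+ n.+1; set h' := H / 2 ^+ n.+1.
have ww : w = w' + w' by rewrite wE expr2_half.
have hh : h = h' + h' by rewrite hE expr2_half.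
have w'0 : 0 <= w' by rewrite divr_ge0// exprn_ge0.
have h'0 : 0 <= h' by rewrite divr_ge0// exprn_ge0.
apply: contrapT => hn.
have {}hn x y : a <= x -> x + w' <= a + w -> c <= y -> y + h' <= c + h ->
  `|rint P Q x y w' h'| <= K / 4 ^+ n.+1.
  by move=> h1 h2 h3 h4; rewrite leNgt; apply/negP => h5; apply: hn; exists x, y.
move: Kb; apply/negP; rewrite -leNgt.
rewrite ww hh rint_quad//; last by rewrite -ww -hh.
have -> : K / 4 ^+ n = K / 4 ^+ n.+1 + K / 4 ^+ n.+1 + (K / 4 ^+ n.+1 + K / 4 ^+ n.+1).
  by rewrite exprS; field; rewrite expf_neq0.
rewrite (le_trans (ler_normD _ _))// lerD//;
  rewrite (le_trans (ler_normD _ _))// lerD// hn//; lra.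
Qed.

Theorem goursat a c w h : 0 <= w -> 0 <= h -> closed_form P Q a c w h ->
  rint P Q a c w h = 0.
Proof.
move=> w0 h0 cf; apply: contrapT => /eqP J0.
(* Halving makes the bound [K / 4 ^+ n] strict already at stage 0. *)
set J := rint P Q a c w h in J0; set K := `|J| / 2.
have K0 : 0 < K by rewrite divr_gt0// normr_gt0.
pose good (n : nat) (p : R * R) := [/\ a <= p.1, p.1 + w / 2 ^+ n <= a + w, c <= p.2,
   p.2 + h / 2 ^+ n <= c + h &
   K / 4 ^+ n < `|rint P Q p.1 p.2 (w / 2 ^+ n) (h / 2 ^+ n)|].
(* The implication sits under the existential to make the step total, so that a choice function can
   be iterated. *)
have step n p : exists q, good n p -> good n.+1 q /\
   [/\ p.1 <= q.1, q.1 + w / 2 ^+ n.+1 <= p.1 + w / 2 ^+ n,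
       p.2 <= q.2 & q.2 + h / 2 ^+ n.+1 <= p.2 + h / 2 ^+ n].
  have [gp|] := pselect (good n p); last by exists p.
  case: gp => g1 g2 g3 g4 g5.
  have cf' := closed_formS cf g1 g3 g2 g4.
  have [x [y [h1 h2 h3 h4 h5]]] := rint_sub w0 h0 erefl erefl cf' g5.
  exists (x, y) => _; split; split => //=.
  - exact: le_trans h1.
  - exact: le_trans g2.
  - exact: le_trans h3.
  - exact: le_trans g4.
pose nxt n p := projT1 (cid (step n p)).
have nxtP n p : good n p -> _ := projT2 (cid (step n p)).
pose u := fix u n := if n is n'.+1 then nxt n' (u n') else (a, c).
have gu n : good n (u n).
  elim: n => [|n IH]; last by have [] := nxtP _ _ IH.
  rewrite /u /good /= !expr0 !divr1; split => //.
  by rewrite /K -/J ltr_pdivrMr// ltr_pMr ?normr_gt0// (ltr_nat _ 1 2).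
have un n : [/\ (u n).1 <= (u n.+1).1, (u n.+1).1 + w / 2 ^+ n.+1 <= (u n).1 + w / 2 ^+ n,
       (u n).2 <= (u n.+1).2 & (u n.+1).2 + h / 2 ^+ n.+1 <= (u n).2 + h / 2 ^+ n].
  by have [_] := nxtP _ _ (gu n).
have nested (v : nat -> R) (s : R) : 0 <= s -> (forall n, v n <= v n.+1) ->
    (forall n, v n.+1 + s / 2 ^+ n.+1 <= v n + s / 2 ^+ n) ->
    exists x, forall n, v n <= x <= v n + s / 2 ^+ n.
  move=> s0 vi vd.
  have vi' : {homo v : m n / (m <= n)%N >-> m <= n}.
    by apply: homo_leq => // x y z; exact: le_trans.
  have vd' : {homo (fun n => v n + s / 2 ^+ n) : m n / (m <= n)%N >-> n <= m}.
    by apply: (homo_leq (r := fun x y => y <= x)) => // x y z /[swap]; exact: le_trans.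
  have ub m n : v n <= v m + s / 2 ^+ m.
    have [mn|/ltnW nm] := leqP m n.
      by apply: le_trans (vd' _ _ mn); rewrite lerDl divr_ge0// exprn_ge0.
    by rewrite (le_trans (vi' _ _ nm))// lerDl divr_ge0// exprn_ge0.
  exists (sup (range v)) => n; apply/andP; split.
    apply: ub_le_sup; last by exists n.
    by exists (v n + s / 2 ^+ n) => _ [m _ <-].
  by apply: ge_sup; [exists (v n), n | move=> _ [m _ <-]].
have [x hx] : exists x, forall n, (u n).1 <= x <= (u n).1 + w / 2 ^+ n.
  by apply: (nested (fun n => (u n).1)) => // n; case: (un n).
have [y hy] : exists y, forall n, (u n).2 <= y <= (u n).2 + h / 2 ^+ n.
  by apply: (nested (fun n => (u n).2)) => // n; case: (un n).
have x0 : a <= x <= a + w by have := hx 0%N; rewrite /= expr0 divr1.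
have y0 : c <= y <= c + h by have := hy 0%N; rewrite /= expr0 divr1.
have [A [B [E [hP hQ]]]] := cf _ _ x0 y0.
(* The summand 1 keeps [S] positive for degenerate rectangles, and [e] is tuned so that the bound of
   [rint_small] at stage n is at most [2 * e * (S / 2 ^+ n) ^+ 2 = K / 4 ^+ n]. *)
set S := w + h + 1; have S0 : 0 < S by rewrite ltr_wpDl// addr_ge0.
set e := K / (2 * S ^+ 2); have e0 : 0 < e by rewrite divr_gt0// mulr_gt0// exprn_gt0.
have [d1 d10 h1] := hP _ e0; have [d2 d20 h2] := hQ _ e0.
set d := Num.min d1 d2; have d0 : 0 < d by rewrite lt_min d10.
have [n nd] := half_pow_lt S d0.
have p2 : 0 < (2 : R) ^+ n by rewrite exprn_gt0.
have wS : w <= S by rewrite /S; lra.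
have hS : h <= S by rewrite /S; lra.
have [g1 g2 g3 g4 g5] := gu n.
move: g5; apply/negP; rewrite -leNgt.
have w'0 : 0 <= w / 2 ^+ n by rewrite divr_ge0// ltW.
have h'0 : 0 <= h / 2 ^+ n by rewrite divr_ge0// ltW.
have -> : K / 4 ^+ n = 2 * e * (S / 2 ^+ n) ^+ 2.
  have -> : (4 : R) ^+ n = (2 ^+ n) ^+ 2.
    by rewrite -exprM mulnC exprM; congr (_ ^+ n); ring.
  by rewrite /e; move: p2; set q := 2 ^+ n => p2; field; rewrite !gt_eqF.
apply: (le_trans (rint_small w'0 h'0 (closed_formS cf g1 g3 g2 g4) (hx n) (hy n)
  (d := d) (A := A) (B := B) (E := E) _ _ e0 _ _)).
- by rewrite (le_lt_trans _ nd)// ler_pM2r// invr_gt0.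
- by rewrite (le_lt_trans _ nd)// ler_pM2r// invr_gt0.
- by move=> x' y'; rewrite !lt_min => /andP[k1 _] /andP[k2 _]; exact: h1.
- by move=> x' y'; rewrite !lt_min => /andP[_ k1] /andP[_ k2]; exact: h2.
rewrite ler_wpM2l ?(ltW (mulr_gt0 _ _))// ler_sqr ?nnegrE ?addr_ge0//; last first.
  by rewrite divr_ge0 ?ltW.
by rewrite -mulrDl ler_pM2r ?invr_gt0// /S lerDl.
Qed.

End GoursatTheorem.

(** * Mean values and the maximum principle *)

Section MeanValue.
Context {R : realType}.
Implicit Types (a c z w : R[i]) (F G : R[i] -> R[i]).
Local Open Scope complex_scope.

Lemma is_derive_littleo (f : R -> R) (x l e : R) : is_derive x 1 f l -> 0 < e ->
  exists2 d, 0 < d & forall y, `|y - x| < d -> `|f y - f x - l * (y - x)| <= e * `|y - x|.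
Proof.
move=> [fd fl] e0.
have : h^-1 *: (f (h *: 1 + x) - f x) @[h --> 0^'] --> l by rewrite -fl; exact: fd.
move=> /cvgrPdist_le /(_ _ e0) /nbhs_ballP[d /= d0 hd].
exists d => // y yd; have [->|yx] := eqVneq y x; first by rewrite !subrr mulr0 subrr normr0 mulr0.
have yx0 : y - x != 0 by rewrite subr_eq0.
have := hd (y - x); rewrite /ball/= sub0r normrN => /(_ yd yx0).
rewrite /GRing.scale/= mulr1 subrK => h.
have -> : f y - f x - l * (y - x) = - ((l - (y - x)^-1 * (f y - f x)) * (y - x)).
  by field.
by rewrite normrN normrM ler_wpM2r.
Qed.

Definition cexp z : R[i] :=
  (expR (complex.Re z) * cos (complex.Im z)) +i* (expR (complex.Re z) * sin (complex.Im z)).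

Lemma cexpD z w : cexp (z + w) = cexp z * cexp w.
Proof.
by apply: eqc; rewrite ?ReM ?ImM /= ReD ImD expRD ?cosD ?sinD; ring.
Qed.

Lemma cexp0 : cexp 0 = 1.
Proof. by apply: eqc; rewrite /= expR0 ?cos0 ?sin0 !mul1r. Qed.

Lemma cabs_cexp z : cabs (cexp z) = expR (complex.Re z).
Proof.
rewrite cabsE /= !exprMn -mulrDr cos2Dsin2 mulr1 sqrtr_sqr; apply: ger0_norm; exact: expR_ge0.
Qed.

Lemma cexp_periodic x (y : R) : cexp (x +i* (y + 2 * pi)) = cexp (x +i* y).
Proof. by rewrite /cexp /= mulr_natl cosD2pi sinD2pi. Qed.

Lemma cdiff_littleo F a (l : R[i]) :
  (forall e, 0 < e -> cnear a (fun z => cabs (F z - F a - l * (z - a)) <= e * cabs (z - a))) ->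
  cdiff F a.
Proof.
move=> h; exists (fun z => if z == a then l else (F z - F a) / (z - a)).
  move=> e e0; have e20 : 0 < e / 2 by rewrite divr_gt0.
  apply: cnearS (h _ e20) => z; rewrite eqxx.
  case: eqVneq => [_ _|za hz]; first by rewrite subrr cabs0.
  have za0 : z - a != 0 by rewrite subr_eq0.
  have -> : (F z - F a) / (z - a) - l = (F z - F a - l * (z - a)) / (z - a) by field.
  rewrite cabsM cabsV ltr_pdivrMr ?cabs_gt0// (le_lt_trans hz)//.
  by rewrite ltr_pM2r ?cabs_gt0// ltr_pdivrMr// ltr_pMr// (ltr_nat _ 1 2).
apply: cnearT => z; case: eqVneq => [->|za]; first by rewrite subrr mulr0 addr0.
by rewrite divfK ?subr_eq0// addrC subrK.
Qed.

Lemma cdiff_cexp a : cdiff cexp a.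
Proof.
suff h0 : cdiff cexp 0.
  have : cdiff (fun z => cexp a * cexp (z - a)) a.
    apply: cdiffM; first exact: cdiff_cst.
    apply: (cdiff_comp (F := cexp) (G := fun z => z - a)).
      by apply: cdiffB; [exact: cdiff_id|exact: cdiff_cst].
    by rewrite subrr.
  by apply: cdiff_near; apply: cnearT => z; rewrite -cexpD subrKC.
apply: (@cdiff_littleo _ _ 1) => e e0.
have [m [m0 m1 me]] : exists m : R, [/\ 0 < m, m <= 1 & m <= e / 8].
  by exists (Num.min (e / 8) 1); rewrite lt_min divr_gt0// !ge_min !lexx orbT ltr01.
have [d1 d10 h1] := is_derive_littleo (is_derive_expR (0 : R)) m0.
have [d2 d20 h2] := is_derive_littleo (is_derive_cos (0 : R)) m0.
have [d3 d30 h3] := is_derive_littleo (is_derive_sin (0 : R)) m0.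
exists (Num.min m (Num.min d1 (Num.min d2 d3))); first by rewrite !lt_min m0 d10 d20.
move=> z; rewrite !subr0 mul1r cexp0 !lt_min => /and4P[zm z1 z2 z3].
set x := complex.Re z; set y := complex.Im z.
have xz : `|x| <= cabs z by exact: normRe_le.
have yz : `|y| <= cabs z by exact: normIm_le.
have := h1 x; rewrite !subr0 expR0 mul1r => /(_ (le_lt_trans xz z1)) {}h1.
have := h2 y; rewrite !subr0 cos0 sin0 oppr0 mul0r subr0 => /(_ (le_lt_trans yz z2)) {}h2.
have := h3 y; rewrite !subr0 sin0 cos0 mul1r subr0 => /(_ (le_lt_trans yz z3)) {}h3.
have x1 : `|x| <= m by rewrite (le_trans xz)// ltW.
have cz := cabs_ge0 z.
have mz : m * `|x| <= m * cabs z by rewrite ler_wpM2l// ltW.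
have mz' : m * `|y| <= m * cabs z by rewrite ler_wpM2l// ltW.
apply: le_trans (cabs_leD _) _; rewrite !ReD !ImD !ReN !ImN /= -/x -/y subr0.
have -> : expR x * cos y - 1 - x = (expR x - 1 - x) * cos y + (cos y - 1) * (1 + x) by ring.
have -> : expR x * sin y - y = (expR x - 1) * sin y + (sin y - y) by ring.
have b1 : `|(expR x - 1 - x) * cos y| <= m * cabs z.
  rewrite normrM (le_trans _ mz)// (le_trans _ h1)// ler_piMr//.
  by rewrite ler_norml cos_geN1 cos_le1.
have b2 : `|(cos y - 1) * (1 + x)| <= 2 * m * cabs z.
  rewrite normrM mulrC -mulrA ler_pM// ?(le_trans h2)//.
  by rewrite (le_trans (ler_normD _ _))// normr1 -natr1 lerD// (le_trans x1).
have b3 : `|(expR x - 1) * sin y| <= 4 * m * cabs z.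
  rewrite normrM.
  have e1 : `|expR x - 1| <= 2 * m.
    have -> : expR x - 1 = (expR x - 1 - x) + x by ring.
    rewrite (le_trans (ler_normD _ _))// (le_trans (lerD h1 x1))//.
    have := ler_pM (ltW m0) (normr_ge0 x) m1 x1; lra.
  have e2 : `|sin y| <= 2 * cabs z.
    have -> : sin y = (sin y - y) + y by ring.
    rewrite (le_trans (ler_normD _ _))// (le_trans (lerD h3 yz))//.
    have := ler_pM (ltW m0) (normr_ge0 y) m1 yz; lra.
  have := ler_pM (normr_ge0 _) (normr_ge0 _) e1 e2; lra.
have t1 := ler_normD ((expR x - 1 - x) * cos y) ((cos y - 1) * (1 + x)).
have t2 := ler_normD ((expR x - 1) * sin y) (sin y - y).
have := ler_wpM2r cz me; lra.
Qed.

(** The form Im G dx + Re G dy is the imaginary part of G dz; the Cauchy-Riemann equations provide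
    the common coefficient [B], the real part of the derivative. *)
Lemma cdiff_closed G (x y : R) : cdiff G (x +i* y) -> exists A B E,
  pdiff (fun x y => complex.Im (G (x +i* y))) x y A B /\
  pdiff (fun x y => complex.Re (G (x +i* y))) x y B E.
Proof.
case=> Phi Pc hP; set l := Phi (x +i* y).
exists (complex.Im l), (complex.Re l), (- complex.Im l).
have key e : 0 < e -> exists2 d, 0 < d & forall x' y', `|x' - x| < d -> `|y' - y| < d ->
    cabs (G (x' +i* y') - G (x +i* y) - l * ((x' - x) +i* (y' - y))) <= e * (`|x' - x| + `|y' - y|).
  move=> e0; case: (cnearI hP (Pc _ e0)) => d d0 hd.
  exists (d / 2); first by rewrite divr_gt0.
  move=> x' y' xd yd.
  have zE : (x' +i* y') - (x +i* y) = (x' - x) +i* (y' - y) by [].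
  have le1 : cabs ((x' - x) +i* (y' - y)) <= `|x' - x| + `|y' - y| by exact: cabs_leD.
  have [] := hd (x' +i* y').
    by rewrite zE (le_lt_trans le1)// [d]splitr ltrD.
  move=> -> h; rewrite zE [G _ + _]addrC addrK -mulrBl cabsM.
  by rewrite (le_trans (ler_wpM2l (cabs_ge0 _) le1))// ler_wpM2r ?addr_ge0// ltW.
split=> e /key [d d0 hd]; exists d => // x' y' xd yd; apply: le_trans (hd _ _ xd yd).
- apply: le_trans (normIm_le _); rewrite !(ImD, ImN, ImM)/=.
  by rewrite le_eqVlt; apply/orP; left; apply/eqP; congr `|_|; ring.
- apply: le_trans (normRe_le _); rewrite !(ReD, ReN, ReM)/=.
  by rewrite le_eqVlt; apply/orP; left; apply/eqP; congr `|_|; ring.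
Qed.

(* Goursat's theorem for z |-> F (c + exp z) on [a, b] x [0, 2 pi] shows that the mean of
   [Re F] over circles about [c] does not depend on the radius. *)
Lemma no_strict_Re_max F c (rho e : R) : 0 < rho -> 0 < e -> ccont F c ->
  (forall z, 0 < cabs (z - c) < rho -> cdiff F z) ->
  (forall z, cabs (z - c) < rho -> complex.Re (F z) <= complex.Re (F c) - e * cabs (z - c) ^+ 2) ->
  False.
Proof.
move=> rho0 e0 Fc Fd Fm.
pose G z := F (c + cexp z).
set s := rho / 2; have s0 : 0 < s by rewrite divr_gt0.
have srho : s < rho by rewrite /s ltr_pdivrMr// ltr_pMr// (ltr_nat _ 1 2).
have Gd z : complex.Re z <= ln s -> cdiff G z.
  move=> zs; apply: (cdiff_comp (F := F) (G := fun z => c + cexp z)).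
    by apply: cdiffD; [exact: cdiff_cst|exact: cdiff_cexp].
  apply: Fd; rewrite [c + _]addrC addrK cabs_cexp expR_gt0/= (le_lt_trans _ srho)//.
  by rewrite -[leRHS]lnK ?posrE// ler_expR.
have k0 : 0 < e * s ^+ 2 / 2 by rewrite divr_gt0// mulr_gt0// exprn_gt0.
have [d d0 hd] := Fc _ k0.
(* The side over [a] runs along a circle so small that [Re F] exceeds [Re (F c) - e * s ^+ 2 / 2]
   there, while on the circle of radius [s] it is at most [Re (F c) - e * s ^+ 2]. As exp omits 0,
   differentiability at [c] is never invoked. *)
set a := ln (Num.min s (d / 2)); set b := ln s.
have m0 : 0 < Num.min s (d / 2) by rewrite lt_min s0 divr_gt0.
have ab : a <= b by rewrite ler_ln ?posrE// ge_min lexx.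
have pi2 : (0 : R) < 2 * pi by rewrite mulr_gt0// pi_gt0.
set P := fun x y => complex.Im (G (x +i* y)).
set Q := fun x y => complex.Re (G (x +i* y)).
have cf : closed_form P Q a 0 (b - a) (2 * pi).
  by move=> x y xa _; apply/cdiff_closed/Gd => /=; rewrite -/b; lra.
have : rint P Q a 0 (b - a) (2 * pi) = 0 by apply: goursat => //; lra.
(* By periodicity of exp the horizontal sides cancel, leaving equal integrals over the two
   circles. *)
rewrite /rint (_ : P ^~ (0 + 2 * pi) = P ^~ 0); last first.
  by apply/funext => x; rewrite /P /G cexp_periodic.
rewrite subrr add0r add0r subrKC => /subr0_eq.
have sc x : a <= x <= b -> scont (Q x) 0 (2 * pi).
  by move=> xab; rewrite -[2 * pi]add0r; apply: closed_scont2 cf _; rewrite subrKC.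
have hb : sint (Q b) 0 (2 * pi) <= (complex.Re (F c) - e * s ^+ 2) * (2 * pi - 0).
  apply: sint_le; [exact: ltW|by apply: sc; rewrite ab lexx|move=> y _].
  have nE : cabs (c + cexp (b +i* y) - c) = s.
    by rewrite [c + _]addrC addrK cabs_cexp /= lnK ?posrE.
  by have := Fm (c + cexp (b +i* y)); rewrite nE; apply.
have ha : (complex.Re (F c) - e * s ^+ 2 / 2) * (2 * pi - 0) <= sint (Q a) 0 (2 * pi).
  apply: sint_ge; [exact: ltW|by apply: sc; rewrite ab lexx|move=> y _].
  have nE : cabs (c + cexp (a +i* y) - c) < d.
    rewrite [c + _]addrC addrK cabs_cexp /= lnK ?posrE// gt_min.
    by apply/orP; right; rewrite ltr_pdivrMr// ltr_pMr// (ltr_nat _ 1 2).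
  have := hd _ nE; rewrite /Q /G => h.
  have := le_lt_trans (normRe_le _) h; rewrite ReD ReN ltr_distl => /andP[+ _].
  exact: ltW.
move=> EQ; move: ha; rewrite -EQ => ha; have := le_trans ha hb.
rewrite ler_pM2r; last by rewrite subr0.
by rewrite lerD2l lerN2 leNgt ltr_pdivrMr// ltr_pMr ?(ltr_nat _ 1 2)// mulr_gt0// exprn_gt0.
Qed.

End MeanValue.

Section MaximumPrinciple.
Context {R : realType}.
Implicit Types (a c z : R[i]) (F H : R[i] -> R[i]) (Q S rho : R[i] -> R).
Local Open Scope complex_scope.

(** If no maximum exists, the superlevel sets of [f] at points of [A] generate a filter along which
    every point of [A] is eventually and locally beaten. Compactness makes this uniform, and then
    some point of [A] beats itself. *)
Lemma usc_compact_max (T : topologicalType) (f : T -> R) (A : set T) :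
  A !=set0 -> compact A ->
  (forall x, A x -> forall e, 0 < e -> \forall y \near x, f y < f x + e) ->
  exists2 c, A c & forall x, A x -> f x <= f c.
Proof.
move=> [x0 Ax0] /compact_near_coveringP cA usc; apply: contrapT => nomax.
have {}nomax x : A x -> exists2 y, A y & f x < f y.
  move=> Ax; apply: contrapT => h; apply: nomax; exists x => // y Ay.
  by rewrite leNgt; apply/negP => fxy; apply: h; exists y.
pose F := filter_from A (fun y => [set i | f y <= f i]).
have FF : Filter F.
  apply: filter_from_filter; first by exists x0.
  move=> i j Ai Aj; have [ij|/ltW ji] := leP (f i) (f j).
    by exists j => // k /= jk; split => //=; exact: le_trans jk.
  by exists i => // k /= jk; split => //=; exact: le_trans jk.
have := cA T F (fun i x => f x < f i) FF.
case=> [x Ax|y Ay].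
  have [y Ay xy] := nomax _ Ax.
  have yx0 : 0 < f y - f x by rewrite subr_gt0.
  exists ([set x' | f x' < f x + (f y - f x)], [set i | f y <= f i]); first split.
  - exact: usc.
  - by exists y.
  by move=> [x' i] /= [h1 h2]; rewrite (lt_le_trans h1)// subrKC.
by move=> /(_ y (lexx _) y Ay) /=; rewrite ltxx.
Qed.

Definition usc Q a := forall e, 0 < e -> cnear a (fun z => Q z < Q a + e).

Lemma cnear_prod (p : R * R) (P : R[i] -> Prop) : cnear (p.1 +i* p.2) P ->
  \forall q \near p, P (q.1 +i* q.2).
Proof.
move=> [d d0 hd]; have d20 : 0 < d / 2 by rewrite divr_gt0.
apply/nbhs_ballP; exists (d / 2) => //= q [] /=; rewrite /ball /= => h1 h2.
apply: hd; apply: le_lt_trans (cabs_leD _) _ => /=.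
by rewrite [d]splitr ltrD// distrC.
Qed.

Lemma usc_disc_max Q (r : R) : 0 <= r -> r <= 1 ->
  (forall z, cabs z <= r -> 0 <= Q z) -> (forall z, cabs z <= r -> usc Q z) ->
  exists2 c, cabs c <= r & forall z, cabs z <= r -> Q z <= Q c.
Proof.
move=> r0 r1 Q0 Qu.
(* Since [Q] is nonnegative on the closed disc, the value -1 off it preserves upper semicontinuity
   and is never the maximum. *)
pose f (p : R * R) := if cabs (p.1 +i* p.2) <= r then Q (p.1 +i* p.2) else -1.
have [||p _ e e0|p Ap pmax] := @usc_compact_max _ f (`[-1, 1] `*` `[-1, 1]).
- by exists (0, 0); split; rewrite /= in_itv/=; lra.
- by apply: compact_setX; exact: segment_compact.
- apply: (@cnear_prod p (fun z => (if cabs z <= r then Q z else -1) < f p + e)).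
  rewrite /f; case: ifP => [pr|/negbT]; last first.
    rewrite -ltNge => pr; exists (cabs (p.1 +i* p.2) - r); first by rewrite subr_gt0.
    move=> z hz; rewrite ifF; first by rewrite ltrDl.
    apply/negbTE; rewrite -ltNge; have := cabs_sub_ge (p.1 +i* p.2) z.
    by rewrite cabsB; lra.
  by apply: cnearS (Qu _ pr _ e0) => z; case: ifP => // _ _; have := Q0 _ pr; lra.
have c0 : cabs (0 : R[i]) <= r by rewrite cabs0.
have inA z : cabs z <= r -> f (complex.Re z, complex.Im z) <= f p.
  move=> zr; apply: pmax; split; rewrite /= in_itv /= -ler_norml.
    by rewrite (le_trans (normRe_le _))// (le_trans zr).
  by rewrite (le_trans (normIm_le _))// (le_trans zr).
have fE z : cabs z <= r -> f (complex.Re z, complex.Im z) = Q z.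
  by case: z => x y zr; rewrite /f /= zr.
have pr : cabs (p.1 +i* p.2) <= r.
  have := inA _ c0; rewrite fE// /f; case: ifP => // _; have := Q0 _ c0; lra.
exists (p.1 +i* p.2) => // z zr; have := inA _ zr; rewrite fE// /f pr.
by [].
Qed.

(** A weak form of subharmonicity: the modulus of a function, holomorphic off [a] and continuous at
    [a], touches [Q] from below at [a]. It suits functions glued as maxima of moduli, which need
    only one supporting branch at each point. *)
Definition csupport Q a := exists F, [/\ ccont F a,
  cnear a (fun z => z != a -> cdiff F z),
  cnear a (fun z => cabs (F z) <= Q z) & cabs (F a) = Q a].

Lemma max_principle Q (B : R) : 0 <= B ->
  (forall z, cabs z < 1 -> 0 <= Q z) ->
  (forall z, cabs z < 1 -> usc Q z) ->
  (forall z, cabs z < 1 -> csupport Q z) ->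
  (forall e, 0 < e -> exists2 r, r < 1 & forall z, r <= cabs z < 1 -> Q z <= B + e) ->
  forall z, cabs z < 1 -> Q z <= B.
Proof.
move=> B0 Q0 Qu Qs Qb z0 z01; rewrite leNgt; apply/negP => Bq.
set q := Q z0 in Bq; set e := (q - B) / 3.
have e0 : 0 < e by rewrite divr_gt0// subr_gt0.
have [r r1 hr] := Qb _ e0.
have z0r : cabs z0 < r.
  rewrite ltNge; apply/negP => rz; have := hr z0; rewrite rz z01 -/q => /(_ isT).
  by rewrite /e; lra.
have r0 : 0 <= r by rewrite (le_trans (cabs_ge0 z0))// ltW.
(* The perturbation makes the maximum strict. On the circle of radius [r] it stays below
   [B + 2 * e], hence below [q = B + 3 * e], so the maximum is taken inside. *)
pose Q1 z := Q z + e * cabs z ^+ 2.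
have lt1 z : cabs z <= r -> cabs z < 1 by move=> /le_lt_trans; apply.
have [||c cr cmax] := @usc_disc_max Q1 r r0 (ltW r1).
- by move=> z /lt1 /Q0 Qz; rewrite addr_ge0// mulr_ge0 ?exprn_ge0 ?cabs_ge0// ltW.
- move=> z /lt1 z1 k k0; have k20 : 0 < k / 2 by rewrite divr_gt0.
  have k4 : 0 < Num.min 1 (k / (6 * e)) by rewrite lt_min ltr01 divr_gt0// mulr_gt0.
  apply: cnearS2 (Qu _ z1 _ k20) (cnear_lt z k4) => y h1; rewrite lt_min => /andP[h2 h3].
  rewrite /Q1.
  have yz : cabs y <= cabs z + cabs (y - z) by rewrite -[X in cabs X <= _](subrKC z) cabsD.
  have y2 : cabs y <= 2 by lra.
  have : cabs y ^+ 2 - cabs z ^+ 2 <= 3 * cabs (y - z).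
    have -> : cabs y ^+ 2 - cabs z ^+ 2 = (cabs y + cabs z) * (cabs y - cabs z) by ring.
    have := cabs_ge0 y; have := cabs_ge0 z; have := cabs_ge0 (y - z).
    have [|] := leP (cabs y) (cabs z) => h4; nra.
  have e60 : 0 < 6 * e by rewrite mulr_gt0.
  move: h3; rewrite ltr_pdivlMr// => h3 h4.
  have := ler_wpM2l (ltW e0) h4; lra.
have z0c := cmax _ (ltW z0r).
have q0 : q <= Q1 c.
  apply: le_trans z0c; rewrite /Q1 lerDl mulr_ge0 ?exprn_ge0 ?cabs_ge0//; exact: ltW.
have cc : cabs c ^+ 2 <= 1 by rewrite expr_le1// ?cabs_ge0// ltW// lt1.
have ec : e * cabs c ^+ 2 <= e by rewrite ler_piMr// ltW.
have {}cr : cabs c < r.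
  rewrite lt_neqAle cr andbT; apply/eqP => crE.
  have := hr c; rewrite crE lexx r1 => /(_ isT) Qc.
  by move: q0; rewrite /Q1; have : e = (q - B) / 3 by []; lra.
have [F [Fc Fd Fle FE]] := Qs _ (lt1 _ (ltW cr)).
have M0 : 0 < cabs (F c).
  by rewrite FE; move: q0; rewrite /Q1; have : e = (q - B) / 3 by []; lra.
(* The factor [u] rotates [F c] to the positive axis. The linear term of [f] has real part
   [e * (|z|^2 - |c|^2 - |z - c|^2)]: it undoes the perturbation and leaves [- e * |z - c|^2], as
   [no_strict_Re_max] requires. *)
pose u : R[i] := (F c)^* / (cabs (F c))%:C.
pose f z := u * F z + (2 * e)%:C * c^* * (z - c).
have u1 : cabs u = 1.
  by rewrite /u cabsM cabs_conj cabsV cabs_real gtr0_norm// divff// gt_eqF.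
have rc : 0 < r - cabs c by rewrite subr_gt0.
have [d d0 hd] := cnearI Fd (cnearI Fle (cnear_lt c rc)).
apply: (@no_strict_Re_max R f c d e d0 e0).
- apply: ccontD; first by apply: ccontM => //; exact: ccont_cst.
  apply: ccontM; first exact: ccont_cst.
  by apply: ccontD; [exact: ccont_id|exact: ccont_cst].
- move=> z /andP[zc zd]; apply: cdiffD.
    apply: cdiffM; first exact: cdiff_cst.
    by have [+ _] := hd _ zd; apply; rewrite -subr_eq0 -cabs_gt0.
  apply: cdiffM; first exact: cdiff_cst.
  by apply: cdiffB; [exact: cdiff_id|exact: cdiff_cst].
move=> z zd; have [_ [h1 h2]] := hd _ zd.
have zr : cabs z <= r.
  have : cabs z <= cabs c + cabs (z - c) by rewrite -[X in cabs X <= _](subrKC c) cabsD.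
  lra.
have := cmax _ zr; rewrite /Q1 -FE => h3.
have fc : complex.Re (f c) = cabs (F c).
  rewrite /f subrr mulr0 addr0 /u.
  have -> : (F c)^* / (cabs (F c))%:C * F c = (cabs (F c))%:C.
    have EE : F c * (F c)^* = (cabs (F c))%:C ^+ 2 by rewrite -normr_cabs sqr_normc.
    rewrite -mulrA [_^-1 * _]mulrC mulrA [_^* * _]mulrC EE expr2 mulfK//.
    by rewrite -normr_cabs normr_eq0 -cabs_gt0.
  by [].
have : complex.Re (u * F z) <= cabs (F z).
  by rewrite (le_trans (Re_le_cabs _))// cabsM u1 mul1r.
rewrite fc /f ReD.
have -> : complex.Re ((2 * e)%:C * c^* * (z - c)) =
   e * (cabs z ^+ 2 - cabs c ^+ 2 - cabs (z - c) ^+ 2).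
  rewrite !sqr_cabs !ReImE; case: c {cmax z0c q0 cc ec cr Fc Fd Fle FE M0 u f u1 rc hd h2 h3 fc zd} => c1 c2.
  by case: z {zr h1} => z1 z2 /=; ring.
by lra.
Qed.

End MaximumPrinciple.

(** * A localized Schwarz lemma *)

Section LocalizedSchwarz.
Context {R : realType}.
Implicit Types (a c z : R[i]) (F H f h : R[i] -> R[i]) (Q S rho : R[i] -> R).
Local Open Scope complex_scope.

Definition rcont rho a := forall e, 0 < e -> cnear a (fun z => `|rho z - rho a| < e).

Lemma usc_max2 Q F G a : ccont F a -> ccont G a ->
  cnear a (fun z => Q z <= Num.max (cabs (F z)) (cabs (G z))) ->
  Num.max (cabs (F a)) (cabs (G a)) <= Q a -> usc Q a.
Proof.
move=> Fc Gc hQ Qa e e0; apply: cnearS2 hQ (cnearI (Fc _ e0) (Gc _ e0)) => z h1 [h2 h3].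
rewrite (le_lt_trans h1)//; move: Qa; rewrite ge_max => /andP[k1 k2].
have := cabs_sub_ge (F z) (F a); have := cabs_sub_ge (G z) (G a).
by rewrite gt_max => *; apply/andP; split; lra.
Qed.

(* Glues |H| near the origin to a constant; the quotient of the result by [cabs z] obeys the
   maximum principle. *)
Lemma schwarz_glue rho H (t k : R) : 0 < t -> 0 <= k -> k <= 1 ->
  (forall z, cabs z < 1 -> rcont rho z) ->
  (forall z, cabs z < 1 -> rho z < 3 * t -> cdiff H z /\ cabs (H z) <= 1) ->
  (forall z, cabs z < 1 -> rho z = t -> k <= cabs (H z)) ->
  (forall z, cabs z < 1 -> 2 * t <= rho z < 3 * t -> cabs (H z) <= k) ->
  rho 0 < t -> H 0 = 0 ->
  forall z, cabs z < 1 -> rho z < t -> cabs (H z) <= cabs z.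
Proof.
move=> t0 k0 k1 rc Hd Ht H2t rho0 H00.
have c01 : cabs (0 : R[i]) < 1 by rewrite cabs0.
have [|P [Pc HP PE]] := @cdiff_quot R H 0.
  by apply: (Hd 0 c01 _).1; lra.
have {}HP z : H z = P z * z by rewrite HP H00 add0r subr0.
have Pd z : cabs z < 1 -> rho z < 3 * t -> z != 0 -> cdiff P z.
  move=> z1 zt z0; have : cdiff (fun y => H y / y) z.
    apply: cdiffM; first by have [] := Hd z z1 zt.
    by apply: cdiffV => //; exact: cdiff_id.
  apply: cdiff_near; have cz0 : 0 < cabs z by rewrite cabs_gt0.
  apply: cnearS (cnear_lt z cz0) => y yz; rewrite HP mulfK//.
  by apply: contraTneq yz => ->; rewrite sub0r cabsN ltxx.
have Pcc z : cabs z < 1 -> rho z < 3 * t -> ccont P z.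
  move=> z1 zt; have [->//|z0] := eqVneq z 0; exact/cdiff_ccont/Pd.
pose G z : R[i] := k%:C / z.
have Gd z : z != 0 -> cdiff G z.
  by move=> z0; apply: cdiffM; [exact: cdiff_cst|exact: (cdiffV (F := id) (cdiff_id z))].
have Gc z : z != 0 -> ccont G z by move=> /Gd /cdiff_ccont.
have GE z : cabs (G z) = k / cabs z by rewrite cabsM cabsV cabs_real ger0_norm.
have rz0 z : t <= rho z -> z != 0.
  by apply: contraTneq => ->; rewrite -ltNge.
have PEz z : z != 0 -> cabs (P z) = cabs (H z) / cabs z.
  by move=> z0; rewrite HP cabsM mulfK// cabs_eq0.
have kP z : z != 0 -> k <= cabs (H z) -> cabs (G z) <= cabs (P z).
  by move=> z0 h; rewrite GE PEz// ler_pM2r// invr_gt0 cabs_gt0.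
have Pk z : z != 0 -> cabs (H z) <= k -> cabs (P z) <= cabs (G z).
  by move=> z0 h; rewrite GE PEz// ler_pM2r// invr_gt0 cabs_gt0.
(* At [rho z = t] the lower bound on [H] gives |P| >= |G|, so the branch [P] supports [Q] across
   this level. At [rho z = 2 * t] the upper bound gives |P| <= |G|, so dropping [P] there keeps [Q]
   upper semicontinuous. *)
pose Q z := if rho z < t then cabs (P z) else
  if rho z < 2 * t then Num.max (cabs (P z)) (cabs (G z)) else cabs (G z).
have rlt z u : cabs z < 1 -> rho z < u -> cnear z (fun y => rho y < u).
  move=> z1 zu; have p : 0 < u - rho z by rewrite subr_gt0.
  by apply: cnearS (rc _ z1 _ p) => y; rewrite ltr_norml => /andP[_]; lra.
have rgt z u : cabs z < 1 -> u < rho z -> cnear z (fun y => u < rho y).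
  move=> z1 zu; have p : 0 < rho z - u by rewrite subr_gt0.
  by apply: cnearS (rc _ z1 _ p) => y; rewrite ltr_norml => /andP[+ _]; lra.
have QlePG z : Q z <= Num.max (cabs (P z)) (cabs (G z)).
  by rewrite /Q; do 2?case: ifP => _ //; rewrite le_max lexx ?orbT.
suff Q1 z : cabs z < 1 -> Q z <= 1.
  move=> z z1 zt; rewrite HP cabsM ler_piMl ?cabs_ge0//.
  by have := Q1 z z1; rewrite /Q zt.
move: z; apply: max_principle => //.
- by move=> z _; rewrite /Q; do 2?case: ifP => _; rewrite ?le_max ?cabs_ge0.
- move=> z z1; have [zt|zt] := ltP (rho z) t.
    apply: (usc_max2 (F := P) (G := P)); try by apply: Pcc => //; lra.
      by apply: cnearS (rlt _ _ z1 zt) => y yt; rewrite /Q yt maxxx.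
    by rewrite maxxx /Q zt.
  have z0 := rz0 _ zt.
  have [z2t|z2t] := leP (rho z) (2 * t); last first.
    apply: (usc_max2 (F := G) (G := G)); try exact: Gc.
      apply: cnearS (rgt _ _ z1 z2t) => y yt.
      by rewrite /Q !ifF ?maxxx//; apply/negbTE; rewrite -leNgt; lra.
    by rewrite maxxx /Q !ifF//; apply/negbTE; rewrite -leNgt; lra.
  apply: (usc_max2 (F := P) (G := G)); [by apply: Pcc => //; lra|exact: Gc| |].
    exact: cnearT.
  rewrite /Q ifF; last by apply/negbTE; rewrite -leNgt.
  case: ifP => // /negbT; rewrite -leNgt => z2.
  by rewrite ge_max lexx andbT Pk// H2t//; lra.
- move=> z z1.
  have nz : cnear z (fun y => y != z -> y != 0).
    have [->|z0] := eqVneq z 0; first exact: cnearT.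
    have cz0 : 0 < cabs z by rewrite cabs_gt0.
    apply: cnearS (cnear_lt z cz0) => y yz _.
    by apply: contraTneq yz => ->; rewrite sub0r cabsN ltxx.
  have n1 : cnear z (fun y => cabs y < 1).
    have cz1 : 0 < 1 - cabs z by rewrite subr_gt0.
    apply: cnearS (cnear_lt z cz1) => y yz.
    have : cabs y <= cabs z + cabs (y - z) by rewrite -[X in cabs X <= _](subrKC z) cabsD.
    lra.
  have [[z2t QE]|[zt QE]] : (rho z < 2 * t /\ Q z = cabs (P z)) \/
      (t < rho z /\ Q z = cabs (G z)).
    rewrite /Q; have [zt|zt] := ltP (rho z) t; first by left; split=> //; lra.
    have [z2t|z2t] := ltP (rho z) (2 * t); last by right; split=> //; lra.
    have [GP|PG] := leP (cabs (G z)) (cabs (P z)); first by left.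
    right; split => //.
    rewrite lt_neqAle zt andbT; apply/eqP => ztE.
    by move: PG; rewrite ltNge kP ?(rz0 _ zt)//; exact: Ht.
  + exists P; split => //; first by apply: Pcc => //; lra.
      apply: cnearS2 nz (cnearI n1 (rlt _ _ z1 z2t)) => y h [y1 yt] /h y0.
      by apply: Pd => //; lra.
    apply: cnearS (rlt _ _ z1 z2t) => y yt.
    by rewrite /Q yt; case: ifP => _ //; rewrite le_max lexx.
  + have z0 := rz0 _ (ltW zt); exists G; split => //; first exact: Gc.
      by apply: cnearS nz => y h /h; exact: Gd.
    apply: cnearS (rgt _ _ z1 zt) => y yt; rewrite /Q ifF.
      by case: ifP => _ //; rewrite le_max lexx orbT.
    by apply/negbTE; rewrite -leNgt ltW.
(* Both |H| and [k] are at most 1, so near the unit circle [Q] is at most [1 / |z|]. *)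
- move=> e e0; exists (1 + e)^-1; first by rewrite invf_lt1; lra.
  move=> z /andP[ez z1].
  have cz : 0 < cabs z by rewrite (lt_le_trans _ ez)// invr_gt0; lra.
  have z0 : z != 0 by rewrite -cabs_gt0.
  have iz : (cabs z)^-1 <= 1 + e by rewrite -[leRHS]invrK lef_pV2 ?posrE ?invr_gt0//; lra.
  have Gle : cabs (G z) <= 1 + e.
    by rewrite GE (le_trans _ iz)// ler_piMl// invr_ge0 ltW.
  have Ple : rho z < 3 * t -> cabs (P z) <= 1 + e.
    move=> zt; rewrite PEz// (le_trans _ iz)// ler_piMl ?invr_ge0 ?(ltW cz)//.
    exact: (Hd z z1 zt).2.
  rewrite /Q; case: ifP => zt; first by apply: Ple; lra.
  by case: ifP => // z2; rewrite ge_max Gle andbT Ple//; lra.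
Qed.

Lemma rcont_Re f a : ccont f a -> rcont (fun z => complex.Re (f z)) a.
Proof.
move=> fc e /fc; apply: cnearS => z; apply: le_lt_trans.
by rewrite -ReN -ReD normRe_le.
Qed.

(* Schwarz's lemma for a function defined only near the part of the disc where [Re f] is
   small; what [h] does elsewhere costs a factor, namely the inverse of its lower bound on
   the level set [Re f = t]. *)
Lemma local_schwarz (Om : R[i] -> Prop) f h (t s : R) : 0 < t -> 0 < s -> s <= 1 ->
  (forall z, cabs z < 1 -> Om z -> [/\ cnear z Om, cdiff f z & cdiff h z]) ->
  (forall z, cabs z < 1 -> ~ Om z -> cnear z (fun y => Om y -> 3 * t <= complex.Re (f y))) ->
  (forall z, cabs z < 1 -> Om z -> 0 <= complex.Re (f z)) ->
  (forall z, cabs z < 1 -> Om z -> complex.Re (f z) < 3 * t -> cabs (h z) <= 1) ->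
  (forall z, cabs z < 1 -> Om z -> complex.Re (f z) = t -> s <= cabs (h z)) ->
  Om 0 -> complex.Re (f 0) < t -> h 0 = 0 ->
  forall z, cabs z < 1 -> Om z -> complex.Re (f z) < t -> cabs (h z) <= cabs z / s.
Proof.
move=> t0 s0 s1 Omd Omc f0 h1 hs Om0 f0t h0 z z1 Oz fzt.
(* Truncation at [3 * t] extends [Re f] continuously to points outside [Om], by the assumption on
   their neighbourhoods. *)
pose rho z := if `[< Om z >] then Num.min (complex.Re (f z)) (3 * t) else 3 * t.
pose la := - ln s / t.
have la0 : 0 <= la by rewrite divr_ge0 ?(ltW t0)// oppr_ge0 ln_le0.
(* Since [expR (- (la * t)) = s], the weight gives [|H| >= s * s] on the level [t] and
   [|H| <= s ^+ 2] beyond the level [2 * t]: exactly the glueing condition with [k = s ^+ 2].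
   Removing the weight at the end costs the factor [1 / s]. *)
pose H z := h z * cexp (- (la%:C * f z)).
have HE z' : cabs (H z') = cabs (h z') * expR (- (la * complex.Re (f z'))).
  by rewrite /H cabsM cabs_cexp ReN ReM /= mul0r subr0.
have lat : expR (- (la * t)) = s.
  by rewrite /la divfK ?gt_eqF// opprK lnK.
have rhoO z' : rho z' < 3 * t -> Om z' /\ rho z' = complex.Re (f z').
  rewrite /rho; case: asboolP => [oz|_]; last by rewrite ltxx.
  by rewrite gt_min ltxx orbF => /ltW/min_l ->.
have Orho z' : Om z' -> complex.Re (f z') < 3 * t -> rho z' = complex.Re (f z').
  by move=> O /ltW/min_l; rewrite /rho; case: asboolP.
have := @schwarz_glue rho H t (s ^+ 2) t0; rewrite sqr_ge0 exprn_ile1 ?(ltW s0)//.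
move=> /(_ isT isT) glue.
have : cabs (H z) <= cabs z.
  apply: glue => //.
  - move=> y y1; have [Oy|nOy] := pselect (Om y); last first.
      move=> e e0; apply: cnearS (Omc y y1 nOy) => x hx.
      have -> : rho y = 3 * t by rewrite /rho; case: asboolP.
      rewrite /rho; case: asboolP => [/hx /min_r ->|_]; by rewrite subrr normr0.
    have [On fd _] := Omd y y1 Oy; move=> e e0.
    apply: cnearS2 On (rcont_Re (cdiff_ccont fd) e0) => x Ox.
    rewrite /rho; case: asboolP => // _; case: asboolP => // _.
    rewrite !ltr_norml => /andP[k1 k2].
    by rewrite /Num.min; case: ifP => a1; case: ifP => a2; lra.
  - move=> y y1 /[dup] yt /rhoO[Oy rE]; have [_ fd hd] := Omd y y1 Oy; split.
      apply: cdiffM => //; apply: (cdiff_comp (F := cexp)); last exact: cdiff_cexp.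
      by apply: cdiffN; apply: cdiffM => //; exact: cdiff_cst.
    rewrite HE; have := h1 y y1 Oy; rewrite -rE => /(_ yt) hy.
    rewrite mulr_ile1 ?cabs_ge0 ?expR_ge0// -[leRHS]expR0 ler_expR oppr_le0.
    by rewrite mulr_ge0// rE f0.
  - move=> y y1 yt; have [|Oy rE] := rhoO y; first by rewrite yt; lra.
    rewrite HE -rE yt lat expr2 ler_pM2r//; apply: hs => //; by rewrite -rE.
  - move=> y y1 /andP[y2 y3]; have [Oy rE] := rhoO y y3.
    rewrite HE -[leRHS]mul1r ler_pM ?cabs_ge0 ?expR_ge0//.
      by apply: h1 => //; rewrite -rE.
    rewrite -lat -expRM_natl ler_expR -rE mulr_natl mulr2n.
    have := ler_wpM2l la0 y2; lra.
  - by rewrite Orho//; lra.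
  - by rewrite /H h0 mul0r.
  - by rewrite Orho//; lra.
rewrite HE => hz; rewrite ler_pdivlMr// (le_trans _ hz)// ler_wpM2l ?cabs_ge0//.
by rewrite -lat ler_expR lerN2 ler_wpM2l// ltW.
Qed.

End LocalizedSchwarz.

(** * Infinitesimally Lipschitz functions on D *)

Section Discs.
Context {R : realType} {d : nat}.
Implicit Types (D : set (Cn R d)) (phi : R[i] -> Cn R d) (T : Cn R d -> R).
Local Open Scope complex_scope.

(** Continuous induction: the local bound at the supremum of the good points shows first that the
    supremum is good, then that it cannot be smaller than [b]. *)
Lemma lip_local_global (f A : R -> R) (b : R) : 0 <= b ->
  (forall x y, 0 <= x -> x <= y -> y <= b -> A x <= A y) ->
  (forall t, 0 <= t <= b -> exists2 e, 0 < e &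
     forall s, 0 <= s <= b -> `|s - t| < e -> `|f s - f t| <= `|A s - A t|) ->
  `|f b - f 0| <= A b - A 0.
Proof.
move=> b0 Am loc; pose E := [set x | 0 <= x <= b /\ `|f x - f 0| <= A x - A 0].
have E0 : E 0 by split; rewrite ?lexx ?b0// !subrr normr0.
have Eub : ubound E b by move=> x [/andP[]].
have Es : has_sup E by split; [exists 0 | exists b].
set c := sup E.
have c0 : 0 <= c by apply: ub_le_sup => //; exists b.
have cb : c <= b by apply: ge_sup => //; exists 0.
have c0b : 0 <= c <= b by rewrite c0.
have [e e0 he] := loc c c0b.
have Ec : E c.
  have [x [x0b fx] xc] := sup_adherent e0 Es; split => //.
  have xlec : x <= c by apply: ub_le_sup; [exists b | split].
  have := he x x0b; rewrite distrC ger0_norm ?subr_ge0// => /(_ _)H.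
  have /H : c - x < e by rewrite -/c in xc; lra.
  have Axc : A x <= A c by apply: Am => //; case/andP: x0b.
  rewrite [`|A x - _|]distrC [`|A c - _|]ger0_norm ?subr_ge0// distrC => h.
  have -> : f c - f 0 = (f c - f x) + (f x - f 0) by ring.
  by rewrite (le_trans (ler_normD _ _))//; lra.
have [cltb|bc] := ltP c b; last by have [_] := Ec; rewrite (@le_anti _ _ c b) ?cb.
exfalso; pose s := Num.min b (c + e / 2).
have cs : c < s by rewrite lt_min cltb/= ltrDl divr_gt0.
have sb : s <= b by rewrite ge_min lexx.
have se : s <= c + e / 2 by rewrite ge_min lexx orbT.
have s0b : 0 <= s <= b by rewrite sb andbT (le_trans c0)// ltW.
have := he s s0b; rewrite ger0_norm ?subr_ge0 ?(ltW cs)// => /(_ _)H.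
have /H : s - c < e by lra.
have Acs : A c <= A s by apply: Am => //; exact: ltW.
rewrite [`|A s - _|]ger0_norm ?subr_ge0// => h.
have Es' : E s.
  split => //; have [_ fc] := Ec.
  have -> : f s - f 0 = (f s - f c) + (f c - f 0) by ring.
  by rewrite (le_trans (ler_normD _ _))//; lra.
by move: cs; apply/negP; rewrite -leNgt; apply: ub_le_sup => //; exists b.
Qed.

Lemma artanh_ge (x e : R) : 0 <= x -> x < 1 -> x <= e -> x <= (1 + e) * artanh x.
Proof.
move=> x0 x1 xe; have p1 : 0 < 1 + x by lra.
have p2 : 0 < 1 - x by lra.
have e0 : 0 <= e by lra.
have h1 : x / (1 + x) <= ln (1 + x).
  have : ln (1 + (- (x / (1 + x)))) <= - (x / (1 + x)).
    by apply: le_ln1Dx; rewrite ltrN2 ltr_pdivrMr// mul1r; lra.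
  have -> : 1 + - (x / (1 + x)) = (1 + x)^-1 by field; rewrite gt_eqF.
  by rewrite lnV ?posrE// lerN2.
have h2 : ln (1 - x) <= - x by apply: le_ln1Dx; rewrite ltrN2.
rewrite /artanh ln_div ?posrE//.
have h3 : x <= (1 + e) * (x / (1 + x)).
  by rewrite mulrA ler_pdivlMr// mulrC ler_wpM2r//; lra.
have h4 : x <= (1 + e) * x by rewrite ler_peMl//; lra.
have e1 : 0 <= 1 + e by lra.
have := ler_wpM2l e1 h1; have := ler_wpM2l e1 h2.
lra.
Qed.

Lemma artanhB (s t : R) : 0 <= t -> t <= s -> s < 1 ->
  artanh s - artanh t = artanh ((s - t) / (1 - t * s)).
Proof.
move=> t0 ts s1; rewrite /artanh -mulrBr; congr (_ * _).
have q0 : 0 < 1 - t * s by rewrite subr_gt0; nra.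
rewrite -ln_div ?posrE ?divr_gt0//; [|lra..].
by congr ln; field; rewrite !gt_eqF//; nra.
Qed.

Definition hdisc D phi := forall a, cabs a < 1 ->
  D (phi a) /\ forall j, cdiff (fun z => phi z 0 j) a.

(** Only centres are tested, because Moebius maps move any point of a disc there. The factor [1 + e]
    absorbs errors of order o(|h|), and [T] need not be differentiable. *)
Definition inf_lip D T := forall phi, hdisc D phi -> forall e, 0 < e ->
  cnear 0 (fun h => `|T (phi h) - T (phi 0)| <= (1 + e) * cabs h).

Lemma hdisc_moebius D phi (al : R[i]) (t : R) : hdisc D phi -> cabs al = 1 -> 0 <= t < 1 ->
  hdisc D (fun h => phi (al * ((h + t%:C) / (1 + t%:C * h)))).
Proof.
move=> hp al1 /andP[t0 t1].
have m1 h : cabs h < 1 -> cabs (al * ((h + t%:C) / (1 + t%:C * h))) < 1 /\ 1 + t%:C * h != 0.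
  move=> h1.
  have n0 : cabs (h + t%:C) < cabs (1 + t%:C * h).
    rewrite -ltr_sqr ?nnegrE ?cabs_ge0// !sqr_cabs !ReImE /=.
    have : cabs h ^+ 2 < 1 by rewrite expr_lt1// cabs_ge0.
    rewrite sqr_cabs; case: h {h1} => x y /= h1.
    rewrite -subr_gt0; have -> : (1 + (t * x - 0 * y)) ^+ 2 + (0 + (t * y + 0 * x)) ^+ 2 -
      ((x + t) ^+ 2 + (y + 0) ^+ 2) = (1 - t ^+ 2) * (1 - (x ^+ 2 + y ^+ 2)) by ring.
    by rewrite mulr_gt0 ?subr_gt0// expr_lt1.
  have p : 0 < cabs (1 + t%:C * h) by rewrite (le_lt_trans _ n0)// cabs_ge0.
  by rewrite -cabs_gt0 p cabsM al1 mul1r cabsM cabsV ltr_pdivrMr// mul1r.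
move=> a /m1 [a1 a0]; have [Da ca] := hp _ a1; split => // j.
apply: (cdiff_comp (F := fun z => phi z 0 j)); last exact: ca.
apply: cdiffM; first exact: cdiff_cst.
apply: cdiffM; first by apply: cdiffD; [exact: cdiff_id|exact: cdiff_cst].
apply: cdiffV => //; apply: cdiffD; first exact: cdiff_cst.
by apply: cdiffM; [exact: cdiff_cst|exact: cdiff_id].
Qed.

(** The infinitesimal bound is integrated along the radius to [a]. Recentring the disc at each point
    of the radius turns increments of artanh into artanh of the Moebius displacement. *)
Lemma inf_lip_artanh D T phi (a : R[i]) : inf_lip D T -> hdisc D phi -> cabs a < 1 ->
  `|T (phi a) - T (phi 0)| <= artanh (cabs a).
Proof.
move=> TL hp a1; have [->|a0] := eqVneq a 0.
  by rewrite subrr normr0 cabs0 /artanh subr0 addr0 divr1 ln1 mulr0.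
set b := cabs a; have b0 : 0 < b by rewrite cabs_gt0.
pose al : R[i] := a / b%:C.
have al1 : cabs al = 1.
  by rewrite /al cabsM cabsV cabs_real gtr0_norm// divff ?gt_eqF.
have bC0 : b%:C != 0 :> R[i] by rewrite -cabs_gt0 cabs_real normr_gt0 gt_eqF.
pose f (s : R) := T (phi (al * s%:C)).
have -> : T (phi a) = f b by rewrite /f /al divfK.
have -> : T (phi 0) = f 0 by rewrite /f mulr0.
have artanh0 : artanh (0 : R) = 0 by rewrite /artanh subr0 addr0 divr1 ln1 mulr0.
have am (x y : R) : 0 <= x -> x <= y -> y <= b -> artanh x <= artanh y.
  move=> x0 xy yb; have y1 : y < 1 by rewrite (le_lt_trans yb).
  rewrite /artanh ler_pM2l ?invr_gt0// ler_ln ?posrE ?divr_gt0//; [|lra..].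
  by rewrite ler_pdivrMr ?subr_gt0 1?mulrAC ?ler_pdivlMr; nra.
have key e : 0 < e -> `|f b - f 0| <= (1 + e) * artanh b.
  (* One factor [1 + e1] comes from [inf_lip], the other from comparing |h| with artanh |h|. *)
  move=> e0; pose e1 := Num.min 1 (e / 3).
  have e10 : 0 < e1 by rewrite lt_min ltr01 divr_gt0.
  have e11 : e1 <= 1 by rewrite ge_min lexx.
  have e13 : e1 <= e / 3 by rewrite ge_min lexx orbT.
  have ee : (1 + e1) * (1 + e1) <= 1 + e by nra.
  have := @lip_local_global f (fun s => (1 + e) * artanh s) b.
  rewrite /= artanh0 mulr0 subr0; apply; [exact: ltW| |].
    by move=> x y x0 xy yb; rewrite ler_wpM2l ?am//; lra.
  move=> t /andP[t0 tb]; have t1 : t < 1 by rewrite (le_lt_trans tb).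
  have t01 : 0 <= t < 1 by rewrite t0.
  have [r r0 hr] := TL _ (hdisc_moebius hp al1 t01) _ e10.
  exists (Num.min (r * (1 - b)) (e1 * (1 - b))).
    by rewrite lt_min !mulr_gt0// subr_gt0.
  move=> s /andP[s0 sb]; rewrite lt_min => /andP[st st'].
  have s1 : s < 1 by rewrite (le_lt_trans sb).
  have q0 : 0 < 1 - t * s by nra.
  have qb : 1 - b <= 1 - t * s by nra.
  have b1 : 0 < 1 - b by rewrite subr_gt0.
  pose h := (s - t) / (1 - t * s).
  have nh : `|h| = `|s - t| / (1 - t * s) by rewrite normrM normrV ?unitfE ?gt_eqF// (gtr0_norm q0).
  have hr' : `|h| < r by rewrite nh ltr_pdivrMr// (lt_le_trans st)// ler_pM2l.
  have he' : `|h| < e1 by rewrite nh ltr_pdivrMr// (lt_le_trans st')// ler_pM2l.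
  have := hr h%:C; rewrite subr0 cabs_real => /(_ hr').
  rewrite mulr0 add0r addr0 divr1 -/(f t).
  have -> : (h%:C + t%:C) / (1 + t%:C * h%:C) = s%:C :> R[i].
    rewrite -[1]/(1%:C) -!rmorphM -!rmorphD -fmorphV -rmorphM; congr (_%:C).
    by rewrite /h; field; rewrite !gt_eqF//; nra.
  rewrite -/(f s) => fst.
  rewrite (le_trans fst)//.
  have hle : `|h| <= (1 + e1) * `|artanh s - artanh t|.
    have [ts|/ltW st''] := leP t s.
      rewrite artanhB// -/h; have h0 : 0 <= h by rewrite /h divr_ge0 ?(ltW q0)// subr_ge0.
      rewrite ger0_norm//; move: he'; rewrite ger0_norm// => he'.
      have hA : h <= (1 + e1) * artanh h by apply: artanh_ge => //; lra.
      by rewrite (le_trans hA)// ler_pM2l ?ler_norm//; lra.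
    rewrite distrC artanhB// mulrC.
    have hE : (t - s) / (1 - t * s) = - h by rewrite /h -(opprB s t) mulNr.
    rewrite [s * t]mulrC hE -(normrN h); have h0 : 0 <= - h by rewrite -hE divr_ge0 ?(ltW q0)// subr_ge0.
    rewrite (ger0_norm h0); move: he'; rewrite -(normrN h) (ger0_norm h0) => he'.
    have hA : - h <= (1 + e1) * artanh (- h) by apply: artanh_ge => //; lra.
    by rewrite mulrC (le_trans hA)// ler_pM2l ?ler_norm//; lra.
  have e1p : 0 <= 1 + e1 by lra.
  have {}hle := ler_wpM2l e1p hle.
  rewrite (le_trans hle)// mulrA -(mulrBr (1 + e)) (normrM (1 + e)) (@gtr0_norm _ (1 + e)).
    by rewrite ler_wpM2r.
  lra.
rewrite leNgt; apply/negP => lt.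
have A0 : 0 <= artanh b by rewrite -artanh0 am// ltW.
pose e := (`|f b - f 0| - artanh b) / (2 * (artanh b + 1)).
have A1 : 0 < 2 * (artanh b + 1) by lra.
have e0 : 0 < e by rewrite divr_gt0// subr_gt0.
have eE : e * (2 * (artanh b + 1)) = `|f b - f 0| - artanh b by rewrite /e divfK// gt_eqF.
have := key _ e0; nra.
Qed.

Lemma holomorphic_hdisc D (phi : R[i] -> Cn R d) : holomorphic_disc D phi -> hdisc D phi.
Proof.
move=> hp a a1; have [Da da] := hp a a1; split => // j.
pose l : Cn R d := derive (phi : (R[i])^o -> Cn R d) a 1.
apply: (@cdiff_littleo _ _ _ (l 0 j)) => e e0.
move/cvg_ballP : da => /(_ e%:C); rewrite ltcR => /(_ e0).
(* Radii of balls over [R[i]] are complex numbers; positivity forces the imaginary part [e2] to be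
   0. *)
move/nbhs_ballP => [/= [e1 e2]] /=; rewrite ltcE /= => /andP[/eqP e20 e10] he.
exists e1 => // z zd; have [->|za] := eqVneq z a.
  by rewrite !subrr mulr0 subrr cabs0 mulr0.
have za0 : z - a != 0 by rewrite subr_eq0.
have /he : ball (0 : (R[i])^o) (e1 +i* e2) (z - a).
  by rewrite /ball /= sub0r normrN normr_cabs ltcE /= e20 eqxx.
move=> /(_ za0) [_ /(_ 0 j)]; rewrite /ball /= !mxE.
rewrite normr_cabs ltcR => /ltW h.
have -> : phi z 0 j - phi a 0 j - l 0 j * (z - a) =
   - ((l 0 j - (z - a)^-1 * (phi z 0 j - phi a 0 j)) * (z - a)) by field.
rewrite cabsN cabsM ler_wpM2r ?cabs_ge0//; apply: le_trans h.
rewrite le_eqVlt; apply/orP; left; apply/eqP; congr (cabs (_ - _ * (_ - _))).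
by rewrite /GRing.scale /= mulr1 subrK.
Qed.

(** The function [|T x - T y|] is itself a pseudodistance, and [inf_lip_artanh] puts it below the
    Lempert function. *)
Lemma kobayashi_ge D T z w : inf_lip D T -> D z -> D w ->
  ((`|T z - T w|)%:E <= kobayashi D z w)%E.
Proof.
move=> TL Dz Dw; apply: ereal_sup_ubound; exists (fun x y => `|T x - T y|) => //; split.
  split => [x _|//|x y _ _|x y u _ _ _]; first by rewrite subrr normr0.
    by rewrite distrC.
  by rewrite (le_trans _ (ler_normD _ _))// addrA subrK.
move=> x y Dx Dy; apply: le_ereal_inf_tmp => _ [a [a1 [phi [hp <- <-]]] <-].
rewrite lee_fin distrC; apply: (inf_lip_artanh TL) => //.
exact: holomorphic_hdisc.
Qed.

End Discs.

(** * Hermitian geometry *)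

Section Hermitian.
Context {R : realType} {d : nat}.
Implicit Types (X Y Z u v : Cn R d) (a b : R[i]).
Local Open Scope complex_scope.

Definition co X (j : 'I_d) : R[i] := X 0 j.

Lemma coD X Y j : co (X + Y) j = co X j + co Y j.
Proof. by rewrite /co mxE. Qed.

Lemma coN X j : co (- X) j = - co X j.
Proof. by rewrite /co mxE. Qed.

Lemma coB X Y j : co (X - Y) j = co X j - co Y j.
Proof. by rewrite coD coN. Qed.

Lemma coZ a X j : co (a *: X) j = a * co X j.
Proof. by rewrite /co mxE. Qed.

Lemma co0 j : co 0 j = 0.
Proof. by rewrite /co mxE. Qed.

Lemma eq_co X Y : (forall j, co X j = co Y j) -> X = Y.
Proof. by move=> h; apply/rowP. Qed.

(* Locked versions of [hdot] and [enorm]: unifying two instances by unfolding is hopeless. *)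
Definition hd X Y : R[i] := locked (@hdot R d) X Y.
Definition en X : R := locked (@enorm R d) X.

Lemma hd_hdot X Y : hdot X Y = hd X Y.
Proof. by rewrite /hd -lock. Qed.

Lemma en_enorm X : enorm X = en X.
Proof. by rewrite /en -lock. Qed.

Lemma hdotE X Y : hd X Y = \sum_j co X j * conjc (co Y j).
Proof.
rewrite -hd_hdot /hdot dotmxE mxE; apply: eq_bigr => j _; by rewrite !mxE.
Qed.

Lemma hdotDl X Y Z : hd (X + Y) Z = hd X Z + hd Y Z.
Proof. by rewrite !hdotE -big_split; apply: eq_bigr => j _; rewrite coD mulrDl. Qed.

Lemma hdotZl a X Z : hd (a *: X) Z = a * hd X Z.
Proof. by rewrite !hdotE mulr_sumr; apply: eq_bigr => j _; rewrite coZ mulrA. Qed.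

Lemma hdotNl X Z : hd (- X) Z = - hd X Z.
Proof. by rewrite -scaleN1r hdotZl mulN1r. Qed.

Lemma hdotBl X Y Z : hd (X - Y) Z = hd X Z - hd Y Z.
Proof. by rewrite hdotDl hdotNl. Qed.

Lemma hdot_conj X Y : conjc (hd X Y) = hd Y X.
Proof.
rewrite !hdotE rmorph_sum; apply: eq_bigr => j _.
by rewrite rmorphM /= conjcK mulrC.
Qed.

Lemma hdotDr X Y Z : hd X (Y + Z) = hd X Y + hd X Z.
Proof. by rewrite -hdot_conj hdotDl rmorphD /= !hdot_conj. Qed.

Lemma hdotZr a X Z : hd X (a *: Z) = conjc a * hd X Z.
Proof. by rewrite -hdot_conj hdotZl rmorphM /= !hdot_conj. Qed.

Lemma hdotBr X Y Z : hd X (Y - Z) = hd X Y - hd X Z.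
Proof. by rewrite -hdot_conj hdotBl rmorphB /= !hdot_conj. Qed.

Lemma hdot0l Z : hd 0 Z = 0.
Proof. by rewrite -(scale0r (0 : Cn R d)) hdotZl mul0r. Qed.

Lemma mul_conj a : a * conjc a = (cabs a ^+ 2)%:C.
Proof. by rewrite -sqr_normc normr_cabs rmorphXn. Qed.

Lemma hdot_diag X : hd X X = (\sum_j cabs (co X j) ^+ 2)%:C.
Proof. by rewrite hdotE rmorph_sum; apply: eq_bigr => j _; rewrite mul_conj. Qed.

Lemma enormE X : en X = Num.sqrt (\sum_j cabs (co X j) ^+ 2).
Proof. by rewrite -en_enorm /enorm hd_hdot hdot_diag. Qed.

Lemma sqr_enorm X : en X ^+ 2 = \sum_j cabs (co X j) ^+ 2.
Proof. by rewrite enormE sqr_sqrtr// sumr_ge0// => j _; rewrite sqr_ge0. Qed.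

Lemma hdot_self X : hd X X = (en X ^+ 2)%:C.
Proof. by rewrite hdot_diag sqr_enorm. Qed.

Lemma enorm_ge0 X : 0 <= en X.
Proof. by rewrite enormE sqrtr_ge0. Qed.

Lemma enorm0 : en (0 : Cn R d) = 0.
Proof. by rewrite enormE big1 ?sqrtr0// => j _; rewrite co0 cabs0 expr0n. Qed.

Lemma co_le_enorm X j : cabs (co X j) <= en X.
Proof.
rewrite -ler_sqr ?nnegrE ?cabs_ge0 ?enorm_ge0// sqr_enorm (bigD1 j)//= lerDl.
by rewrite sumr_ge0// => i _; rewrite sqr_ge0.
Qed.

Lemma enorm_eq0 X : (en X == 0) = (X == 0).
Proof.
apply/eqP/eqP => [X0|->]; last exact: enorm0.
apply: eq_co => j; rewrite co0; apply/eqP; rewrite -cabs_eq0 eq_le cabs_ge0 andbT.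
by rewrite -X0 co_le_enorm.
Qed.

Lemma enorm_gt0 X : (0 < en X) = (X != 0).
Proof. by rewrite lt_def enorm_ge0 andbT enorm_eq0. Qed.

Lemma enormZ a X : en (a *: X) = cabs a * en X.
Proof.
rewrite -[RHS]ger0_norm ?mulr_ge0 ?cabs_ge0 ?enorm_ge0// -sqrtr_sqr exprMn sqr_enorm.
rewrite enormE; congr Num.sqrt; rewrite mulr_sumr; apply: eq_bigr => j _.
by rewrite coZ cabsM exprMn.
Qed.

Lemma enormN X : en (- X) = en X.
Proof. by rewrite -scaleN1r enormZ cabsN cabs1 mul1r. Qed.

Lemma enormB X Y : en (X - Y) = en (Y - X).
Proof. by rewrite -enormN opprB. Qed.

Lemma cs_alg (c u : R[i]) (a b : R) : conjc c = u ->
  b%:C * (conjc b%:C * a%:C) - b%:C * (conjc c * c) -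
    (c * (conjc b%:C * u) - c * (conjc c * b%:C)) = (b * (b * a - cabs c ^+ 2))%:C.
Proof. by move=> <-; rewrite sqr_cabs; case: c => x y; apply: eqc => /=; ring. Qed.

Lemma tri_alg (c u : R[i]) (a b : R) : conjc c = u ->
  a%:C + c + (u + b%:C) = (a + b + 2 * complex.Re c)%:C.
Proof. by move=> <-; case: c => x y; apply: eqc => /=; ring. Qed.

Lemma cauchy_schwarz X Y : cabs (hd X Y) <= en X * en Y.
Proof.
have [->|Y0] := eqVneq Y 0.
  by rewrite -hdot_conj hdot0l cabs_conj cabs0 mulr_ge0 ?enorm_ge0.
have nY : 0 < en Y by rewrite enorm_gt0.
set c := hd X Y; set N := en Y ^+ 2.
have N0 : 0 < N by rewrite exprn_gt0.
have : 0 <= en (N%:C *: X - c *: Y) ^+ 2 by rewrite sqr_ge0.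
have -> : en (N%:C *: X - c *: Y) ^+ 2 = N * (N * en X ^+ 2 - cabs c ^+ 2).
  apply: (@complexI R); rewrite -hdot_self hdotBl !hdotBr !(hdotZl, hdotZr) !hdot_self.
  exact: cs_alg (hdot_conj X Y).
rewrite pmulr_rge0// subr_ge0 mulrC => h.
by rewrite -ler_sqr ?nnegrE ?cabs_ge0 ?mulr_ge0 ?enorm_ge0// exprMn.
Qed.

Lemma enormD X Y : en (X + Y) <= en X + en Y.
Proof.
rewrite -ler_sqr ?nnegrE ?addr_ge0 ?enorm_ge0//.
have -> : en (X + Y) ^+ 2 = en X ^+ 2 + en Y ^+ 2 + 2 * complex.Re (hd X Y).
  apply: (@complexI R); rewrite -hdot_self hdotDl !hdotDr !hdot_self.
  exact: tri_alg (hdot_conj X Y).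
have := Re_le_cabs (hd X Y); have := cauchy_schwarz X Y; lra.
Qed.

Lemma enorm_dist X Y Z : en (X - Y) <= en (X - Z) + en (Z - Y).
Proof. by rewrite (le_trans _ (enormD _ _))// addrA subrK. Qed.

Lemma enorm_le_sum X : en X <= \sum_j cabs (co X j).
Proof.
rewrite -ler_sqr ?nnegrE ?enorm_ge0 ?sumr_ge0// => [|j _]; last exact: cabs_ge0.
rewrite sqr_enorm expr2 mulr_suml; apply: ler_sum => j _.
rewrite expr2 ler_wpM2l ?cabs_ge0// (bigD1 j)//= lerDl sumr_ge0// => i _.
exact: cabs_ge0.
Qed.

Definition enear p (P : Cn R d -> Prop) := exists2 s : R, 0 < s & forall x, en (x - p) < s -> P x.

Lemma nbhs_enear (p : Cn R d) (P : set (Cn R d)) : nbhs p P <-> enear p P.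
Proof.
split.
  move/nbhs_ballP => [[e1 e2]] /=; rewrite ltcE /= => /andP[/eqP e20 e10] h.
  exists e1 => // x xp; apply: h; split; first by rewrite ltcE /= e20 eqxx.
  move=> i j; rewrite /ball /= normr_cabs ltcE /= e20 eqxx /= (ord1 i).
  by have := co_le_enorm (x - p) j; rewrite coB cabsB => /le_lt_trans; apply.
(* Dividing by [d.+1] covers [d = 0] and makes the sum of the [d] coordinate bounds strictly smaller
   than [s]. *)
move=> [s s0 h]; apply/nbhs_ballP; have q0 : 0 < s / d.+1%:R by rewrite divr_gt0// ltr0n.
exists (s / d.+1%:R)%:C; first by rewrite /= ltcR.
move=> x [_ xp]; apply: h; apply: le_lt_trans (enorm_le_sum _) _.
apply: (@le_lt_trans _ _ (\sum_(j < d) (s / d.+1%:R))).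
  apply: ler_sum => j _; have := xp 0 j; rewrite /ball /= normr_cabs ltcR => /ltW.
  by rewrite coB cabsB.
rewrite sumr_const card_ord -[ltLHS]mulr_natr mulrAC -mulrA gtr_pMr// ltr_pdivrMr ?ltr0n//.
by rewrite mul1r ltr_nat.
Qed.

End Hermitian.

(** * Lipschitz functions from a peak function *)

Section Barrier.
Context {R : realType} {d : nat}.
Implicit Types (phi : R[i] -> Cn R d) (T : Cn R d -> R) (F : Cn R d -> R[i]).
Local Open Scope complex_scope.

Lemma cnear_all (I : finType) a (P : I -> R[i] -> Prop) :
  (forall i, cnear a (P i)) -> cnear a (fun z => forall i, P i z).
Proof.
move=> h; suff: cnear a (fun z => forall i, i \in enum I -> P i z).
  by apply: cnearS => z hz i; apply: hz; rewrite mem_enum.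
elim: (enum I) => [|i s IH]; first by apply: cnearT.
by apply: cnearS2 (h i) IH => z hi hs j; rewrite inE => /orP[/eqP ->|/hs].
Qed.

Definition cdiff_vec phi a := forall j, cdiff (fun z => phi z 0 j) a.

Lemma cdiff_vec_cont phi a e : cdiff_vec phi a -> 0 < e ->
  cnear a (fun z => en (phi z - phi a) < e).
Proof.
move=> h e0; have q0 : 0 < e / d.+1%:R by rewrite divr_gt0// ltr0n.
have := cnear_all (fun j => cdiff_ccont (h j) q0); apply: cnearS => z hz.
apply: le_lt_trans (enorm_le_sum _) _.
apply: (@le_lt_trans _ _ (\sum_(j < d) (e / d.+1%:R))).
  by apply: ler_sum => j _; rewrite coB ltW// hz.
rewrite sumr_const card_ord -[ltLHS]mulr_natr mulrAC -mulrA gtr_pMr// ltr_pdivrMr ?ltr0n//.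
by rewrite mul1r ltr_nat.
Qed.

(** Holomorphy is expressed by what discs can see of it, namely stability under composition. *)
Definition hol_on (A : set (Cn R d)) F := forall phi a, A (phi a) -> cdiff_vec phi a ->
  cdiff (fun z => F (phi z)) a.

Context (D : set (Cn R d)) (q : Cn R d) (g : Cn R d -> R[i]) (s c : R).

Definition pball := [set x | D x /\ en (x - q) < s].

Hypotheses (s0 : 0 < s) (c0 : 0 < c) (Dq : ~ D q) (ghol : hol_on pball g).
Hypothesis gpos : forall x, pball x -> c * en (x - q) ^+ 2 <= complex.Re (g x).

(** At distance [s / 2] from [q] the lower bound for [Re g] is [c * (s / 2) ^+ 2 = 3 * t], the level
    that [local_schwarz] asks for where a disc leaves the ball. *)
Let t := c * s ^+ 2 / 12.

Lemma t_gt0 : 0 < t.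
Proof. by rewrite divr_gt0// mulr_gt0// exprn_gt0. Qed.

Lemma g_gt0 x : pball x -> 0 < complex.Re (g x).
Proof.
move=> Px; apply: lt_le_trans (gpos Px); rewrite mulr_gt0// exprn_gt0// enorm_gt0.
by rewrite subr_eq0; apply: contra_notN Dq => /eqP <-; case: Px.
Qed.

Lemma g_far x : D x -> s / 2 < en (x - q) -> en (x - q) < s -> 3 * t <= complex.Re (g x).
Proof.
move=> Dx xs xs'; apply: le_trans (gpos _); last by split.
have : (s / 2) ^+ 2 <= en (x - q) ^+ 2.
  by rewrite ler_sqr ?nnegrE ?enorm_ge0 ?divr_ge0 ?(ltW s0)// ltW.
move=> /(ler_wpM2l (ltW c0)); apply: le_trans; rewrite /t; lra.
Qed.

Section Disc.
Variables (phi : R[i] -> Cn R d) (hphi : hdisc D phi).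

Lemma near_ball (z : R[i]) : cabs z < 1 -> en (phi z - q) < s ->
  cnear z (fun y => en (phi y - q) < s).
Proof.
move=> z1 zs; have p : 0 < s - en (phi z - q) by rewrite subr_gt0.
apply: cnearS (cdiff_vec_cont (hphi z1).2 p) => y yz.
by have := enorm_dist (phi y) q (phi z); lra.
Qed.

Lemma near_disc (z : R[i]) : cabs z < 1 -> cnear z (fun y => cabs y < 1).
Proof.
move=> z1; have cz1 : 0 < 1 - cabs z by rewrite subr_gt0.
apply: cnearS (cnear_lt z cz1) => y yz.
have : cabs y <= cabs z + cabs (y - z) by rewrite -[X in cabs X <= _](subrKC z) cabsD.
lra.
Qed.

Lemma near_far (z : R[i]) : cabs z < 1 -> s <= en (phi z - q) ->
  cnear z (fun y => en (phi y - q) < s -> 3 * t <= complex.Re (g (phi y))).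
Proof.
move=> z1 zs; have p : 0 < s / 2 by rewrite divr_gt0.
apply: cnearS2 (near_disc z1) (cdiff_vec_cont (hphi z1).2 p) => y y1 yz ys.
apply: g_far => //; first by case: (hphi y1).
by have := enorm_dist (phi z) q (phi y); rewrite (enormB (phi z) (phi y)); lra.
Qed.

Lemma phi0_pball : en (phi 0 - q) < s -> pball (phi 0).
Proof.
by move=> h; split => //; have c01 : cabs (0 : R[i]) < 1; rewrite ?cabs0//; case: (hphi c01).
Qed.

(** [local_schwarz] for the part of the disc that [phi] sends into the ball, with [Re g] itself as
    the barrier. [near_far] is the separation from the rest of the disc. *)
Lemma barrier_schwarz F (k : R) : 0 < k -> k <= 1 ->
  en (phi 0 - q) < s -> complex.Re (g (phi 0)) < t -> hol_on pball F -> F (phi 0) = 0 ->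
  (forall y, pball y -> complex.Re (g y) < 3 * t -> cabs (F y) <= 1) ->
  (forall y, pball y -> complex.Re (g y) = t -> k <= cabs (F y)) ->
  cnear 0 (fun h => [/\ cabs h < 1, en (phi h - q) < s & cabs (F (phi h)) <= cabs h / k]).
Proof.
move=> k0 k1 p0 g0 Fh F0 F1 Fk.
have c01 : cabs (0 : R[i]) < 1 by rewrite cabs0.
have PB z : cabs z < 1 -> en (phi z - q) < s -> pball (phi z).
  by move=> z1 zs; split => //; case: (hphi z1).
have key := @local_schwarz R (fun z => en (phi z - q) < s) (fun z => g (phi z))
  (fun z => F (phi z)) t k t_gt0 k0 k1.
have gc : ccont (fun z => g (phi z)) 0.
  by apply/cdiff_ccont/ghol; [exact: PB|exact: (hphi c01).2].
have p : 0 < t - complex.Re (g (phi 0)) by rewrite subr_gt0.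
apply: cnearS2 (near_disc c01) (cnearI (near_ball c01 p0) (rcont_Re gc p)) => z z1 [zs].
rewrite ltr_norml => /andP[_ zt]; split => //.
apply: key => //.
- move=> y y1 ys; split; first exact: near_ball.
    by apply: ghol; [exact: PB|exact: (hphi y1).2].
  by apply: Fh; [exact: PB|exact: (hphi y1).2].
- by move=> y y1 /negP; rewrite -leNgt; exact: near_far.
- by move=> y y1 ys; exact/ltW/g_gt0/PB.
- by move=> y y1 ys; apply: F1; exact: PB.
- by move=> y y1 ys; apply: Fk; exact: PB.
- lra.
Qed.

Lemma halfplane_dist (a b : R[i]) : 0 <= complex.Re b ->
  cabs (a + conjc b) <= cabs (a - b) + 2 * complex.Re b.
Proof.
move=> b0; have -> : a + conjc b = (a - b) + (2 * complex.Re b)%:C.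
  by case: a b {b0} => [a1 a2] [b1 b2]; apply: eqc => /=; ring.
by rewrite (le_trans (cabsD _ _))// cabs_real ger0_norm// mulr_ge0.
Qed.

Lemma halfplane_contract (a b : R[i]) : 0 <= complex.Re a -> 0 <= complex.Re b ->
  cabs (a - b) <= cabs (a + conjc b).
Proof.
move=> a0 b0; rewrite -ler_sqr ?nnegrE ?cabs_ge0// !sqr_cabs.
case: a b a0 b0 => [a1 a2] [b1 b2] /= a0 b0.
by have := mulr_ge0 a0 b0; nra.
Qed.

(** Schwarz's lemma is applied to [(g - g0) / (g + conjc g0)], the Cayley map of the right
    half-plane that vanishes at the centre; clearing the denominator, close to [2 * Re g0] for small
    h, gives the derivative bound. *)
Lemma barrier_step e : 0 < e -> en (phi 0 - q) < s ->
  complex.Re (g (phi 0)) <= t / 4 ->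
  cnear 0 (fun h => [/\ cabs h < 1, en (phi h - q) < s &
    cabs (g (phi h) - g (phi 0)) <=
      (2 * complex.Re (g (phi 0)) * (1 + 4 / t * complex.Re (g (phi 0))) + e) * cabs h]).
Proof.
move=> e0 p0 gt; have P0 := phi0_pball p0; have tp := t_gt0.
have a0 := g_gt0 P0.
move: (erefl (g (phi 0))); set g0 := {1}(g (phi 0)) => Eg0.
rewrite -Eg0 in gt a0 *; set a := complex.Re g0 in gt a0 *.
pose F y := (g y - g0) / (g y + conjc g0).
have den y : pball y -> a < cabs (g y + conjc g0) /\
    complex.Re (g y) < cabs (g y + conjc g0).
  move=> Py; have := g_gt0 Py; have := Re_le_cabs (g y + conjc g0).
  rewrite ReD (_ : complex.Re (conjc g0) = a); last by rewrite /a; case: (g0).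
  by move=> ? ?; split; lra.
have den0 y : pball y -> g y + conjc g0 != 0.
  by move=> /den[h _]; rewrite -cabs_gt0 (lt_trans a0).
have FE y : cabs (F y) = cabs (g y - g0) / cabs (g y + conjc g0).
  by rewrite cabsM cabsV.
(* On [Re g = t] the denominator has modulus at least [t] and exceeds the numerator by at most
   [2 * a]. For [a / t <= 1 / 4] one has [1 / k <= 1 + 4 * (a / t)], whence the correction factor
   and the assumption [a <= t / 4]. *)
pose k := 1 - 2 * (a / t).
have u4 : a / t <= 1 / 4 by rewrite ler_pdivrMr//; lra.
have u0 : 0 < a / t by rewrite divr_gt0.
have k0 : 1 / 2 <= k by rewrite /k; lra.
have kp : 0 < k by lra.
have := @barrier_schwarz F k kp; rewrite /k => /(_ ltac:(lra) p0 ltac:(lra)) bs.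
have {bs} : cnear 0 (fun h => [/\ cabs h < 1, en (phi h - q) < s &
    cabs (F (phi h)) <= cabs h / k]).
  apply: bs.
  - move=> ph b Pb hb; have gd := ghol Pb hb.
    apply: cdiffM; first by apply: cdiffB => //; exact: cdiff_cst.
    by apply: cdiffV; [apply: cdiffD => //; exact: cdiff_cst|exact: den0].
  - by rewrite /F -Eg0 subrr mul0r.
  - move=> y Py _; rewrite FE ler_pdivrMr ?cabs_gt0 ?den0// mul1r.
    by rewrite halfplane_contract// ltW// g_gt0.
  - move=> y Py yt; have [h1 h2] := den _ Py.
    rewrite FE ler_pdivlMr ?cabs_gt0 ?den0//.
    have := halfplane_dist (g y) (ltW a0); rewrite -/a => h3.
    have : t * (a / t) <= cabs (g y + conjc g0) * (a / t) by rewrite ler_pM2r//; lra.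
    rewrite [t * _]mulrC divfK ?gt_eqF//; lra.
have c01 : cabs (0 : R[i]) < 1 by rewrite cabs0.
have gc : ccont (fun z => g (phi z)) 0.
  by apply/cdiff_ccont/ghol => //; exact: (hphi c01).2.
have e20 : 0 < e / 2 by rewrite divr_gt0.
move=> near1; apply: cnearS2 near1 (gc _ e20) => h [h1 hs hF] he.
split => //; have Ph : pball (phi h) by split => //; case: (hphi h1).
rewrite -Eg0 in he *.
move: hF; rewrite FE ler_pdivrMr ?cabs_gt0 ?den0// => hF.
apply: (le_trans hF).
have := halfplane_dist (g (phi h)) (ltW a0); rewrite -/a => h3.
have k2 : k^-1 <= 1 + 4 / t * a.
  rewrite -[leLHS]mul1r ler_pdivrMr// /k (_ : 4 / t * a = 4 * (a / t)); last by ring.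
  nra.
have k3 : k^-1 <= 2 by rewrite -[leLHS]mul1r ler_pdivrMr//; lra.
have h4 : cabs (g (phi h) + conjc g0) <= 2 * a + e / 2 by lra.
move: h4; set X := cabs (_ + _); set Y := _ + e => h4.
rewrite [leRHS]mulrC -(mulrA (cabs h)) ler_wpM2l ?cabs_ge0// /Y.
have kv : 0 < k^-1 by rewrite invr_gt0.
have := ler_wpM2l (ltW kv) h4.
have := ler_wpM2r (ltW a0) k2; have := ler_wpM2r (ltW e0) k3; lra.
Qed.

End Disc.
End Barrier.

(** * Logarithmic bumps and truncated moduli *)

Section LipschitzFunctions.
Context {R : realType} {d : nat}.
Implicit Types (phi : R[i] -> Cn R d) (T : Cn R d -> R) (F : Cn R d -> R[i]).
Local Open Scope complex_scope.

Lemma ln_diff_le (u v k : R) : 0 < u -> 0 < v -> u - v <= k * v -> v - u <= k * u ->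
  `|ln u - ln v| <= k.
Proof.
move=> u0 v0 h1 h2.
have ln_le (x y : R) : 0 < x -> 0 < y -> x - y <= k * y -> ln x - ln y <= k.
  move=> x0 y0 h; rewrite -ln_div ?posrE//.
  have -> : x / y = 1 + (x / y - 1) by ring.
  have xy : -1 < x / y - 1 by have : 0 < x / y := divr_gt0 x0 y0; lra.
  apply: le_trans (le_ln1Dx xy) _; rewrite lerBlDr ler_pdivrMr// mulrDl mul1r; lra.
rewrite ler_norml; apply/andP; split; last exact: ln_le.
by have := ln_le _ _ v0 u0 h2; lra.
Qed.

(** The derivative of 1/2 ln (1/G + k) is - 1 / (2 G (1 + k G)), the exact inverse of the speed 2 G
    (1 + k G) permitted by [barrier_step] when k = 4 / t. *)
Lemma ln_inv_step (G G0 k e de : R) : 0 < G -> 0 < G0 -> 0 <= k -> 0 < e ->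
  `|G - G0| <= (2 * G0 * (1 + k * G0) + e * G0) * de -> 0 <= de ->
  (1 + e / 2) * G0 <= (1 + e) * G ->
  `|2^-1 * ln (G^-1 + k) - 2^-1 * ln (G0^-1 + k)| <= (1 + e) * de.
Proof.
move=> Gp G0p k0 e0 hG de0 GG.
rewrite -mulrBr normrM gtr0_norm ?invr_gt0// mulrC ler_pdivrMr//.
have p (x : R) : 0 < x -> 0 < x^-1 + k by move=> x0; rewrite ltr_pwDl ?invr_gt0.
have key (A B : R) : 0 < A -> 0 < B -> `|G - G0| <= (1 + e) * de * 2 * A * (1 + k * B) ->
    A^-1 - B^-1 <= `|G - G0| / (A * B) -> A^-1 + k - (B^-1 + k) <= (1 + e) * de * 2 * (B^-1 + k).
  move=> A0 B0 h1 h2; rewrite opprD addrACA subrr addr0 (le_trans h2)//.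
  rewrite ler_pdivrMr ?mulr_gt0// (le_trans h1)//.
  by rewrite le_eqVlt; apply/orP; left; apply/eqP; field; rewrite gt_eqF.
have dist (A B : R) : 0 < A -> 0 < B -> `|B - A| = `|G - G0| -> A^-1 - B^-1 <= `|G - G0| / (A * B).
  move=> A0 B0 <-; have -> : A^-1 - B^-1 = (B - A) / (A * B) by field; rewrite !gt_eqF.
  by rewrite ler_pM2r ?ler_norm// invr_gt0 mulr_gt0.
have s1 : 2 * G0 * (1 + k * G0) + e * G0 <= 2 * ((1 + e / 2) * G0) * (1 + k * G0).
  have : 0 <= e * k * G0 * G0 by rewrite !mulr_ge0// ltW.
  lra.
have kG : 0 <= k * G0 by rewrite mulr_ge0// ltW.
apply: ln_diff_le; [exact: p|exact: p| |].
  apply: key => //; last by apply: dist => //; rewrite distrC.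
  apply: (le_trans hG).
  have : 2 * ((1 + e / 2) * G0) * (1 + k * G0) <= 2 * ((1 + e) * G) * (1 + k * G0).
    by rewrite ler_wpM2r ?ler_wpM2l//; lra.
  by move=> /(le_trans s1) /(ler_wpM2r de0); lra.
apply: key => //; last by apply: dist.
apply: (le_trans hG).
have : 2 * ((1 + e / 2) * G0) * (1 + k * G0) <= 2 * G0 * ((1 + e) * (1 + k * G)).
  rewrite (_ : 2 * ((1 + e / 2) * G0) * (1 + k * G0) = 2 * G0 * ((1 + e / 2) * (1 + k * G0))); last by ring.
  rewrite ler_wpM2l//; first by rewrite mulr_ge0// ltW.
  have := ler_wpM2l k0 GG; lra.
by move=> /(le_trans s1) /(ler_wpM2r de0); lra.
Qed.

Lemma max0_lip (u v k : R) : `|Num.max 0 (u - k) - Num.max 0 (v - k)| <= `|u - v|.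
Proof.
have [h1|h1] := leP 0 (u - k); have [h2|h2] := leP 0 (v - k).
- by rewrite opprB addrA subrK.
- by rewrite subr0 ger0_norm// (le_trans _ (ler_norm _))//; lra.
- by rewrite sub0r normrN ger0_norm// distrC (le_trans _ (ler_norm _))//; lra.
- by rewrite subrr normr0.
Qed.

Context (D : set (Cn R d)) (q : Cn R d) (g : Cn R d -> R[i]) (s c : R).
Hypotheses (s0 : 0 < s) (c0 : 0 < c) (Dq : ~ D q) (ghol : hol_on (pball D q s) g).
Hypothesis gpos : forall x, pball D q s x -> c * en (x - q) ^+ 2 <= complex.Re (g x).

Let t := c * s ^+ 2 / 12.
Let tp : 0 < t := t_gt0 s0 c0.
Let gp := g_gt0 c0 Dq gpos.

(* The summand [k] corrects -1/2 ln |g| for the second order term of [barrier_step]. *)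
Definition bump (k eta : R) x : R := if `[< en (x - q) < s >] then
  Num.max 0 (2^-1 * ln ((cabs (g x))^-1 + k) - 2^-1 * ln (eta^-1 + k)) else 0.

Lemma bump_ge0 k eta x : 0 <= bump k eta x.
Proof. by rewrite /bump; case: ifP => // _; rewrite le_max lexx. Qed.

Lemma bump_supp k eta x : 0 <= k -> 0 < eta -> D x -> bump k eta x != 0 ->
  en (x - q) < s /\ cabs (g x) < eta.
Proof.
move=> k0 eta0 Dx; rewrite /bump; case: asboolP => xs; last by rewrite eqxx.
move=> h; split => //; rewrite ltNge; apply: contra_neqN h => eg.
have gx : 0 < cabs (g x) by rewrite (lt_le_trans _ eg).
apply: max_l; rewrite subr_le0 ler_pM2l ?invr_gt0// ler_ln ?posrE; last 2 first.
- by rewrite ltr_pwDl ?invr_gt0.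
- by rewrite ltr_pwDl ?invr_gt0.
by rewrite lerD2r lef_pV2.
Qed.

Lemma near_zero_disc phi (P : R[i] -> Prop) : hdisc D phi ->
  cnear 0 P -> cnear 0 (fun h => [/\ P h, cabs h < 1 & D (phi h)]).
Proof.
move=> hp hP; have c01 : cabs (0 : R[i]) < 1 by rewrite cabs0.
by apply: cnearS2 hP (near_disc c01) => z Pz z1; split => //; case: (hp z z1).
Qed.

(** The support lies where |g| < [eta], so [Re g < t / 4], while [Re g >= 3 * t] near the sphere of
    radius [s]: the extension by 0 is harmless, and where the bump is positive [barrier_step]
    applies. *)
Lemma inf_lip_bump eta : 0 < eta -> eta <= t / 4 -> inf_lip D (bump (4 / t) eta).
Proof.
move=> eta0 etat phi hp e e0; have k0 : 0 <= 4 / t by rewrite divr_ge0// ltW.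
have c01 : cabs (0 : R[i]) < 1 by rewrite cabs0.
have D0 : D (phi 0) by case: (hp _ c01).
have e1 : 0 <= 1 + e by lra.
have zero x : D x -> (en (x - q) < s -> eta <= complex.Re (g x)) -> bump (4 / t) eta x = 0.
  move=> Dx h; apply: contrapT => /eqP /(bump_supp k0 eta0 Dx)[/h h1 h2].
  by have := Re_le_cabs (g x); rewrite leNgt (lt_le_trans h2).
have [ps|ps] := ltP (en (phi 0 - q)) s; last first.
  apply: cnearS (near_zero_disc hp (near_far s0 c0 gpos hp c01 ps)) => h [hg h1 Dh].
  rewrite (zero (phi 0)) ?(zero (phi h))//; first by rewrite subrr normr0 mulr_ge0 ?cabs_ge0.
    by move=> /hg; rewrite -/t; lra.
  by rewrite ltNge ps.
have P0 : pball D q s (phi 0) by [].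
have gc : ccont (fun z => g (phi z)) 0 by apply/cdiff_ccont/ghol => //; exact: (hp _ c01).2.
have [gt|gt] := leP (complex.Re (g (phi 0))) (t / 4); last first.
  have p : 0 < complex.Re (g (phi 0)) - t / 4 by rewrite subr_gt0.
  apply: cnearS (near_zero_disc hp (rcont_Re gc p)) => h [hg h1 Dh].
  rewrite (zero (phi 0)) ?(zero (phi h))//; first by rewrite subrr normr0 mulr_ge0 ?cabs_ge0.
    by move=> _; move: hg; rewrite ltr_norml => /andP[+ _]; lra.
  by move=> _; lra.
have G0p : 0 < cabs (g (phi 0)) by rewrite (lt_le_trans (gp P0))// Re_le_cabs.
set G0 := cabs (g (phi 0)) in G0p.
have e2 : 0 < e * G0 by rewrite mulr_gt0.
(* If |g| moves by less than this amount, it stays above [(1 + e / 2) / (1 + e) * G0], the last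
   condition of [ln_inv_step]. *)
have e3 : 0 < (e / 2) * G0 / (1 + e) by rewrite !(divr_gt0, mulr_gt0)//; lra.
have := cnearI (barrier_step s0 c0 Dq ghol gpos hp e2 ps gt) (gc _ e3).
apply: cnearS => h [[h1 hs hg] hc]; rewrite /bump.
case: asboolP => // _; case: asboolP => // _; apply: le_trans (max0_lip _ _ _) _.
have GG : `|cabs (g (phi h)) - G0| <= cabs (g (phi h) - g (phi 0)).
  rewrite ler_norml; apply/andP; split; last exact: cabs_sub_ge.
  by rewrite cabsB; have := cabs_sub_ge (g (phi 0)) (g (phi h)); rewrite -/G0; lra.
have GGG : (1 + e / 2) * G0 <= (1 + e) * cabs (g (phi h)).
  have := le_lt_trans GG hc; rewrite ltr_pdivlMr; last lra.
  move=> h3; have e1' : 0 < 1 + e by lra.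
  have := ler_norm (- (cabs (g (phi h)) - G0)); rewrite normrN => /(ler_wpM2r (ltW e1')).
  lra.
apply: ln_inv_step => //.
- by have : 0 < (1 + e / 2) * G0 by [rewrite mulr_gt0//; lra]; move=> /lt_le_trans/(_ GGG); rewrite pmulr_rgt0//; lra.
- apply: (le_trans GG); apply: (le_trans hg); rewrite -/t ler_wpM2r ?cabs_ge0// lerD2r.
  have g0G : complex.Re (g (phi 0)) <= G0 by exact: Re_le_cabs.
  have g0p := ltW (gp P0).
  rewrite ler_pM ?ler_wpM2l//; first by rewrite mulr_ge0.
    by rewrite addr_ge0// mulr_ge0.
  by rewrite lerD2l ler_wpM2l.
- exact: cabs_ge0.
Qed.

(** Where [Re g > t / 4], in particular near the sphere of radius [s], |F| exceeds [tau] and the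
    truncated function is constant; this permits its extension by [tau]. A derivative bound is
    therefore needed only at centres with |F| at most [tau]. *)
Lemma inf_lip_trunc F (K tau : R) : 0 < K -> hol_on (pball D q s) F ->
  (forall x, pball D q s x -> cabs (F x) <= tau -> complex.Re (g x) <= t / 4) ->
  (forall phi, hdisc D phi -> en (phi 0 - q) < s -> cabs (F (phi 0)) <= tau ->
     forall e : R, 0 < e -> cnear 0 (fun h => [/\ cabs h < 1, en (phi h - q) < s &
        cabs (F (phi h) - F (phi 0)) <= (K + e) * cabs h])) ->
  inf_lip D (fun x => (if `[< en (x - q) < s >] then Num.min (cabs (F x)) tau else tau) / K).
Proof.
move=> K0 Fh Ft Fl phi hp e e0.
have c01 : cabs (0 : R[i]) < 1 by rewrite cabs0.
have D0 : D (phi 0) by case: (hp _ c01).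
have e1 : 0 <= 1 + e by lra.
pose E x := if `[< en (x - q) < s >] then Num.min (cabs (F x)) tau else tau.
have Eout x : D x -> (en (x - q) < s -> tau <= cabs (F x)) -> E x = tau.
  by rewrite /E => Dx; case: asboolP => // xs /(_ xs) /min_r.
rewrite -/(E (phi 0)).
suff : cnear 0 (fun h => `|E (phi h) - E (phi 0)| <= K * (1 + e) * cabs h).
  apply: cnearS => h hE; rewrite -/(E (phi h)) -mulrBl normrM normfV (gtr0_norm K0).
  by rewrite ler_pdivrMr// (le_trans hE)// le_eqVlt; apply/orP; left; apply/eqP; ring.
have triv : forall h, D (phi h) -> (en (phi h - q) < s -> tau <= cabs (F (phi h))) ->
    E (phi 0) = tau -> `|E (phi h) - E (phi 0)| <= K * (1 + e) * cabs h.
  by move=> h Dh hF ->; rewrite Eout// subrr normr0 !mulr_ge0 ?cabs_ge0// ltW.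
have big x : pball D q s x -> t / 4 < complex.Re (g x) -> tau <= cabs (F x).
  by move=> Px gx; rewrite leNgt; apply/negP => /ltW /(Ft _ Px); rewrite leNgt gx.
have [ps|ps] := ltP (en (phi 0 - q)) s; last first.
  apply: cnearS (near_zero_disc hp (near_far s0 c0 gpos hp c01 ps)) => h [hg h1 Dh].
  apply: triv => //; last by apply: Eout => //; rewrite ltNge ps.
  by move=> hs; apply: big => //; have := hg hs; have := tp; rewrite -/t; lra.
have P0 : pball D q s (phi 0) by [].
have Fc : ccont (fun z => F (phi z)) 0 by apply/cdiff_ccont/Fh => //; exact: (hp _ c01).2.
have [Ftau|Ftau] := leP (cabs (F (phi 0))) tau; last first.
  have p : 0 < cabs (F (phi 0)) - tau by rewrite subr_gt0.
  apply: cnearS (near_zero_disc hp (Fc _ p)) => h [hg h1 Dh].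
  apply: triv => //; last by apply: Eout => // _; exact: ltW.
  by move=> _; have := cabs_sub_ge (F (phi 0)) (F (phi h)); rewrite cabsB; lra.
have Ke : 0 < K * e by rewrite mulr_gt0.
apply: cnearS (Fl phi hp ps Ftau _ Ke) => h [h1 hs hF].
have -> : K * (1 + e) = K + K * e by ring.
apply: le_trans hF; rewrite /E; case: asboolP => // _; case: asboolP => // _.
have := cabs_sub_ge (F (phi 0)) (F (phi h)); rewrite cabsB.
have := cabs_sub_ge (F (phi h)) (F (phi 0)).
move: (cabs (F (phi h))) (cabs (F (phi 0))) (cabs (_ - _)) => u v w h2 h3.
by rewrite ler_norml /Num.min; case: ifP; case: ifP; lra.
Qed.

End LipschitzFunctions.

Section LipschitzDifference.
Context {R : realType} {d : nat}.
Implicit Types (D : set (Cn R d)) (T : Cn R d -> R).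

(** If one function is positive at the centre, the other vanishes along the disc nearby; if both
    vanish at the centre, each value of the difference is, up to sign, a value of only one of them.
    So the Lipschitz constants do not add. *)
Lemma inf_lip_diff D T1 T2 : inf_lip D T1 -> inf_lip D T2 ->
  (forall x, 0 <= T1 x) -> (forall x, 0 <= T2 x) ->
  (forall x, D x -> T1 x = 0 \/ T2 x = 0) -> inf_lip D (fun x => T1 x - T2 x).
Proof.
move=> L1 L2 p1 p2 disj phi hp e e0.
have c01 : cabs (0 : R[i]) < 1 by rewrite cabs0.
have D0 : D (phi 0) by case: (hp _ c01).
have pos (T T' : Cn R d -> R) : inf_lip D T -> (forall x, 0 <= T x) ->
    (forall x, D x -> T x = 0 \/ T' x = 0) -> T (phi 0) != 0 ->
    cnear 0 (fun h => T' (phi h) = 0).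
  move=> L p dj T0; have Tp : 0 < T (phi 0) by rewrite lt_def T0 p.
  have q0 : 0 < T (phi 0) / (1 + e) by rewrite divr_gt0//; lra.
  apply: cnearS2 (near_zero_disc hp (L phi hp _ e0)) (cnear_lt 0 q0) => h [hT h1 Dh].
  rewrite subr0 ltr_pdivlMr; last lra.
  move=> h2; have [Th|//] := dj _ Dh; move: hT; rewrite Th sub0r normrN ger0_norm//.
  lra.
have near12 := near_zero_disc hp (cnearI (L1 phi hp _ e0) (L2 phi hp _ e0)).
have [T10|T10] := eqVneq (T1 (phi 0)) 0; last first.
  have T2h := pos T1 T2 L1 p1 disj T10; have T20 := cnear_at T2h.
  by apply: cnearS2 near12 T2h => h [[h1 _] _ _] ->; rewrite T20 !subr0.
have [T20|T20] := eqVneq (T2 (phi 0)) 0; last first.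
  have T1h : cnear 0 (fun h => T1 (phi h) = 0).
    by apply: (pos T2) => // x /disj [|]; [right|left].
  by apply: cnearS2 near12 T1h => h [[_ h2] _ _] ->; rewrite T10 !sub0r -opprD normrN.
apply: cnearS near12 => h [[h1 h2] _ Dh]; move: h1 h2; rewrite T10 T20 !subr0.
by case: (disj _ Dh) => ->; rewrite ?subr0// sub0r normrN.
Qed.

End LipschitzDifference.

(** * Calculus along real lines *)

Section DirectionalCalculus.
Context {R : realType} {d : nat}.
Implicit Types (f h : Cn R d -> R) (x y z v w p : Cn R d) (V : set (Cn R d)).
Local Open Scope complex_scope.

(* Locked for the same reason as [en]. *)
Definition dv : Cn R d -> (Cn R d -> R) -> Cn R d -> R := locked (@rderive R d).

Lemma dvE : @rderive R d = dv.
Proof. exact: lock. Qed.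

Definition dd f V := forall v z, V z -> derivable (rline f v z) 0 1.

Definition ncont f z := forall e, 0 < e -> enear z (fun x => `|f x - f z| < e).

Definition C1 V f := dd f V /\ forall v z, V z -> ncont (dv v f) z.

Lemma ncontP f z : ncont f z <-> {for z, continuous f}.
Proof.
have cvgP := @cvgrPdist_lt R R (Cn R d) (nbhs z) (nbhs_filter z) f (f z); split => h.
  apply/cvgP => e e0; have [s s0 hs] := h e e0; apply/(nbhs_enear z).
  by exists s => // x /hs; rewrite distrC.
move=> e e0; move/cvgP : h => /(_ _ e0) /(nbhs_enear z)[s s0 hs].
by exists s => // x /hs; rewrite distrC.
Qed.

Lemma openP V : open V -> forall z, V z -> enear z V.
Proof. by rewrite openE => oV z /oV; rewrite /interior => /nbhs_enear. Qed.

Lemma realZ_add (a b : R) v : (a + b)%:C *: v = a%:C *: v + b%:C *: v.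
Proof. by rewrite rmorphD scalerDl. Qed.

Lemma en_realZ (a : R) v : en (a%:C *: v) = `|a| * en v.
Proof. by rewrite enormZ cabs_real. Qed.

Lemma realZ_assoc (a b : R) v : (a * b)%:C *: v = a%:C *: (b%:C *: v).
Proof. by rewrite rmorphM scalerA. Qed.

Lemma realZ1 v : (1 : R)%:C *: v = v.
Proof. exact: scale1r. Qed.

Lemma realZ0 v : (0 : R)%:C *: v = 0.
Proof. exact: scale0r. Qed.

Lemma rline_is_derive f v z (t : R) : derivable (rline f v (z + t%:C *: v)) 0 1 ->
  is_derive t 1 (rline f v z) (dv v f (z + t%:C *: v)).
Proof.
move=> h; have h0 : is_derive (t - t) 1 (rline f v (z + t%:C *: v)) (dv v f (z + t%:C *: v)).
  by rewrite (subrr t); apply: DeriveDef; [exact: h|rewrite -dvE /rderive derive1E].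
have hs : is_derive t 1 (fun s : R => s - t) 1 by apply: is_derive_shift.
have := @is_derive1_comp R (rline f v (z + t%:C *: v)) (fun s => s - t) t _ 1 h0 hs.
rewrite mulr1.
have -> // : rline f v (z + t%:C *: v) \o (fun s : R => s - t) = rline f v z.
apply/funext => s; rewrite /rline /= -addrA -realZ_add; congr (f (_ + _ *: _)).
by rewrite subrKC.
Qed.

Lemma rderive_littleo f V v z e : dd f V -> V z -> 0 < e ->
  exists2 k : R, 0 < k & forall t : R, `|t| < k ->
    `|f (z + t%:C *: v) - f z - t * dv v f z| <= e * `|t|.
Proof.
move=> fd Vz e0; have fd' : derivable (rline f v (z + (0 : R)%:C *: v)) 0 1.
  by rewrite realZ0 addr0; exact: fd.
have := rline_is_derive fd'; rewrite realZ0 addr0 => hd.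
have [k k0 h] := is_derive_littleo hd e0; exists k => // t tk.
by have := h t; rewrite subr0 mulrC /rline realZ0 addr0; exact.
Qed.

Lemma rderive_unique f V v z (l : R) : dd f V -> V z ->
  (forall e, 0 < e -> exists2 k : R, 0 < k & forall t : R, `|t| < k ->
    `|f (z + t%:C *: v) - f z - t * l| <= e * `|t|) -> dv v f z = l.
Proof.
move=> fd Vz h; apply/eqP; rewrite -subr_eq0 -normr_le0; apply/ler_addgt0Pl => e e0.
rewrite addr0; have e20 : 0 < e / 2 by rewrite divr_gt0.
have [k1 k10 h1] := rderive_littleo v fd Vz e20; have [k2 k20 h2] := h _ e20.
pose t := Num.min k1 k2 / 2; have m0 : 0 < Num.min k1 k2 by rewrite lt_min k10.
have t0 : 0 < t by rewrite divr_gt0.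
have tm : t < Num.min k1 k2 by rewrite ltr_pdivrMr// ltr_pMr// (ltr_nat _ 1 2).
move: (tm); rewrite lt_min -[in X in X -> _](gtr0_norm t0) => /andP[/h1 b1 /h2 b2].
rewrite -(ler_pM2l t0) -[X in X * `|_|](gtr0_norm t0) -normrM.
have -> : t * (dv v f z - l) = (f (z + t%:C *: v) - f z - t * l) -
   (f (z + t%:C *: v) - f z - t * dv v f z) by ring.
rewrite (le_trans (ler_normB _ _))// (le_trans (lerD b2 b1))// gtr0_norm//; lra.
Qed.

Lemma segment_MVT f V x v : dd f V -> (forall t : R, 0 <= t <= 1 -> V (x + t%:C *: v)) ->
  exists2 t : R, 0 <= t <= 1 & f (x + v) - f x = dv v f (x + t%:C *: v).
Proof.
move=> fd Vt.
have hdt (t : R) : 0 <= t <= 1 -> is_derive t 1 (rline f v x) (dv v f (x + t%:C *: v)).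
  by move=> t01; apply/rline_is_derive/fd/Vt.
have [| |t] := @MVT_segment R (rline f v x) (fun t => dv v f (x + t%:C *: v)) 0 1 ler01.
- by move=> t; rewrite in_itv /= => /andP[t0 t1]; apply: hdt; rewrite !ltW.
- apply: continuous_in_subspaceT => t; rewrite inE /= in_itv /= => /hdt [dt _].
  exact/differentiable_continuous/derivable1_diffP.
by rewrite in_itv /= => t01; rewrite subr0 mulr1 /rline realZ1 realZ0 addr0 => E; exists t.
Qed.

Lemma enear_cvx z (s : R) x v : en (x - z) < s -> en (x + v - z) < s ->
  forall t : R, 0 <= t <= 1 -> en (x + t%:C *: v - z) < s.
Proof.
move=> xs xvs t /andP[t0 t1].
have -> : x + t%:C *: v - z = (1 - t)%:C *: (x - z) + t%:C *: (x + v - z).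
  by apply: eq_co => j; rewrite !(coD, coB, coZ, coN) rmorphB rmorph1; ring.
rewrite (le_lt_trans (enormD _ _))// !en_realZ !ger0_norm ?subr_ge0//.
have [->|tn0] := eqVneq t 0; first by rewrite subr0 mul1r mul0r addr0.
have tp : 0 < t by rewrite lt_def tn0.
apply: (@lt_le_trans _ _ ((1 - t) * s + t * s)); last by rewrite -mulrDl subrK mul1r.
by rewrite ler_ltD ?ltr_pM2l// ler_wpM2l ?subr_ge0// ltW.
Qed.

Lemma rderiveZ f V (a : R) v z : dd f V -> V z ->
  dv (a%:C *: v) f z = a * dv v f z.
Proof.
move=> fd Vz; apply: (rderive_unique fd Vz) => e e0.
have e1 : 0 < e / (`|a| + 1) by rewrite divr_gt0// ltr_wpDl.
have [k k0 h] := rderive_littleo v fd Vz e1.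
exists (k / (`|a| + 1)); first by rewrite divr_gt0// ltr_wpDl.
move=> t; rewrite ltr_pdivlMr ?ltr_wpDl// => tk.
have ta : `|t * a| < k.
  by rewrite normrM (le_lt_trans _ tk)// ler_wpM2l// lerDl.
have := h _ ta; rewrite realZ_assoc -(mulrA t) => b; rewrite (le_trans b)//.
have -> : e / (`|a| + 1) * `|t * a| = e * `|t| * (`|a| / (`|a| + 1)).
  by rewrite normrM; ring.
by rewrite ler_piMr ?mulr_ge0 ?(ltW e0)// ler_pdivrMr ?ltr_wpDl// mul1r lerDl.
Qed.

(** The increment along [v + w] is split into a leg along [v] at [z], treated by differentiability,
    and a displaced leg along [w], treated by the mean value theorem and the continuity of
    [dv w f]. *)
Lemma C1_rderiveD f V v w z : open V -> C1 V f -> V z ->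
  dv (v + w) f z = dv v f z + dv w f z.
Proof.
move=> oV [fd fc] Vz; apply: (rderive_unique fd Vz) => e e0.
have e20 : 0 < e / 2 by rewrite divr_gt0.
have [k1 k10 h1] := rderive_littleo v fd Vz e20.
have [k2 k20 h2] := fc w z Vz _ e20; have [k3 k30 h3] := openP oV Vz.
pose N := en v + en w + 1; have N0 : 0 < N by rewrite ltr_wpDl// addr_ge0 ?enorm_ge0.
pose m := Num.min k2 k3; have m0 : 0 < m by rewrite lt_min k20.
exists (Num.min k1 (m / N)); first by rewrite lt_min k10 divr_gt0.
move=> t; rewrite lt_min ltr_pdivlMr// => /andP[tk1 tN].
have near1 u : en (t%:C *: u) <= `|t| * N -> en (z + t%:C *: u - z) < m.
  by move=> h; rewrite addrAC subrr add0r (le_lt_trans h).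
have b1 : en (z + t%:C *: v - z) < m.
  by apply: near1; rewrite en_realZ ler_wpM2l// /N; have := enorm_ge0 w; lra.
have b2 : en (z + t%:C *: v + t%:C *: w - z) < m.
  rewrite -(addrA z) -scalerDr; apply: near1; rewrite en_realZ ler_wpM2l// /N.
  by have := enormD v w; lra.
have cv := enear_cvx b1 b2.
have [|u u01 E] := @segment_MVT f V (z + t%:C *: v) (t%:C *: w) fd.
  move=> u /cv h; apply: h3; apply: lt_le_trans h _; by rewrite /m ge_min lexx orbT.
rewrite (rderiveZ _ _ fd) in E; last first.
  by apply: h3; apply: lt_le_trans (cv _ u01) _; rewrite /m ge_min lexx orbT.
have h4 := h2 _ (lt_le_trans (cv _ u01) (_ : m <= k2)); rewrite /m ge_min lexx in h4.
have {}h4 := h4 isT; have h5 := h1 _ tk1.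
rewrite scalerDr addrA.
have -> : f (z + t%:C *: v + t%:C *: w) = f (z + t%:C *: v) +
  t * dv w f (z + t%:C *: v + u%:C *: (t%:C *: w)) by rewrite -E subrKC.
move: h4; set dw := dv w f (_ + _ *: _) => h4.
have -> : f (z + t%:C *: v) + t * dw - f z - t * (dv v f z + dv w f z) =
  (f (z + t%:C *: v) - f z - t * dv v f z) + t * (dw - dv w f z) by ring.
rewrite (le_trans (ler_normD _ _))// normrM.
have := ler_wpM2l (normr_ge0 t) (ltW h4); lra.
Qed.

Definition rlin (L : Cn R d -> R) :=
  (forall v w, L (v + w) = L v + L w) /\ (forall (a : R) v, L (a%:C *: v) = a * L v).

Lemma C1_rlin V f z : open V -> C1 V f -> V z -> rlin (fun v => dv v f z).
Proof.
move=> oV fC Vz; split => [v w|a v]; first exact: C1_rderiveD fC Vz.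
by apply: rderiveZ Vz; case: fC.
Qed.

Lemma basis_expand v :
  v = \sum_j ((complex.Re (co v j))%:C *: xdir j + (complex.Im (co v j))%:C *: ydir j).
Proof.
apply: eq_co => i; rewrite /co summxE (bigD1 i)//= big1 ?addr0 => [|j ji].
  rewrite !mxE !eqxx /=.
  by case: (v 0 i) => a b; apply: eqc; rewrite /= /GRing.scale /=; ring.
by rewrite !mxE eqxx /= [i == j]eq_sym (negbTE ji); apply: eqc; rewrite /= ?ReImE/=; ring.
Qed.

Lemma rlinE L v : rlin L ->
  L v = \sum_j (complex.Re (co v j) * L (xdir j) + complex.Im (co v j) * L (ydir j)).
Proof.
move=> [LD LZ]; have L0 : L 0 = 0 by have := LZ 0 0; rewrite realZ0 mul0r.
rewrite {1}[v]basis_expand (big_morph L LD L0).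
by apply: eq_bigr => j _; rewrite LD !LZ.
Qed.

Lemma rlin_bound L v e : rlin L ->
  (forall j, `|L (xdir j)| <= e /\ `|L (ydir j)| <= e) -> `|L v| <= (2 * d%:R * e) * en v.
Proof.
move=> /rlinE -> h; apply: le_trans (ler_norm_sum _ _ _) _.
apply: (@le_trans _ _ (\sum_(j < d) 2 * e * en v)).
  apply: ler_sum => j _; have [h1 h2] := h j.
  apply: le_trans (ler_normD _ _) _; rewrite !normrM.
  have cj := co_le_enorm v j.
  have b1 := ler_pM (normr_ge0 _) (normr_ge0 _) (le_trans (normRe_le _) cj) h1.
  have b2 := ler_pM (normr_ge0 _) (normr_ge0 _) (le_trans (normIm_le _) cj) h2.
  lra.
by rewrite sumr_const card_ord -[leLHS]mulr_natr le_eqVlt; apply/orP; left; apply/eqP; ring.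
Qed.

Lemma rlinB L M : rlin L -> rlin M -> rlin (fun v => L v - M v).
Proof.
move=> [LD LZ] [MD MZ]; split => [v w|a v]; first by rewrite LD MD; ring.
by rewrite LZ MZ; ring.
Qed.

End DirectionalCalculus.

(** * Gradients, Hessians and the Levi form *)

Section SecondOrder.
Context {R : realType} {d : nat}.
Implicit Types (f h r : Cn R d -> R) (x y z v w p q X : Cn R d) (V : set (Cn R d)).
Local Open Scope complex_scope.

Lemma enear_all (I : finType) z (P : I -> Cn R d -> Prop) :
  (forall i, enear z (P i)) -> enear z (fun x => forall i, P i x).
Proof.
move=> hP; suff: enear z (fun x => forall i, i \in enum I -> P i x).
  by move=> [s s0 hs]; exists s => // x /hs xs i; apply: xs; rewrite mem_enum.
elim: (enum I) => [|i l [s s0 hs]]; first by exists 1.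
have [s' s'0 hs'] := hP i; exists (Num.min s s'); first by rewrite lt_min s0.
move=> x; rewrite lt_min => /andP[/hs h1 /hs' h2] j.
by rewrite inE => /orP[/eqP ->|/h1].
Qed.

(** Continuity is given for one direction at a time; linearity reduces all directions to the 2d
    basis vectors, hence the constant [k]. *)
Lemma C1_near V f p e : open V -> C1 V f -> V p -> 0 < e -> exists2 s : R, 0 < s &
  forall x, en (x - p) < s -> V x /\ forall v, `|dv v f x - dv v f p| <= e * en v.
Proof.
move=> oV fC Vp e0; have fc := fC.2.
pose k := e / (2 * d%:R + 1); have k0 : 0 < k by rewrite divr_gt0// ltr_wpDl ?mulr_ge0.
have [s1 s10 h1] := openP oV Vp.
have [s2 s20 h2] := enear_all (fun j => fc (xdir j) p Vp _ k0).
have [s3 s30 h3] := enear_all (fun j => fc (ydir j) p Vp _ k0).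
exists (Num.min s1 (Num.min s2 s3)); first by rewrite !lt_min s10 s20.
move=> x; rewrite !lt_min => /and3P[/h1 Vx /h2 xx /h3 xy]; split => // v.
have L := rlinB (C1_rlin oV fC Vx) (C1_rlin oV fC Vp).
apply: le_trans (rlin_bound v L (e := k) _) _.
  by move=> j; split; exact/ltW.
rewrite ler_wpM2r ?enorm_ge0// /k mulrCA ler_piMr ?(ltW e0)//.
by rewrite ler_pdivrMr ?ltr_wpDl ?mulr_ge0// mul1r lerDl.
Qed.

Definition gr f z : Cn R d := \row_j (dv (xdir j) f z +i* dv (ydir j) f z).

Lemma grad_gr f z : grad f z = gr f z.
Proof. by rewrite /grad dvE. Qed.

Lemma Re_mul_conj (a : R[i]) (x y : R) :
  complex.Re (a * conjc (x +i* y)) = complex.Re a * x + complex.Im a * y.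
Proof. by case: a => a b /=; ring. Qed.

Lemma co_gr f z j : co (gr f z) j = dv (xdir j) f z +i* dv (ydir j) f z.
Proof. by rewrite /co mxE. Qed.

Lemma dv_gr V f v z : open V -> C1 V f -> V z ->
  dv v f z = complex.Re (hd v (gr f z)).
Proof.
move=> oV fC Vz; rewrite (rlinE v (C1_rlin oV fC Vz)) hdotE.
rewrite (big_morph (@complex.Re R) (@ReD R) (erefl _)); apply: eq_bigr => j _.
by rewrite co_gr Re_mul_conj.
Qed.

Lemma ball_MVT V f p x y (s : R) : dd f V -> (forall z, en (z - p) < s -> V z) ->
  en (x - p) < s -> en (y - p) < s ->
  exists2 t : R, 0 <= t <= 1 & en (x + t%:C *: (y - x) - p) < s /\
    f y - f x = dv (y - x) f (x + t%:C *: (y - x)).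
Proof.
move=> fd sV xs ys; have cv : en (x + (y - x) - p) < s by rewrite (subrKC x y).
have xt := enear_cvx xs cv.
have [|t t01 E] := @segment_MVT R d f V x (y - x) fd; first by move=> t /xt /sV.
by exists t => //; split; [exact: xt|rewrite -E (subrKC x y)].
Qed.

Lemma C1_lip V f p : open V -> C1 V f -> V p -> exists2 s : R, 0 < s &
  exists2 L : R, 0 <= L & forall x, en (x - p) < s -> V x /\
    forall y, en (y - p) < s -> `|f y - f x| <= L * en (y - x).
Proof.
move=> oV fC Vp; have [s s0 hs] := C1_near oV fC Vp ltr01.
exists s => //; exists (en (gr f p) + 1); first by rewrite addr_ge0 ?enorm_ge0.
move=> x xs; have [Vx _] := hs x xs; split => // y ys.
have [|t t01 [ts ->]] := ball_MVT fC.1 _ xs ys; first by move=> z /hs[].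
have [_ /(_ (y - x)) h] := hs _ ts.
have h2 : `|dv (y - x) f p| <= en (gr f p) * en (y - x).
  rewrite (dv_gr _ oV fC Vp) (le_trans (normRe_le _))// mulrC.
  exact: cauchy_schwarz.
rewrite -[dv _ _ _](subrK (dv (y - x) f p)).
by rewrite (le_trans (ler_normD _ _))// mulrDl addrC lerD.
Qed.

Lemma C1_ncont V f z : open V -> C1 V f -> V z -> ncont f z.
Proof.
move=> oV fC Vz e e0; have [s s0 [L L0 hL]] := C1_lip oV fC Vz.
have L1 : 0 < L + 1 by rewrite ltr_wpDl.
exists (Num.min s (e / (L + 1))); first by rewrite lt_min s0 divr_gt0.
move=> x; rewrite lt_min ltr_pdivlMr// => /andP[xs xe].
have zs : en (z - z) < s by rewrite subrr enorm0.
have [_ /(_ x xs) h] := hL z zs.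
by rewrite (le_lt_trans h)// (le_lt_trans _ xe)// mulrC ler_wpM2l ?enorm_ge0// lerDl.
Qed.

Lemma Ck1_C1 V r : Ck 1 V r -> C1 V r.
Proof.
move=> hr; split => v z Vz; first by have [h _] := hr v; exact: h.
by have [_ h] := hr v; apply/ncontP; rewrite -dvE; exact: h.
Qed.

Lemma affine_errD (A A' B B' h h' t e T : R) :
  `|A - B - t * h| <= e / 2 * T -> `|A' - B' - t * h'| <= e / 2 * T ->
  `|A + A' - (B + B') - t * (h + h')| <= e * T.
Proof.
move=> b1 b2; have -> : A + A' - (B + B') - t * (h + h') =
  (A - B - t * h) + (A' - B' - t * h') by ring.
by rewrite (le_trans (ler_normD _ _))//; lra.
Qed.

Lemma affine_errZ (a A B h t e : R) : 0 <= e ->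
  `|A - B - t * h| <= e / (`|a| + 1) * `|t| ->
  `|a * A - a * B - t * (a * h)| <= e * `|t|.
Proof.
move=> e0 b1; have a1 : 0 < `|a| + 1 by rewrite ltr_wpDl.
have -> : a * A - a * B - t * (a * h) = a * (A - B - t * h) by ring.
rewrite normrM (le_trans (ler_wpM2l (normr_ge0 _) b1))//.
have -> : `|a| * (e / (`|a| + 1) * `|t|) = e * `|t| * (`|a| / (`|a| + 1)) by ring.
by rewrite ler_piMr ?mulr_ge0// ler_pdivrMr// mul1r lerDl.
Qed.

Section C2.
Variables (V : set (Cn R d)) (r : Cn R d -> R).
Hypotheses (oV : open V) (rC : Ck 2 V r).

Lemma C2_C1d w : C1 V (dv w r).
Proof. by rewrite -dvE; apply: Ck1_C1; exact: (rC w).2. Qed.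

Lemma C2_C1 : C1 V r.
Proof.
split => v z Vz; first by have [h _] := rC v; exact: h.
exact: C1_ncont oV (C2_C1d v) Vz.
Qed.

Lemma C2_Ck1 : Ck 1 V r.
Proof.
move=> v; split => z Vz; first by have [h _] := rC v; exact: h.
by rewrite dvE; apply/ncontP; exact: C2_C1.2.
Qed.

Definition hess z v w := dv v (dv w r) z.

Lemma hess_rlinl z w : V z -> rlin (fun v => hess z v w).
Proof. exact: C1_rlin (C2_C1d w). Qed.

(** The derivative [dv w r] is linear in [w] at every point near [z], and this identity is
    differentiated along [v]. *)
Lemma hess_rlinr z v : V z -> rlin (hess z v).
Proof.
move=> Vz; have [s1 s10 h1] := openP oV Vz.
have inV (t : R) : `|t| < s1 / (en v + 1) -> V (z + t%:C *: v).
  move=> tk; apply: h1; rewrite addrAC subrr add0r en_realZ.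
  move: tk; rewrite ltr_pdivlMr ?ltr_wpDl ?enorm_ge0//; apply: le_lt_trans.
  by rewrite ler_wpM2l// lerDl.
have k0 : 0 < s1 / (en v + 1) by rewrite divr_gt0// ltr_wpDl ?enorm_ge0.
have rl y : V y -> rlin (fun v => dv v r y) by exact: C1_rlin C2_C1.
have dw w := (C2_C1d w).1; split => [w w'|a w].
- apply: (rderive_unique (dw _) Vz) => e e0; have e20 : 0 < e / 2 by rewrite divr_gt0.
  have [k1 k10 g1] := rderive_littleo v (dw w) Vz e20.
  have [k2 k20 g2] := rderive_littleo v (dw w') Vz e20.
  exists (Num.min (s1 / (en v + 1)) (Num.min k1 k2)); first by rewrite !lt_min k0 k10.
  move=> t; rewrite !lt_min => /and3P[/inV Vt /g1 b1 /g2 b2].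
  rewrite (rl _ Vt).1 (rl _ Vz).1 -/(hess z v w) -/(hess z v w').
  exact: affine_errD b1 b2.
- apply: (rderive_unique (dw _) Vz) => e e0.
  have a1 : 0 < `|a| + 1 by rewrite ltr_wpDl.
  have e1 : 0 < e / (`|a| + 1) by rewrite divr_gt0.
  have [k1 k10 g1] := rderive_littleo v (dw w) Vz e1.
  exists (Num.min (s1 / (en v + 1)) k1); first by rewrite !lt_min k0 k10.
  move=> t; rewrite !lt_min => /andP[/inV Vt /g1 b1].
  rewrite (rl _ Vt).2 (rl _ Vz).2 -/(hess z v w); exact: affine_errZ (ltW e0) b1.
Qed.

Lemma hess_bound z : V z -> exists2 M : R, 0 <= M & forall v w, `|hess z v w| <= M * en v * en w.
Proof.
move=> Vz.
pose M := \sum_j (en (gr (dv (xdir j) r) z) + en (gr (dv (ydir j) r) z)).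
have M0 : 0 <= M by apply: sumr_ge0 => j _; rewrite addr_ge0 ?enorm_ge0.
have hb v w : `|hess z v w| <= en v * en (gr (dv w r) z).
  by rewrite /hess (dv_gr _ oV (C2_C1d w) Vz) (le_trans (normRe_le _))// cauchy_schwarz.
have le j : en (gr (dv (xdir j) r) z) + en (gr (dv (ydir j) r) z) <= M.
  by rewrite /M (bigD1 j)//= lerDl sumr_ge0// => i _; rewrite addr_ge0 ?enorm_ge0.
exists (2 * d%:R * M); first by rewrite !mulr_ge0.
move=> v w; apply: le_trans (rlin_bound w (hess_rlinr v Vz) (e := en v * M) _) _.
  move=> j; have lj := le j; split; apply: le_trans (hb _ _) _; rewrite ler_wpM2l ?enorm_ge0//.
    by have := enorm_ge0 (gr (dv (ydir j) r) z); lra.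
  by have := enorm_ge0 (gr (dv (xdir j) r) z); lra.
by rewrite le_eqVlt; apply/orP; left; apply/eqP; ring.
Qed.

Lemma hess_near p e : V p -> 0 < e -> exists2 s : R, 0 < s & forall x, en (x - p) < s ->
  V x /\ forall v w, `|hess x v w - hess p v w| <= e * en v * en w.
Proof.
move=> Vp e0; pose k := e / (2 * d%:R + 1).
have k0 : 0 < k by rewrite divr_gt0// ltr_wpDl ?mulr_ge0.
have C1n w : enear p (fun x => V x /\
    forall v, `|dv v (dv w r) x - dv v (dv w r) p| <= k * en v).
  exact: C1_near oV (C2_C1d w) Vp k0.
have [s1 s10 h1] := openP oV Vp.
have [s2 s20 h2] := enear_all (fun j => C1n (xdir j)).
have [s3 s30 h3] := enear_all (fun j => C1n (ydir j)).
exists (Num.min s1 (Num.min s2 s3)); first by rewrite !lt_min s10 s20.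
move=> x; rewrite !lt_min => /and3P[/h1 Vx /h2 xx /h3 xy]; split => // v w.
have L := rlinB (hess_rlinr v Vx) (hess_rlinr v Vp).
apply: le_trans (rlin_bound w L (e := k * en v) _) _.
  by move=> j; split; [have [_] := xx j|have [_] := xy j]; exact.
rewrite ler_wpM2r ?enorm_ge0// mulrA ler_wpM2r ?enorm_ge0// /k mulrCA ler_piMr ?(ltW e0)//.
by rewrite ler_pdivrMr ?ltr_wpDl ?mulr_ge0// mul1r lerDl.
Qed.

(** The function [F] below has a nonnegative derivative at the point given by the mean value
    theorem: a second mean value step bounds the growth of [dv v r] below by [m * t]. *)
Lemma taylor_lower p q v (s m : R) : (forall z, en (z - p) < s -> V z) ->
  en (q - p) < s -> en (q + v - p) < s ->
  (forall z, en (z - p) < s -> m <= hess z v v) ->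
  r q + dv v r q + m / 2 <= r (q + v).
Proof.
move=> sV qs qvs hm; have cv := enear_cvx qs qvs.
have d1 (t : R) : 0 <= t <= 1 -> is_derive t 1 (rline r v q) (dv v r (q + t%:C *: v)).
  by move=> t01; apply/rline_is_derive/C2_C1.1/sV/cv.
pose F (t : R) := rline r v q t - (t * dv v r q + m / 2 * t ^+ 2).
have dF (t : R) : 0 <= t <= 1 -> is_derive t 1 F
    (dv v r (q + t%:C *: v) - (dv v r q + m * t)).
  move=> t01; have d1t := d1 t t01; rewrite /F.
  by apply: is_derive_eq; rewrite /GRing.scale/=; field.
have dcont : {within `[0, 1], continuous F}.
  apply: continuous_in_subspaceT => u; rewrite inE /= in_itv /= => /dF [du _].
  exact/differentiable_continuous/derivable1_diffP.
have dF' (u : R) : u \in `]0, 1[ -> is_derive u 1 F (dv v r (q + u%:C *: v) - (dv v r q + m * u)).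
  by rewrite in_itv /= => /andP[u0 u1]; apply: dF; rewrite !ltW.
have [t] := @MVT_segment R F _ 0 1 ler01 dF' dcont.
rewrite in_itv /= => t01; rewrite subr0 mulr1 /F /rline realZ1 realZ0 addr0 => E.
have ts := cv t t01.
have cv' := enear_cvx qs ts.
have [u u01] := segment_MVT (C2_C1d v).1 (fun u u01 => sV _ (cv' u u01)).
have us := cv' u u01.
have [_ hZ] := hess_rlinl v (sV _ us); rewrite -/(hess _ _ _) hZ => E2.
have t0 : 0 <= t by case/andP: t01.
have := ler_wpM2l t0 (hm _ us); move: E2.
set dt := dv v r (q + _); set hs := hess _ v v => E2 hts.
by move: E; rewrite -/dt expr0n /= expr1n => E; lra.
Qed.

Lemma hess_expand z v w : V z -> hess z v w = \sum_j \sum_k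
  (complex.Re (co v j) * (complex.Re (co w k) * hess z (xdir j) (xdir k) +
     complex.Im (co w k) * hess z (xdir j) (ydir k)) +
   complex.Im (co v j) * (complex.Re (co w k) * hess z (ydir j) (xdir k) +
     complex.Im (co w k) * hess z (ydir j) (ydir k))).
Proof.
move=> Vz; rewrite (rlinE v (hess_rlinl w Vz)); apply: eq_bigr => j _.
rewrite (rlinE w (hess_rlinr (xdir j) Vz)) (rlinE w (hess_rlinr (ydir j) Vz)).
by rewrite !mulr_sumr -big_split.
Qed.

Lemma rderive_cst (k : R) v z : dv v (fun _ : Cn R d => k) z = 0.
Proof. by rewrite -dvE /rderive (_ : rline _ _ _ = cst k) ?derive1_cst. Qed.

Lemma rderive_half f v z : V z -> dd f V -> dv v (fun x => f x / 2) z = dv v f z / 2.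
Proof.
move=> Vz fd; have h0 : is_derive (0 : R) 1 (rline f v z) (dv v f z).
  by apply: DeriveDef; [exact: fd|rewrite -dvE /rderive derive1E].
have h1 : is_derive (0 : R) 1 (fun t => rline f v z t * 2^-1) (dv v f z * 2^-1).
  by apply: is_derive_eq; rewrite /GRing.scale/=; ring.
rewrite -[LHS]/(dv _ _ _) -{1}dvE /rderive derive1E (_ : rline _ _ _ = (fun t => rline f v z t * 2^-1))//.
exact: derive_val.
Qed.

Lemma dzbar_real k f : dzbar k (fun x => (f x)%:C) =
  (fun z => (dv (xdir k) f z / 2) +i* (dv (ydir k) f z / 2)).
Proof.
apply/funext => z; rewrite /dzbar /cderive dvE.
rewrite (_ : (fun x => complex.Re (f x)%:C) = f)//.
rewrite (_ : (fun x => complex.Im (f x)%:C) = (fun _ => 0))// !rderive_cst.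
by apply: eqc; rewrite !ReImE /= ?oppr0; field.
Qed.

(** Averaging the real Hessian over [X] and ['i *: X] cancels its holomorphic quadratic part and
    leaves the Hermitian one. *)
Lemma levi_hess p X : V p -> levi_form r p X = (hess p X X + hess p ('i *: X) ('i *: X)) / 4.
Proof.
move=> Vp; rewrite /levi_form !(hess_expand _ _ Vp) -big_split/= mulr_suml.
rewrite (big_morph (@complex.Re R) (@ReD R) (erefl _)); apply: eq_bigr => j _.
rewrite (big_morph (@complex.Re R) (@ReD R) (erefl _)) -big_split/= mulr_suml.
apply: eq_bigr => k _; rewrite dzbar_real /dz /cderive dvE /=.
rewrite !(rderive_half _ Vp (C2_C1d _).1) -!/(hess p _ _) !coZ.
rewrite -/(co X j) -/(co X k).
move: (hess p _ _) (hess p _ _) (hess p _ _) (hess p _ _) => a b c e.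
case: (co X j) (co X k) => x1 y1 [x2 y2].
have -> : 2^-1 = (2^-1)%:C :> R[i] by rewrite fmorphV rmorph_nat.
by rewrite (_ : Num.conj (x2 +i* y2) = x2 -i* y2)// /=; field.
Qed.

(** Twice the (1,0)-part of the differential of [r]: complex linear in [v], with real part
    [dv v r z]. *)
Definition ell z v : R[i] := hd v (gr r z).

Lemma Re_ell z v : V z -> complex.Re (ell z v) = dv v r z.
Proof. by move=> Vz; rewrite (dv_gr _ oV C2_C1 Vz). Qed.

Lemma complex_tangent_ell p X : ell p X = 0 -> complex_tangent r p X.
Proof.
rewrite /ell hdotE => h; rewrite /complex_tangent.
transitivity (2^-1 * \sum_j co X j * conjc (co (gr r p) j)); last by rewrite h mulr0.
rewrite mulr_sumr; apply: eq_bigr => j _; rewrite co_gr /dz /cderive dvE /= -/(co X j).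
rewrite !rderive_cst -[fun x => r x]/r.
move: (dv (xdir j) r p) (dv (ydir j) r p) (co X j) => a b [x y].
rewrite -mulrA; congr (_ * _); apply: eqc => /=; ring.
Qed.

End C2.
End SecondOrder.

(** * Compactness in C^d and quantitative Levi positivity *)

Section Compactness.
Context {R : realType} {d : nat}.
Implicit Types (f : Cn R d -> R) (x y z p q X : Cn R d) (A D V : set (Cn R d)).
Local Open Scope complex_scope.

(** The identification of R^2d with C^d, through which compactness of real cubes is transported. *)
Definition row_of_real (a : 'rV[R]_(d + d)) : Cn R d :=
  \row_j (a 0 (lshift d j) +i* a 0 (rshift d j)).

Lemma row_of_real_continuous : continuous row_of_real.
Proof.
move=> a P /nbhs_enear [s s0 hs].
have k0 : 0 < s / (2 * d%:R + 1) by rewrite divr_gt0// ltr_wpDl ?mulr_ge0.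
apply/nbhs_ballP; exists (s / (2 * d%:R + 1)) => // b [_ ab]; apply: hs.
apply: le_lt_trans (enorm_le_sum _) _.
apply: (@le_lt_trans _ _ (\sum_(j < d) 2 * (s / (2 * d%:R + 1)))).
  apply: ler_sum => j _; rewrite coB /co !mxE.
  apply: le_trans (cabs_leD _) _; rewrite !ReImE /=.
  have := ab 0 (lshift d j); have := ab 0 (rshift d j).
  by rewrite /ball /= distrC => h1; rewrite distrC => h2; lra.
rewrite sumr_const card_ord -[ltLHS]mulr_natr.
have -> : 2 * (s / (2 * d%:R + 1)) * d%:R = s * (2 * d%:R / (2 * d%:R + 1)) by ring.
by rewrite gtr_pMr// ltr_pdivrMr ?ltr_wpDl ?mulr_ge0// mul1r ltrDl.
Qed.

Lemma closed_bounded_compact A (M : R) : closed A -> (forall x, A x -> en x <= M) -> compact A.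
Proof.
move=> cA bA; pose K := [set v : 'rV[R]_(d + d) | forall k, `[- M, M]%classic (v ord0 k)].
have cK : compact (row_of_real @` K).
  apply: continuous_compact; last first.
    apply: (@rV_compact R (d + d) (fun _ => `[- M, M]%classic)) => _.
    exact: segment_compact.
  exact/continuous_subspaceT/row_of_real_continuous.
apply: subclosed_compact cA cK _ => x Ax.
pose a : 'rV[R]_(d + d) := row_mx (\row_j complex.Re (co x j)) (\row_j complex.Im (co x j)).
have cM j : cabs (co x j) <= M by rewrite (le_trans (co_le_enorm _ _))// bA.
exists a.
  move=> k; rewrite /= in_itv /= -ler_norml /a -(splitK k).
  case: (fintype.split k) => j /=; rewrite ?row_mxEl ?row_mxEr !mxE.
    exact: le_trans (normRe_le _) (cM j).
  exact: le_trans (normIm_le _) (cM j).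
apply: eq_co => j; rewrite [LHS]/co /row_of_real mxE /a row_mxEl row_mxEr !mxE.
by case: (co x j).
Qed.

Lemma Cn_EVT_min A f (M : R) : A !=set0 -> closed A -> (forall x, A x -> en x <= M) ->
  (forall x, ncont f x) -> exists2 c, A c & forall x, A x -> f c <= f x.
Proof.
move=> A0 cA bA fc.
have fcont : continuous f by move=> x; apply/ncontP.
have [c + h] := compact_EVT_min A0 (closed_bounded_compact cA bA) (continuous_subspaceT fcont).
by rewrite inE => Ac; exists c => // x Ax; apply: h; rewrite inE.
Qed.

Lemma en_lip x y : `|en x - en y| <= en (x - y).
Proof.
rewrite ler_norml; apply/andP; split.
  by have := enormD (y - x) x; rewrite subrK (enormB y x); lra.
by have := enormD (x - y) y; rewrite subrK; lra.
Qed.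

Lemma closed_enear A : (forall x, ~ A x -> enear x (fun y => ~ A y)) -> closed A.
Proof.
move=> h; rewrite -openC openE => x /h hx; exact/nbhs_enear.
Qed.

Lemma ncont_quad f (M : R) : 0 <= M ->
  (forall x y, `|f x - f y| <= M * en (x - y) * (en x + en y)) -> forall z, ncont f z.
Proof.
move=> M0 h z e e0; pose K := M * (2 * en z + 1) + 1.
have z0 := enorm_ge0 z.
have K0 : 0 < K by rewrite ltr_wpDl// mulr_ge0//; lra.
exists (Num.min 1 (e / K)); first by rewrite lt_min ltr01 divr_gt0.
move=> x; rewrite lt_min ltr_pdivlMr// => /andP[x1 xe].
apply: le_lt_trans (h x z) _; apply: le_lt_trans xe.
have xz : en x <= en z + 1 by have := enormD (x - z) z; rewrite subrK; lra.
rewrite mulrAC mulrC ler_wpM2l ?enorm_ge0// /K.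
have h2 : en x + en z <= 2 * en z + 1 by lra.
have := ler_wpM2l M0 h2; lra.
Qed.

Section LeviPositive.
Variables (V : set (Cn R d)) (r : Cn R d -> R) (p : Cn R d).
Hypotheses (oV : open V) (rC : Ck 2 V r) (Vp : V p).
Hypothesis levi_gt0 : forall X, X != 0 -> complex_tangent r p X -> 0 < levi_form r p X.

Lemma hess_quad : exists2 M : R, 0 <= M & forall x y,
  `|hess r p x x - hess r p y y| <= M * en (x - y) * (en x + en y).
Proof.
have [M M0 hM] := hess_bound oV rC Vp; exists M => // x y.
have [lD _] := hess_rlinl oV rC x Vp; have [rD _] := hess_rlinr oV rC y Vp.
have e1 : hess r p x x = hess r p (x - y) x + hess r p y x by rewrite -lD subrK.
have e2 : hess r p y x = hess r p y (x - y) + hess r p y y by rewrite -rD subrK.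
rewrite e1 e2 addrA addrK (le_trans (ler_normD _ _))//.
have := hM (x - y) x; have := hM y (x - y); lra.
Qed.

Lemma ell_quad x y : `|cabs (ell r p x) ^+ 2 - cabs (ell r p y) ^+ 2| <=
  en (gr r p) ^+ 2 * en (x - y) * (en x + en y).
Proof.
have cs v : cabs (ell r p v) <= en v * en (gr r p) by exact: cauchy_schwarz.
have e1 : ell r p x - ell r p y = ell r p (x - y) by rewrite /ell hdotBl.
have d1 : `|cabs (ell r p x) - cabs (ell r p y)| <= en (x - y) * en (gr r p).
  apply: le_trans (cs (x - y)); rewrite -e1 ler_norml; apply/andP; split.
    by rewrite cabsB; have := cabs_sub_ge (ell r p y) (ell r p x); lra.
  exact: cabs_sub_ge.
rewrite subr_sqr normrM.
have d2 : `|cabs (ell r p x) + cabs (ell r p y)| <= (en x + en y) * en (gr r p).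
  by rewrite ger0_norm ?addr_ge0 ?cabs_ge0// mulrDl lerD.
apply: le_trans (ler_pM (normr_ge0 _) (normr_ge0 _) d1 d2) _.
by rewrite le_eqVlt; apply/orP; left; apply/eqP; ring.
Qed.

Lemma ell_eq0 X : ell r p X = 0 -> complex_tangent r p X.
Proof. exact: complex_tangent_ell. Qed.

Lemma maxr_dist (a b a' b' : R) : `|Num.max a b - Num.max a' b'| <= `|a - a'| + `|b - b'|.
Proof.
have := ler_norm (a - a'); have := ler_norm (b - b').
have := ler_norm (a' - a); have := ler_norm (b' - b).
rewrite [`|a' - a|]distrC [`|b' - b|]distrC => h1 h2 h3 h4.
have := normr_ge0 (a - a'); have := normr_ge0 (b - b') => h5 h6.
rewrite ler_norml; apply/andP.
by have [?|?] := leP a b; have [?|?] := leP a' b'; split; lra.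
Qed.

(** The Levi form is positive only on the kernel of [ell]. On the unit sphere the maximum of the
    Levi form and of |ell|^2 is positive, so by compactness it has a positive minimum [m];
    homogeneity does the rest. *)
Lemma levi_positive : exists2 K : R, 0 <= K & exists2 m : R, 0 < m &
  forall X, m * en X ^+ 2 <= levi_form r p X + K * cabs (ell r p X) ^+ 2.
Proof.
have [M M0 hM] := hess_quad.
have leviE X : levi_form r p X = (hess r p X X + hess r p ('i *: X) ('i *: X)) / 4.
  exact: (levi_hess oV rC).
have ieni X : en ('i *: X) = en X.
  by rewrite enormZ cabsE /= expr0n add0r expr1n sqrtr1 mul1r.
have leviq x y : `|levi_form r p x - levi_form r p y| <= M * en (x - y) * (en x + en y).
  have := hM ('i *: x) ('i *: y); rewrite -scalerBr !ieni => h1.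
  have h2 := hM x y; have h3 := le_trans (normr_ge0 _) h2.
  rewrite !leviE; move: h1 h2 h3; move: (hess _ _ _ _) (hess _ _ _ _) (hess _ _ _ _) (hess _ _ _ _).
  move: (M * _ * _) => u a b c e; rewrite !ler_norml => /andP[k1 k2] /andP[k3 k4] k5.
  by apply/andP; split; lra.
pose G := en (gr r p) ^+ 2; have G0 : 0 <= G by rewrite sqr_ge0.
pose f X := Num.max (levi_form r p X) (cabs (ell r p X) ^+ 2).
have fq x y : `|f x - f y| <= (M + G) * en (x - y) * (en x + en y).
  apply: le_trans (maxr_dist _ _ _ _) _.
  by have := leviq x y; have := ell_quad x y; rewrite -/G; lra.
have fc := ncont_quad (addr_ge0 M0 G0) fq.
have leviZ (t : R) X : levi_form r p (t%:C *: X) = t ^+ 2 * levi_form r p X.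
  rewrite !leviE scalerA [_ * t%:C]mulrC -scalerA.
  rewrite !(hess_rlinl oV rC _ Vp).2 !(hess_rlinr oV rC _ Vp).2; ring.
have ellZ (t : R) X : cabs (ell r p (t%:C *: X)) ^+ 2 = t ^+ 2 * cabs (ell r p X) ^+ 2.
  by rewrite /ell hdotZl cabsM cabs_real exprMn real_normK ?num_real.
have levi0 : levi_form r p 0 = 0 by have := leviZ 0 0; rewrite scaler0 expr0n mul0r.
have scale K m : (forall X, en X = 1 -> m <= levi_form r p X + K * cabs (ell r p X) ^+ 2) ->
    forall X, m * en X ^+ 2 <= levi_form r p X + K * cabs (ell r p X) ^+ 2.
  move=> h X; have [->|X0] := eqVneq X 0.
    by rewrite enorm0 expr0n mulr0 levi0 /ell hdot0l cabs0 expr0n mulr0 addr0.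
  have Xp : 0 < en X by rewrite enorm_gt0.
  have := h ((en X)^-1%:C *: X); rewrite en_realZ normfV (gtr0_norm Xp) mulVf ?gt_eqF//.
  move=> /(_ erefl); rewrite leviZ ellZ mulrCA -mulrDr exprVn ler_pdivlMl ?exprn_gt0//.
  by rewrite mulrC.
(* Unit vectors are missing when [d = 0]; any constants then do. *)
have [[X1 X11]|nX] := pselect (exists X : Cn R d, en X = 1); last first.
  by exists 0 => //; exists 1 => // X; apply: scale => Y Y1; case: nX; exists Y.
pose S := [set X : Cn R d | en X = 1].
have cS : closed S.
  apply: closed_enear => x /eqP xS; exists `|en x - 1|; first by rewrite normr_gt0 subr_eq0.
  move=> y yx /= yS; move: yx; rewrite ltNge => /negP; apply.
  by rewrite -yS distrC en_lip.
have bS x : S x -> en x <= 1 by move=> ->.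
have [X0 SX0 minX] := Cn_EVT_min (ex_intro _ X1 X11) cS bS fc.
have f0 : 0 < f X0.
  rewrite /f lt_max; have [e0|e0] := eqVneq (ell r p X0) 0; last first.
    by rewrite exprn_gt0 ?cabs_gt0// orbT.
  by rewrite levi_gt0//; [rewrite -enorm_gt0 SX0|exact: ell_eq0].
have lb X : S X -> - (2 * M) <= levi_form r p X.
  move=> SX; have := leviq X (- X).
  have := leviq X 0; rewrite levi0 !subr0 enorm0 SX addr0 !mulr1 => h _.
  by have := ler_norm (- levi_form r p X); rewrite normrN; lra.
(* Where the Levi form is below [m] one has |ell|^2 >= [m], and the constant outweighs its lower
   bound [- (2 * M)]. *)
pose m := f X0; exists ((2 * M + m) / m); first by rewrite divr_ge0 ?(ltW f0)// addr_ge0 ?(ltW f0)// mulr_ge0.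
exists m => //; apply: scale => X SX; have := minX X SX; rewrite /f le_max => /orP[h|h].
  rewrite (le_trans h)// lerDl mulr_ge0 ?sqr_ge0// divr_ge0 ?(ltW f0)// addr_ge0 ?(ltW f0)//.
  by rewrite mulr_ge0.
have c0 : 0 <= (2 * M + m) / m by rewrite divr_ge0 ?(ltW f0)// addr_ge0 ?(ltW f0)// mulr_ge0.
have := ler_wpM2l c0 h; rewrite -/m -/(f X0) -/m divfK ?gt_eqF// => h2.
by have := lb X SX; lra.
Qed.

End LeviPositive.
End Compactness.

(** * Boundary points *)

Section Boundary.
Context {R : realType} {d : nat}.
Implicit Types (f r : Cn R d -> R) (x y z p q X v w : Cn R d) (D V : set (Cn R d)).
Local Open Scope complex_scope.

Lemma boundaryP D q : open D -> boundary D q <->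
  ~ D q /\ forall s : R, 0 < s -> exists2 x, D x & en (x - q) < s.
Proof.
move=> oD; split.
  move=> [cq iq]; split; first by move=> Dq; apply: iq; move: oD; rewrite openE; exact.
  move=> s s0; have : nbhs q [set x | en (x - q) < s] by apply/nbhs_enear; exists s.
  by move=> /cq [x [Dx xs]]; exists x.
move=> [nDq h]; split; last by move=> /interior_subset.
move=> B /nbhs_enear [s s0 hs]; have [x Dx xs] := h s s0.
by exists x; split => //; exact: hs.
Qed.

Lemma closed_boundary D : open D -> closed (boundary D).
Proof.
move=> oD; rewrite /boundary setDE; apply: closedI; first exact: closed_closure.
by rewrite closedC; exact: open_interior.
Qed.

Lemma bdistE D z : bdist D z = inf [set en (z - q) | q in boundary D].
Proof. by rewrite /bdist; congr inf; apply: eq_imagel => q _; exact: en_enorm. Qed.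

Lemma bdist_le D z q : boundary D q -> bdist D z <= en (z - q).
Proof.
move=> bq; rewrite bdistE; apply: ge_inf; last by exists q.
by exists 0 => _ [y _ <-]; exact: enorm_ge0.
Qed.

Lemma bdist_attained D p z : open D -> boundary D p ->
  exists2 q, boundary D q & en (z - q) = bdist D z.
Proof.
move=> oD bp; pose A := boundary D `&` [set q | en (z - q) <= en (z - p)].
have cA : closed A.
  apply: closedI; first exact: closed_boundary.
  apply: closed_enear => x /negP; rewrite -ltNge => xz.
  exists (en (z - x) - en (z - p)); first by rewrite subr_gt0.
  by move=> y yx /= yz; have := enorm_dist z x y; lra.
have bA q : A q -> en q <= en z + en (z - p).
  by move=> [_ /= h]; have := enormD (q - z) z; rewrite subrK (enormB q z); lra.
have fc x : ncont (fun q => en (z - q)) x.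
  move=> e e0; exists e => // y yx; apply: le_lt_trans (en_lip _ _) _.
  by rewrite opprB addrC addrA subrK enormB.
have [q [bq qz] qmin] := Cn_EVT_min (ex_intro _ p (conj bp (lexx _))) cA bA fc.
exists q => //; apply: le_anti; rewrite bdist_le// andbT bdistE.
apply: lb_le_inf; first by exists (en (z - p)), p.
move=> _ [y by_ <-]; have [yz|/ltW yz] := leP (en (z - y)) (en (z - p)).
  by apply: qmin; split.
exact: le_trans yz.
Qed.

Lemma closest_bdptP D p z : open D -> boundary D p ->
  boundary D (closest_bdpt D z) /\ en (z - closest_bdpt D z) = bdist D z.
Proof.
move=> oD bp; rewrite -en_enorm /closest_bdpt; have [q bq qz] := bdist_attained z oD bp.
by case: (@getPex _ [set q | boundary D q /\ enorm (z - q) = bdist D z]) => //; exists q; rewrite /= en_enorm.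
Qed.

Lemma bdist_lip D p z w : open D -> boundary D p -> bdist D z <= bdist D w + en (z - w).
Proof.
move=> oD bp; have [q bq <-] := bdist_attained w oD bp.
by have := bdist_le z bq; have := enorm_dist z q w; lra.
Qed.

Lemma bdist_gt0 D p z : open D -> boundary D p -> D z -> 0 < bdist D z.
Proof.
move=> oD bp Dz; have [q bq <-] := bdist_attained z oD bp.
rewrite enorm_gt0 subr_eq0; apply/eqP => zq; move: bq; rewrite -zq.
by move=> /(boundaryP _ oD)[].
Qed.

Lemma defining_bd0 D V r q : open D -> local_defining_function D V r -> C1 V r ->
  boundary D q -> V q -> r q = 0.
Proof.
move=> oD [oV Dr _] rC /(boundaryP _ oD)[nDq h] Vq; apply: le_anti; apply/andP; split.
  rewrite leNgt; apply/negP => rq.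
  have [s s0 hs] := C1_ncont oV rC Vq rq; have [s' s'0 hs'] := openP oV Vq.
  have [x Dx] := h (Num.min s s') ltac:(by rewrite lt_min s0).
  rewrite lt_min => /andP[/hs xs /hs' Vx].
  have := (Dr x Vx).1 Dx; move: xs; rewrite ltr_norml => /andP[+ _]; lra.
by rewrite leNgt; apply/negP => /(Dr q Vq).2.
Qed.

(** The normal is chosen among all those given by local defining functions, so their normalized
    gradients must be shown to agree. *)
Lemma outer_normalE D V r q : open D -> local_defining_function D V r -> Ck 1 V r ->
  boundary D q -> V q -> outer_unit_normal D q = ((en (gr r q))^-1)%:C *: gr r q.
Proof.
move=> oD ldf rC bq Vq.
pose S := [set nu | exists V' r', [/\ V' q, Ck 1 V' r', local_defining_function D V' r' &
  nu = ((enorm (grad r' q))^-1)%:C *: grad r' q]].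
have inS : S (((en (gr r q))^-1)%:C *: gr r q).
  by exists V, r; split => //; rewrite en_enorm grad_gr.
have : S (outer_unit_normal D q) by apply: (@getPex _ S); exists (((en (gr r q))^-1)%:C *: gr r q).
move=> [V' [r' [V'q r'C ldf']]]; rewrite en_enorm grad_gr => ->.
have C1r := Ck1_C1 rC; have C1r' := Ck1_C1 r'C.
have r0 := defining_bd0 oD ldf C1r bq Vq; have r'0 := defining_bd0 oD ldf' C1r' bq V'q.
case: ldf => oV Dr gr0; case: ldf' => oV' Dr' gr'0.
(* If [r] decreases along [v], the ray enters [D], where [r'] is negative. *)
have sgn v : dv v r q < 0 -> dv v r' q <= 0.
  move=> vr; rewrite leNgt; apply/negP => vr'.
  have e1 : 0 < - dv v r q / 2 by rewrite divr_gt0// oppr_gt0.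
  have e2 : 0 < dv v r' q / 2 by rewrite divr_gt0.
  have [k1 k10 h1] := rderive_littleo v C1r.1 Vq e1.
  have [k2 k20 h2] := rderive_littleo v C1r'.1 V'q e2.
  have [s s0 hs] := openP oV Vq; have [s' s'0 hs'] := openP oV' V'q.
  have N0 : 0 < en v + 1 by rewrite ltr_wpDl ?enorm_ge0.
  pose k := Num.min (Num.min k1 k2) (Num.min (s / (en v + 1)) (s' / (en v + 1))).
  have k0 : 0 < k by rewrite !lt_min k10 k20 !divr_gt0.
  pose t := k / 2; have t0 : 0 < t by rewrite divr_gt0.
  have : t < k by rewrite ltr_pdivrMr// ltr_pMr// (ltr_nat _ 1 2).
  rewrite {1}/k !lt_min !ltr_pdivlMr// => /andP[/andP[tk1 tk2] /andP[ts ts']].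
  have tv : en (q + t%:C *: v - q) <= t * (en v + 1).
    by rewrite addrAC subrr add0r en_realZ gtr0_norm// ler_wpM2l ?(ltW t0)// lerDl.
  have Vt := hs _ (le_lt_trans tv ts); have V't := hs' _ (le_lt_trans tv ts').
  have := h1 t; rewrite gtr0_norm// => /(_ tk1); rewrite r0 subr0 ler_norml => /andP[_ b1].
  have := h2 t; rewrite gtr0_norm// => /(_ tk2); rewrite r'0 subr0 ler_norml => /andP[b2 _].
  have rt : r (q + t%:C *: v) < 0.
    by have := mulr_gt0 e1 t0; lra.
  have := (Dr' _ V't).1 ((Dr _ Vt).2 rt); have := mulr_gt0 e2 t0; lra.
set n := gr r q; set n' := gr r' q.
have n0 : 0 < en n by rewrite enorm_gt0 /n -grad_gr gr0.
have n'0 : 0 < en n' by rewrite enorm_gt0 /n' -grad_gr gr'0.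
have unit_dir x : 0 < en x -> exists v, [/\ v = ((en x)^-1)%:C *: x, en v = 1 & x = (en x)%:C *: v].
  move=> x0; exists (((en x)^-1)%:C *: x); split => //.
    by rewrite en_realZ normfV (gtr0_norm x0) mulVf ?gt_eqF.
  by rewrite -realZ_assoc divff ?gt_eqF// realZ1.
have [u [uE uu nu]] := unit_dir n n0; have [u' [uE' uu' nu']] := unit_dir n' n'0.
rewrite -uE -uE'.
have Re_scale (a : R) (b : R[i]) : complex.Re (conjc a%:C * b) = a * complex.Re b.
  by rewrite conjc_real ReM /= mul0r subr0.
have Re_hdC x y : complex.Re (hd x y) = complex.Re (hd y x).
  by rewrite -(hdot_conj x y); case: (hd x y).
have hself x : complex.Re (hd x x) = en x ^+ 2 by rewrite hdot_self.
have dve v : dv v r q = en n * complex.Re (hd v u).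
  by rewrite (dv_gr _ oV C1r Vq) -/n nu hdotZr Re_scale -nu.
have dve' v : dv v r' q = en n' * complex.Re (hd v u').
  by rewrite (dv_gr _ oV' C1r' V'q) -/n' nu' hdotZr Re_scale -nu'.
apply/eqP; rewrite -subr_eq0 -enorm_eq0; apply: contraT => dne.
have dp : 0 < en (u' - u) ^+ 2 by rewrite exprn_gt0// lt_def dne enorm_ge0.
have c1 : complex.Re (hd u' u) < 1.
  move: dp; rewrite -hself hdotBl !hdotBr !ReImE !hself uu uu' (Re_hdC u u').
  rewrite !expr1n; lra.
(* Distinct unit gradients are separated by the direction [u' - u]: its real product with [u] is
   negative, and with [u'] positive. *)
have := sgn (u' - u); rewrite dve dve' !hdotBl !ReImE !hself uu uu' expr1n (Re_hdC u u').
set a := complex.Re (hd u' u) in c1 *.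
have l1 : en n * (a + - 1) < 0 by rewrite pmulr_rlt0//; lra.
by move=> /(_ l1); rewrite pmulr_rle0//; lra.
Qed.

End Boundary.

(** * Peak functions at strongly pseudoconvex boundary points *)

Section LocalGeometry.
Context {R : realType} {d : nat}.
Implicit Types (f r : Cn R d -> R) (x y z p q X v w : Cn R d) (D V : set (Cn R d)).
Local Open Scope complex_scope.

Definition cbil (B : Cn R d -> Cn R d -> R[i]) := [/\
  forall v v' w, B (v + v') w = B v w + B v' w,
  forall v w w', B v (w + w') = B v w + B v w',
  forall a v w, B (a *: v) w = a * B v w &
  forall a v w, B v (a *: w) = a * B v w].

(** Along the ray [r] grows at rate at least [nu], so it vanishes by time [- r x / nu]. The zero is
    a boundary point because [r] is negative just before it. *)
Lemma bdist_le_ray V r D p x u (s nu : R) : open D -> local_defining_function D V r ->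
  C1 V r -> (forall z, en (z - p) < s -> V z) -> 0 < nu -> en u = 1 ->
  (forall z, en (z - p) < s -> nu <= dv u r z) ->
  D x -> en (x - p) - r x / nu < s -> en (x - p) < s -> bdist D x <= - r x / nu.
Proof.
move=> oD [oV Dr gr0] rC sV nu0 u1 hu Dx xs xs0.
have rx : r x < 0 by apply: (Dr x (sV _ xs0)).1.
pose T := - r x / nu; have T0 : 0 < T by rewrite divr_gt0// oppr_gt0.
have inb t : 0 <= t <= T -> en (x + t%:C *: u - p) < s.
  move=> /andP[t0 tT]; rewrite addrAC; apply: le_lt_trans (enormD _ _) _.
  rewrite en_realZ u1 mulr1 ger0_norm//; apply: le_lt_trans xs.
  by rewrite lerD2l (le_trans tT)// /T mulNr.
have Vt t : 0 <= t <= T -> V (x + t%:C *: u) by move=> /inb /sV.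
pose F := rline r u x.
have dF (t : R) : 0 <= t <= T -> is_derive t 1 F (dv u r (x + t%:C *: u)).
  by move=> tT; apply/rline_is_derive/rC.1/Vt.
have cF (a b : R) : 0 <= a -> b <= T -> {within `[a, b], continuous F}.
  move=> a0 bT; apply: continuous_in_subspaceT => t; rewrite inE /= in_itv /= => /andP[ta tb].
  have [dt _] : is_derive t 1 F (dv u r (x + t%:C *: u)).
    by apply: dF; rewrite (le_trans a0)// (le_trans tb).
  exact/differentiable_continuous/derivable1_diffP.
have inc (a b : R) : 0 <= a -> a <= b -> b <= T -> nu * (b - a) <= F b - F a.
  move=> a0 ab bT.
  have dF' (t : R) : t \in `]a, b[ -> is_derive t 1 F (dv u r (x + t%:C *: u)).
    rewrite in_itv /= => /andP[ta tb]; apply: dF.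
    by rewrite (le_trans a0 (ltW ta)) (le_trans (ltW tb)).
  have [t] := @MVT_segment R F _ a b ab dF' (cF _ _ a0 bT).
  rewrite in_itv /= => /andP[ta tb] ->; rewrite ler_wpM2r ?subr_ge0// hu// inb//.
  by rewrite (le_trans a0 ta) (le_trans tb).
have F0 : F 0 = r x by rewrite /F /rline realZ0 addr0.
have FT : 0 <= F T.
  have := inc 0 T (lexx _) (ltW T0) (lexx _); rewrite F0 subr0 /T mulrC divfK ?gt_eqF//.
  lra.
have [|t0] := @IVT R F 0 T 0 (ltW T0) (cF _ _ (lexx _) (lexx _)).
  by rewrite F0 ge_min (ltW rx) le_max FT orbT.
rewrite in_itv /= => /andP[t00 t0T] Ft0.
have bq : boundary D (x + t0%:C *: u).
  apply/(boundaryP _ oD); split.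
    move=> Dq; have tT : 0 <= t0 <= T by rewrite t00.
    have := (Dr _ (Vt _ tT)).1 Dq.
    by rewrite -[r _]/(F t0) Ft0 ltxx.
  have t0p : 0 < t0.
    by rewrite lt_def t00 andbT; apply: contraTneq rx => t0E; move: Ft0; rewrite t0E F0 => ->; rewrite ltxx.
  move=> e e0; pose t := t0 - Num.min t0 (e / 2).
  have m0 : 0 < Num.min t0 (e / 2) by rewrite lt_min t0p divr_gt0.
  have me : Num.min t0 (e / 2) <= e / 2 by rewrite ge_min lexx orbT.
  have mt : Num.min t0 (e / 2) <= t0 by rewrite ge_min lexx.
  have t1 : 0 <= t by rewrite subr_ge0.
  have t2 : t <= t0 by rewrite /t gerBl ltW.
  exists (x + t%:C *: u).
    have tT : 0 <= t <= T by rewrite t1 (le_trans t2).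
    apply: (Dr _ (Vt _ tT)).2.
    have := inc t t0 t1 t2 t0T; rewrite Ft0 -[r _]/(F t).
    have -> : t0 - t = Num.min t0 (e / 2) by rewrite /t subKr.
    by rewrite sub0r -oppr_gt0; apply: lt_le_trans; exact: mulr_gt0.
  rewrite opprD addrACA subrr add0r -scaleNr -rmorphN -realZ_add en_realZ u1 mulr1.
  rewrite distrC ger0_norm ?subr_ge0//; have -> : t0 - t = Num.min t0 (e / 2) by rewrite /t subKr.
  by apply: le_lt_trans me _; rewrite ltr_pdivrMr// ltr_pMr ?(ltr_nat _ 1 2).
apply: le_trans (bdist_le x bq) _.
rewrite opprD addrA subrr add0r enormN en_realZ u1 mulr1 ger0_norm//.
Qed.

Section AtPoint.
Variables (V : set (Cn R d)) (r : Cn R d -> R) (p : Cn R d).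
Hypotheses (oV : open V) (rC : Ck 2 V r) (Vp : V p).

Let H := hess r p.

(* [B v v] is the holomorphic part of the real Hessian, so that
   H v v / 2 = Re (B v v) / 2 + levi_form v. *)
Definition hol_hess v w : R[i] := ((H v w - H ('i *: v) ('i *: w)) / 2) +i*
  (- (H v ('i *: w) + H ('i *: v) w) / 2).

Lemma i_i v : 'i *: ('i *: v) = - v.
Proof.
rewrite scalerA (_ : 'i * 'i = -1) ?scaleN1r//.
by apply: eqc; rewrite /=; ring.
Qed.

Lemma HDl v v' w : H (v + v') w = H v w + H v' w.
Proof. exact: (hess_rlinl oV rC w Vp).1. Qed.

Lemma HDr v w w' : H v (w + w') = H v w + H v w'.
Proof. exact: (hess_rlinr oV rC v Vp).1. Qed.

Lemma HZl (a : R) v w : H (a%:C *: v) w = a * H v w.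
Proof. exact: (hess_rlinl oV rC w Vp).2. Qed.

Lemma HZr (a : R) v w : H v (a%:C *: w) = a * H v w.
Proof. exact: (hess_rlinr oV rC v Vp).2. Qed.

Lemma HNl v w : H (- v) w = - H v w.
Proof. by rewrite -scaleN1r (_ : -1 = (-1)%:C) ?HZl ?mulN1r// rmorphN rmorph1. Qed.

Lemma HNr v w : H v (- w) = - H v w.
Proof. by rewrite -scaleN1r (_ : -1 = (-1)%:C) ?HZr ?mulN1r// rmorphN rmorph1. Qed.

Lemma scale_split (a : R[i]) v :
  a *: v = (complex.Re a)%:C *: v + (complex.Im a)%:C *: ('i *: v).
Proof.
rewrite scalerA -scalerDl; congr (_ *: _).
by case: a => x y; apply: eqc => /=; ring.
Qed.

Lemma hol_hess_cbil : cbil hol_hess.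
Proof.
have Dl v v' w : hol_hess (v + v') w = hol_hess v w + hol_hess v' w.
  by rewrite /hol_hess scalerDr !HDl; apply: eqc; rewrite ?ReD ?ImD /=; field.
have Dr v w w' : hol_hess v (w + w') = hol_hess v w + hol_hess v w'.
  by rewrite /hol_hess scalerDr !HDr; apply: eqc; rewrite ?ReD ?ImD /=; field.
have comm (a : R) v : 'i *: (a%:C *: v) = a%:C *: ('i *: v).
  by rewrite !scalerA mulrC.
have Rl (a : R) v w : hol_hess (a%:C *: v) w = a%:C * hol_hess v w.
  by rewrite /hol_hess comm !HZl; apply: eqc => /=; field.
have Rr (a : R) v w : hol_hess v (a%:C *: w) = a%:C * hol_hess v w.
  by rewrite /hol_hess comm !HZr; apply: eqc => /=; field.
have il v w : hol_hess ('i *: v) w = 'i * hol_hess v w.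
  by rewrite /hol_hess i_i !HNl; apply: eqc => /=; field.
have ir v w : hol_hess v ('i *: w) = 'i * hol_hess v w.
  by rewrite /hol_hess i_i !HNr; apply: eqc => /=; field.
have aE (a : R[i]) : a = (complex.Re a)%:C + (complex.Im a)%:C * 'i.
  by case: a => x y; apply: eqc => /=; ring.
split => // a v w.
  by rewrite scale_split Dl !Rl il mulrA -mulrDl -aE.
by rewrite scale_split Dr !Rr ir mulrA -mulrDl -aE.
Qed.

Lemma hess_hol_levi v : H v v = complex.Re (hol_hess v v) + 2 * levi_form r p v.
Proof. by rewrite (levi_hess oV rC v Vp) /hol_hess /= -/H; field. Qed.

End AtPoint.
End LocalGeometry.

(** * The modified Levi polynomial and its positivity *)

Section PeakEstimate.
Context {R : realType} {d : nat}.
Implicit Types (r : Cn R d -> R) (x y z p q X v w : Cn R d) (D V : set (Cn R d)).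
Local Open Scope complex_scope.

(* Minus the Levi polynomial at [q] when [n] is the gradient of a defining function and [B]
   comes from its Hessian. *)
Definition peak (n : Cn R d -> Cn R d) (B : Cn R d -> Cn R d -> R[i]) q x : R[i] :=
  - (hd (x - q) (n q) + B (x - q) (x - q)).

Lemma common_lower_bound (a b c e : R) : 0 < a -> 0 < b -> 0 < c -> 0 < e ->
  exists s, [/\ 0 < s, s <= a, s <= b, s <= c & s <= e].
Proof.
move=> a0 b0 c0 e0; exists (Num.min (Num.min a b) (Num.min c e)).
by rewrite !lt_min !ge_min !lexx ?orbT a0 b0 c0 e0.
Qed.

(** The real-variable core of [peak_estimate], with [a], [E2], [nE] standing for Re ell, Re ell^2
    and |ell|^2. The defect K |ell|^2 of Levi positivity equals 2 K (Re ell)^2 - K Re ell^2. The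
    last term joins the peak function, and Re ell, being nearly [rx], has a square that is absorbed
    in [rx] and [v2]. *)
Lemma peak_real (rx dq H0 B0 levi a E2 nE m K L s v2 ve : R) :
  0 < m -> 0 <= K -> 0 <= L -> 0 < s -> rx < 0 -> 0 <= ve -> v2 = ve ^+ 2 ->
  dq + (H0 - m / 4 * v2) / 2 <= rx -> H0 = B0 + 2 * levi ->
  m * v2 <= levi + K * nE -> nE = 2 * a ^+ 2 - E2 ->
  `|a| <= - rx + 2 * L * s * ve -> 8 * K * (- rx) <= 1 -> 16 * K * L ^+ 2 * s ^+ 2 <= m / 8 ->
  dq + (B0 / 2 + K * E2) <= rx / 2 - 3 / 4 * m * v2.
Proof.
move=> m0 K0 L0 s0 rx0 ve0 v2E h1 h2 h3 h4 h5 h6 h7.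
have a2 : a ^+ 2 <= 2 * rx ^+ 2 + 8 * (L ^+ 2 * s ^+ 2 * v2).
  have : a ^+ 2 <= (- rx + 2 * L * s * ve) ^+ 2.
    by rewrite -[a ^+ 2]real_normK ?num_real// ler_sqr ?nnegrE// (le_trans _ h5).
  have := sqr_ge0 (- rx - 2 * L * s * ve); rewrite v2E; nra.
have k1 : 2 * K * a ^+ 2 <= 2 * K * (2 * rx ^+ 2 + 8 * (L ^+ 2 * s ^+ 2 * v2)).
  by rewrite ler_wpM2l// mulr_ge0.
have k2 : 4 * K * rx ^+ 2 <= - rx / 2.
  have : 8 * K * (- rx) * (- rx) <= 1 * (- rx) by rewrite ler_pM2r//; lra.
  lra.
have v20 : 0 <= v2 by rewrite v2E sqr_ge0.
have k3 := ler_wpM2r v20 h7.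
subst nE H0.
have k4 : K * (2 * a ^+ 2 - E2) = 2 * K * a ^+ 2 - K * E2 by ring.
rewrite k4 in h3; lra.
Qed.

Lemma half_dist_bound (a b u : R) : `|a| <= u -> `|b| <= u -> `|(a - b) / 2| <= u.
Proof.
rewrite !ler_norml => /andP[h1 h2] /andP[h3 h4].
by apply/andP; split; lra.
Qed.

Lemma hol_hess_bound r p M v w : (forall v w, `|hess r p v w| <= M * en v * en w) ->
  cabs (hol_hess r p v w) <= 2 * (M * en v * en w).
Proof.
move=> hM; apply: le_trans (cabs_leD _) _; rewrite /hol_hess /=.
have ieni X : en ('i *: X) = en X.
  by rewrite enormZ cabsE /= expr0n add0r expr1n sqrtr1 mul1r.
have h1 := hM v w; have := hM ('i *: v) ('i *: w).
have := hM v ('i *: w); have := hM ('i *: v) w; rewrite !ieni => h2 h3 h4.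
rewrite [leRHS]mulr_natl mulr2n; apply: lerD; first exact: half_dist_bound.
rewrite -(opprK (hess r p ('i *: v) w)) mulNr normrN.
by apply: half_dist_bound; rewrite // normrN.
Qed.

Lemma peak_estimate D V r p : open D -> local_defining_function D V r -> Ck 2 V r -> V p ->
  (forall X, X != 0 -> complex_tangent r p X -> 0 < levi_form r p X) ->
  exists B s c C, [/\ cbil B, [/\ 0 < s, 0 < c & 0 <= C],
    forall v w, cabs (B v w) <= C * en v * en w,
    forall q, en (q - p) < s -> [/\ V q, c <= en (gr r q) & en (gr r q) <= C] /\
      forall q', en (q' - p) < s -> en (gr r q - gr r q') <= C * en (q - q') &
    forall q x, boundary D q -> en (q - p) < s -> D x -> en (x - q) < s ->
      c * (en (x - q) ^+ 2 + bdist D x) <= complex.Re (peak (gr r) B q x)].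
Proof.
move=> oD ldf rC Vp levi0; have [oV Dr gr0] := ldf.
have C1r := C2_C1 oV rC; have C1d := C2_C1d rC.
have [K K0 [m m0 hKm]] := levi_positive oV rC Vp levi0.
have m4 : 0 < m / 4 by rewrite divr_gt0.
have [s1 s10 hs1] := hess_near oV rC Vp m4.
have [M M0 hM] := hess_bound oV rC Vp.
have [L LE] : exists L, L = M + m / 4 by eexists.
have L0 : 0 < L by rewrite LE ltr_wpDl.
have hL x v w : en (x - p) < s1 -> `|hess r x v w| <= L * en v * en w.
  move=> /hs1 [_ /(_ v w) h1]; have h2 := hM v w.
  have := ler_normD (hess r x v w - hess r p v w) (hess r p v w); rewrite subrK LE; lra.
set N := gr r p; have nu0 : 0 < en N by rewrite enorm_gt0 /N -grad_gr gr0.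
move: nu0; move nuE : (en N) => nu nu0.
have [u [uN u1]] : exists u, nu%:C *: u = N /\ en u = 1.
  exists (nu^-1%:C *: N); rewrite -realZ_assoc divff ?gt_eqF// realZ1; split => //.
  by rewrite en_realZ normfV gtr0_norm// nuE mulVf ?gt_eqF.
have s1V z : en (z - p) < s1 -> V z by move=> /hs1 [].
have dlip w x y : en (x - p) < s1 -> en (y - p) < s1 ->
    `|dv w r y - dv w r x| <= L * en (y - x) * en w.
  move=> xs ys; have [t t01 [ts ->]] := ball_MVT (C1d w).1 s1V xs ys.
  exact: hL.
have [s2 [s20 s21 s2L]] : exists s2 : R, [/\ 0 < s2, s2 <= s1 & L * s2 <= nu / 2].
  exists (Num.min s1 (nu / (2 * L))); split.
  - by rewrite lt_min s10 divr_gt0// mulr_gt0.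
  - by rewrite ge_min lexx.
  - have : Num.min s1 (nu / (2 * L)) <= nu / (2 * L) by rewrite ge_min lexx orbT.
    move=> /(ler_wpM2l (ltW L0)) h; rewrite (le_trans h)// le_eqVlt; apply/orP; left.
    by apply/eqP; field; rewrite gt_eqF.
have s2s1 z : en (z - p) < s2 -> en (z - p) < s1 by move=> /lt_le_trans; apply.
have pp : en (p - p) < s1 by rewrite subrr enorm0.
have dp w : `|dv w r p| <= nu * en w.
  rewrite (dv_gr _ oV C1r Vp) (le_trans (normRe_le _))// mulrC -nuE; exact: cauchy_schwarz.
have dnear w x : en (x - p) < s2 -> `|dv w r x - dv w r p| <= nu / 2 * en w.
  move=> xs; apply: le_trans (dlip w p x pp (s2s1 _ xs)) _.
  by rewrite ler_wpM2r ?enorm_ge0// (le_trans _ s2L)// ler_wpM2l ?(ltW L0)// ltW.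
have dbd w x : en (x - p) < s2 -> `|dv w r x| <= 2 * nu * en w.
  move=> xs; have := ler_normD (dv w r x - dv w r p) (dv w r p); rewrite subrK.
  have := dnear w x xs; have := dp w; have := mulr_ge0 (ltW nu0) (enorm_ge0 w); lra.
have dup : dv u r p = nu.
  rewrite (dv_gr _ oV C1r Vp) -/N -uN hdotZr conjc_real hdot_self u1 expr1n.
  by rewrite ReM /= mulr1 mul0r subr0.
have hu z : en (z - p) < s2 -> nu / 2 <= dv u r z.
  move=> /(dnear u); rewrite dup u1 mulr1 ler_norml => /andP[+ _]; lra.
(* [8 * s <= s2] leaves room for the ray of [bdist_le_ray], whose length is at most [4 * en v]. The
   conditions with [K] are the smallness assumptions of [peak_real], given that
   [- r x <= 2 * nu * en v]. *)
have [s [s0 s8 sK [s11 sL]]] : exists s : R, [/\ 0 < s, 8 * s <= s2, 16 * K * nu * s <= 1 &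
    s <= 1 /\ 16 * K * L ^+ 2 * s ^+ 2 <= m / 8].
  have p1 : 0 < 16 * K * nu + 1 by rewrite ltr_wpDl// !mulr_ge0// ltW.
  have L2 : 0 <= L ^+ 2 by rewrite sqr_ge0.
  have p2 : 0 < 128 * K * L ^+ 2 + 1 by rewrite ltr_wpDl// (mulr_ge0 _ L2)// mulr_ge0.
  pose e1 := 1 / (16 * K * nu + 1); pose e2 := m / (128 * K * L ^+ 2 + 1).
  have [s [s0 h1 h2 h3 h4]] : exists s, [/\ 0 < s, s <= s2 / 8, s <= 1, s <= e1 & s <= e2].
    by apply: common_lower_bound; rewrite ?divr_gt0.
  exists s; split => //; first lra.
    by move: h3; rewrite /e1 ler_pdivlMr//; lra.
  split => //; move: h4; rewrite /e2 ler_pdivlMr// => h4.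
  have KL : 0 <= 16 * K * L ^+ 2 by rewrite (mulr_ge0 _ L2)// mulr_ge0.
  have ss : s ^+ 2 <= s by rewrite expr2 ler_piMl// ltW.
  have := ler_wpM2l KL ss; lra.
have near2 q x : en (q - p) < s -> en (x - q) < s -> en (x - p) < 2 * s.
  by move=> h1 h2; have := enorm_dist x p q; lra.
have s2s z : en (z - p) < 2 * s -> en (z - p) < s2 by lra.
have ss2 z : en (z - p) < s -> en (z - p) < s2 by lra.
(* Half the holomorphic Hessian gives the Levi polynomial; the square of [ell] repairs the
   directions that are not complex tangent. Everything is frozen at [p], so that only the linear
   term of the peak function varies with [q]. *)
pose B v w := (2^-1)%:C * hol_hess r p v w + K%:C * ell r p v * ell r p w.
pose C2 := \sum_j (L * en (xdir j : Cn R d) + L * en (ydir j : Cn R d)).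
have C20 : 0 <= C2.
  by apply: sumr_ge0 => j _; rewrite addr_ge0// mulr_ge0 ?enorm_ge0// ltW.
have grlip q q' : en (q - p) < s -> en (q' - p) < s -> en (gr r q - gr r q') <= C2 * en (q - q').
  move=> qs qs'; apply: le_trans (enorm_le_sum _) _; rewrite /C2 mulr_suml.
  apply: ler_sum => j _; rewrite coB !co_gr; apply: le_trans (cabs_leD _) _.
  rewrite !ReImE /= mulrDl.
  have := dlip (xdir j) q' q (s2s1 _ (ss2 _ qs')) (s2s1 _ (ss2 _ qs)).
  have := dlip (ydir j) q' q (s2s1 _ (ss2 _ qs')) (s2s1 _ (ss2 _ qs)); lra.
(* These serve, in order, the lower bound on the gradient, the distance term ([- r x / 2] is at
   least [nu / 4 * bdist D x]) and the quadratic term of [peak_real]. *)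
have [c [c0 c1 c2 c3 _]] : exists c, [/\ 0 < c, c <= nu / 2, c <= nu / 4, c <= 3 / 4 * m & c <= 1].
  by apply: common_lower_bound; rewrite ?divr_gt0// mulr_gt0.
have [C CE] : exists C, C = M + K * nu ^+ 2 + C2 + nu by eexists.
have Knu : 0 <= K * nu ^+ 2 by rewrite mulr_ge0// sqr_ge0.
have Cge : [/\ 0 <= C, M + K * nu ^+ 2 <= C, C2 <= C & C2 + nu <= C].
  by rewrite CE; split; lra.
have [C0 C1 C2le C3] := Cge.
exists B, s, c, C; split => //.
- have [hD1 hD2 hZ1 hZ2] := hol_hess_cbil oV rC Vp.
  split => [v v' w|v w w'|a v w|a v w]; rewrite /B /ell.
  + by rewrite hD1 hdotDl; ring.
  + by rewrite hD2 hdotDl; ring.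
  + by rewrite hZ1 hdotZl; ring.
  + by rewrite hZ2 hdotZl; ring.
- move=> v w; rewrite /B; apply: le_trans (cabsD _ _) _.
  rewrite !cabsM !cabs_real ger0_norm ?invr_ge0// (ger0_norm K0).
  have e1 : cabs (hol_hess r p v w) <= 2 * (M * en v * en w).
    exact: hol_hess_bound.
  have cs X : cabs (ell r p X) <= en X * nu by rewrite -nuE; exact: cauchy_schwarz.
  have e2 := ler_pM (cabs_ge0 _) (cabs_ge0 _) (cs v) (cs w).
  have := ler_wpM2l K0 e2.
  have vw : 0 <= en v * en w by rewrite mulr_ge0 ?enorm_ge0.
  have := ler_wpM2r vw C1; lra.
- move=> q qs; split; last first.
    move=> q' qs'; apply: le_trans (grlip q q' qs qs') _.
    by rewrite ler_wpM2r ?enorm_ge0.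
  have Vq := s1V _ (s2s1 _ (ss2 _ qs)); split => //.
    rewrite (le_trans c1)// (le_trans (hu _ (ss2 _ qs)))// (dv_gr _ oV C1r Vq).
    rewrite (le_trans (Re_le_cabs _))// (le_trans (cauchy_schwarz _ _))//.
    by rewrite u1 mul1r.
  have ps : en (p - p) < s by rewrite subrr enorm0.
  have := grlip q p qs ps; have := enormD (gr r q - N) N; rewrite subrK -/N nuE => h1 h2.
  have : C2 * en (q - p) <= C2 * 1 by rewrite ler_wpM2l//; lra.
  lra.
move=> q x bq qs Dx xq; set v := x - q.
have xs := near2 _ _ qs xq.
have Vx := s1V _ (s2s1 _ (s2s _ xs)); have Vq := s1V _ (s2s1 _ (ss2 _ qs)).
have r0 := defining_bd0 oD ldf C1r bq Vq.
have rx := (Dr x Vx).1 Dx.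
have xE : q + v = x by rewrite /v subrKC.
have v0 : 0 <= en v by exact: enorm_ge0.
have vs : en v < s by [].
have [t t01 [ts rE]] := ball_MVT C1r.1 (fun z zs => s1V z (s2s1 z zs)) (ss2 _ qs) (s2s _ xs).
rewrite -/v r0 subr0 in ts rE.
have rbd : - r x <= 2 * nu * en v.
  by have := dbd v _ ts; rewrite -rE ltr0_norm.
have bd : nu / 4 * bdist D x <= - r x / 2.
  have nu2 : 0 < nu / 2 by rewrite divr_gt0.
  have := @bdist_le_ray R d V r D p x u s2 (nu / 2) oD ldf C1r (fun z zs => s1V z (s2s1 z zs)) nu2 u1 hu Dx.
  have rq : - r x / (nu / 2) <= 4 * en v by rewrite ler_pdivrMr//; lra.
  have hyp : en (x - p) - r x / (nu / 2) < s2 by rewrite -mulNr; lra.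
  move=> /(_ hyp (s2s _ xs)); rewrite ler_pdivlMr//; lra.
have tay : dv v r q + (hess r p v v - m / 4 * en v ^+ 2) / 2 <= r x.
  have := @taylor_lower R d V r oV rC p q v s1 (hess r p v v - m / 4 * en v ^+ 2) s1V.
  rewrite xE r0 add0r; apply.
  - exact/s2s1/ss2.
  - exact/s2s1/s2s.
  - move=> z /hs1 [_ /(_ v v)]; rewrite -mulrA -expr2 ler_norml => /andP[+ _]; lra.
(* By the mean value theorem [r x] is the derivative along [v] at a point between [q] and [x].
   Passing from there to [q] and on to [p] costs at most [L * s * en v] each time. *)
have aE : `|complex.Re (ell r p v)| <= - r x + 2 * L * s * en v.
  have Re1 : complex.Re (ell r p v) = dv v r p by rewrite (Re_ell oV rC).
  have h1 := dlip v q p (s2s1 _ (ss2 _ qs)) pp.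
  have h2 := dlip v q _ (s2s1 _ (ss2 _ qs)) (s2s1 _ ts).
  rewrite -rE in h2; rewrite (enormB p q) in h1.
  have tv : en (q + t%:C *: v - q) <= en v.
    rewrite addrAC subrr add0r en_realZ; case/andP: t01 => t0 t1.
    by rewrite ger0_norm// ler_piMl.
  have k1 : L * en (q - p) * en v <= L * s * en v.
    by rewrite ler_wpM2r// ler_wpM2l ?(ltW L0)// ltW.
  have k2 : L * en (q + t%:C *: v - q) * en v <= L * s * en v.
    rewrite ler_wpM2r// ler_wpM2l ?(ltW L0)//; apply: le_trans tv (ltW vs).
  rewrite Re1.
  have -> : dv v r p = (dv v r p - dv v r q) + (r x - (r x - dv v r q)) by ring.
  have := ler_normD (dv v r p - dv v r q) (r x - (r x - dv v r q)).
  have := ler_normB (r x) (r x - dv v r q); rewrite (ltr0_norm rx); lra.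
have lp := hKm v.
have sq : cabs (ell r p v) ^+ 2 = 2 * complex.Re (ell r p v) ^+ 2 -
    complex.Re (ell r p v * ell r p v).
  by rewrite sqr_cabs ReM; ring.
have k8 : 8 * K * (- r x) <= 1.
  have : 8 * K * (- r x) <= 8 * K * (2 * nu * s).
    rewrite ler_wpM2l ?mulr_ge0// (le_trans rbd)// ler_wpM2l ?(ltW vs)//.
    by rewrite mulr_ge0// ltW.
  lra.
have main := peak_real m0 K0 (ltW L0) s0 rx v0 erefl tay (hess_hol_levi oV rC Vp v) lp sq aE k8 sL.
have -> : complex.Re (peak (gr r) B q x) = - (dv v r q +
    (complex.Re (hol_hess r p v v) / 2 + K * complex.Re (ell r p v * ell r p v))).
  rewrite /peak -/v ReN ReD (dv_gr _ oV C1r Vq) /B ReD !ReM /= mul0r subr0.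
  rewrite !ImM /= !mul0r; ring.
rewrite mulrDr.
have := ler_wpM2r (sqr_ge0 (en v)) c3.
have := ler_wpM2r (_ : 0 <= bdist D x) c2.
have b0 : 0 <= bdist D x by exact/ltW/(bdist_gt0 oD bq).
move=> /(_ b0); lra.
Qed.

Theorem local_geometry alpha D p : open D -> strongly_pseudoconvex_bdpt alpha D p ->
  exists n B s c C, [/\ cbil B, [/\ 0 < s, 0 < c & 0 <= C],
    forall v w, cabs (B v w) <= C * en v * en w,
    forall q, boundary D q -> en (q - p) < s -> [/\ c <= en (n q), en (n q) <= C &
        outer_unit_normal D q = ((en (n q))^-1)%:C *: n q] /\
      forall q', en (q' - p) < s -> en (n q - n q') <= C * en (q - q') &
    forall q x, boundary D q -> en (q - p) < s -> D x -> en (x - q) < s ->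
      c * (en (x - q) ^+ 2 + bdist D x) <= complex.Re (peak n B q x)].
Proof.
move=> oD [bp [V [r [Vp [rC _] ldf levi0]]]].
have [B [s [c [C [h1 h2 h3 h4 h5]]]]] := peak_estimate oD ldf rC Vp levi0.
exists (gr r), B, s, c, C; split => // q bq qs; have [[Vq k1 k2] k3] := h4 q qs.
split => //; split => //; apply: (outer_normalE oD ldf _ bq Vq).
by apply: C2_Ck1 => //; case: ldf.
Qed.

End PeakEstimate.

(** * The lower bound *)

Section RealInequalities.
Context {R : realType}.
Implicit Types x y a b c G A T L eps : R.

Lemma ln_le_half y x : 0 < y -> y ^+ 2 <= x -> ln y <= 2^-1 * ln x.
Proof.
move=> y0 yx; have x0 : 0 < x by rewrite (lt_le_trans _ yx)// exprn_gt0.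
have : ln (y ^+ 2) <= ln x by rewrite ler_ln ?posrE// exprn_gt0.
rewrite lnXn// mulr2n; lra.
Qed.

Lemma ln_le_half2 y x1 x2 : 0 < y -> 0 < x1 -> 0 < x2 -> y ^+ 2 <= x1 * x2 ->
  ln y <= 2^-1 * ln x1 + 2^-1 * ln x2.
Proof. by move=> y0 a0 b0 h; rewrite -mulrDr -lnM ?posrE//; exact: ln_le_half. Qed.

(** For [a], [b] the roots of the boundary distances of two points at distance [L]: a bounded ratio
    [A / (a * b)] gives [L <= T / eps * (a * b)], too little for the distances to differ much. *)
Lemma comparable_dist a b A T L eps : 0 < a -> 0 < b -> 0 < T -> 0 < eps ->
  A <= T * (a * b) -> eps * L <= A -> b ^+ 2 <= a ^+ 2 + L -> b <= (1 + T / eps) * a.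
Proof.
move=> a0 b0 T0 e0 AT LA ba; rewrite leNgt; apply/negP => h.
have k0 : 0 < T / eps by rewrite divr_gt0.
have ab : a < b by rewrite (le_lt_trans _ h)// ler_peMl ?(ltW a0)// lerDl ltW.
have LT : L <= T / eps * (a * b).
  rewrite mulrAC ler_pdivlMr// mulrC; exact: le_trans AT.
have h1 : (1 + T / eps) * a * b < b * b by rewrite ltr_pM2r.
have h2 : a * a < a * b by rewrite ltr_pM2l.
move: ba; rewrite !expr2; move: h1 h2 LT; move: (T / eps) => m; lra.
Qed.

Lemma sqr_ratio_le c (c3 c5 : R) G A x y : 0 < c -> 0 < c3 -> 0 < c5 -> 0 < G -> 0 < A ->
  c5 ^+ 2 * (8 * G ^+ 3) <= c * c3 ^+ 2 -> 0 < x -> 0 < y -> c3 * A / (2 * G) <= x ->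
  c5 ^+ 2 * A ^+ 2 / (x * y) <= c * (c3 * A) / (2 * G) / (2 * (G * y)).
Proof.
move=> c0 c30 c50 g0 A0 c5c x0 yy0 h.
have hx : c5 ^+ 2 * A ^+ 2 * (4 * G ^+ 2) <= c * c3 * A * x.
  rewrite -(ler_pM2r (mulr_gt0 (ltr0Sn R 1) g0)).
  have k0 : 0 <= c * c3 * A by rewrite !mulr_ge0 ?ltW.
  move: h; rewrite ler_pdivrMr ?mulr_gt0// => /(ler_wpM2l k0).
  have := ler_wpM2r (sqr_ge0 A) c5c; lra.
have -> : c * (c3 * A) / (2 * G) / (2 * (G * y)) = c * c3 * A * x / (4 * G ^+ 2) / (x * y).
  by field; rewrite !gt_eqF.
by rewrite ler_wpM2r ?invr_ge0 ?mulr_ge0 ?(ltW x0) ?(ltW yy0)// ler_pdivlMr// mulr_gt0// exprn_gt0.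
Qed.

Lemma sqr_ratio_le2 (c3 c5 : R) G A x y : 0 < c3 -> 0 < c5 -> 0 < G -> c5 <= c3 / (2 * G) ->
  0 < x -> 0 < y ->
  c5 ^+ 2 * A ^+ 2 / (x * y) <= c3 * A / (2 * (G * x)) * (c3 * A / (2 * (G * y))).
Proof.
move=> c30 c50 g0 c53 x0 y0.
have c52 : c5 ^+ 2 <= (c3 / (2 * G)) ^+ 2 by rewrite ler_pXn2r// nnegrE ltW// divr_gt0// mulr_gt0.
have -> : c3 * A / (2 * (G * x)) * (c3 * A / (2 * (G * y))) =
  (c3 / (2 * G)) ^+ 2 * (A ^+ 2 / (x * y)) by field; rewrite !gt_eqF.
by rewrite -mulrA ler_wpM2r// divr_ge0 ?sqr_ge0// mulr_ge0// ltW.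
Qed.

Lemma trunc_lower c G Y de A X : 0 < G -> 0 < Y -> 0 < de -> 0 < A -> A <= Y * de ->
  c / 2 * A <= X ->
  Num.min (c / 2) (G / Y) / (8 * G) * (A / de) <= Num.min X (G * de) / (8 * (G * de)).
Proof.
move=> G0 Y0 d0 A0 AY XA.
have -> : Num.min (c / 2) (G / Y) / (8 * G) * (A / de) =
    Num.min (c / 2) (G / Y) * A / (8 * (G * de)) by field; rewrite !gt_eqF.
rewrite ler_wpM2r ?invr_ge0 ?mulr_ge0 ?(ltW G0) ?(ltW d0)// le_min; apply/andP; split.
  by apply: le_trans XA; rewrite ler_pM2r// ge_min lexx.
have : Num.min (c / 2) (G / Y) * A <= G / Y * A by rewrite ler_pM2r// ge_min lexx orbT.
move=> /le_trans; apply; rewrite mulrAC ler_pdivrMr// -mulrA ler_pM2l// mulrC.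
exact: AY.
Qed.

(** Here [L] is at most a multiple of [de], so the error is O(L de); since [L <= A / eps], smallness
    of [de] makes it a small part of [A]. *)
Lemma quadratic_error c C Y de A L eps : 0 < c -> 0 <= C -> 0 < Y -> 0 < eps -> 0 <= L ->
  0 <= A -> 0 < de -> eps * L <= A -> A <= Y * de ->
  de <= c * eps / (2 * (C + 1) * (2 + Y / eps)) ->
  C * L * (L + 2 * de) <= c / 2 * A.
Proof.
move=> c0 C0 Y0 e0 L0 A0 d0 LA AY dl.
have Ye : 0 < Y / eps by rewrite divr_gt0.
have LY : L <= Y / eps * de by rewrite mulrAC ler_pdivlMr// mulrC (le_trans LA).
have k1 : L + 2 * de <= (2 + Y / eps) * de by lra.
have k2 : 0 <= (C + 1) * L by rewrite mulr_ge0// addr_ge0.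
have k3 : C * L * (L + 2 * de) <= (C + 1) * L * ((2 + Y / eps) * de).
  by apply: ler_pM => //; rewrite ?mulr_ge0 ?addr_ge0 ?mulr_ge0 ?(ltW d0)// ler_wpM2r// lerDl.
apply: le_trans k3 _.
have C1 : 0 < C + 1 by lra.
have m0 : 0 < 2 + Y / eps by lra.
have mm : 0 < 2 * (C + 1) * (2 + Y / eps) by rewrite !mulr_gt0.
move: dl; rewrite (ler_pdivlMr _ _ mm).
move=> /(ler_wpM2r L0); have := ler_wpM2l (ltW c0) LA.
move: (2 + Y / eps) => m; lra.
Qed.

Lemma half_lower A c (x1 x2 X : R) : x1 - x2 <= X -> x2 <= c / 2 * A -> A * c <= x1 -> c / 2 * A <= X.
Proof. lra. Qed.

Lemma ln1D_le_log m c x : 0 < x -> m <= c / 2 -> 2 <= c * x -> -1 < m * x ->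
  ln (1 + m * x) <= ln (c * x).
Proof.
move=> x0 mc cx mx; have : m * x <= c / 2 * x by rewrite ler_wpM2r// ltW.
by move=> h; rewrite ler_ln ?posrE; lra.
Qed.

Lemma ln1D_le_quot m k c A a b : 0 < m -> m <= c / k -> 0 < k -> 0 < A -> 0 < a -> 0 < b ->
  a <= k * b -> ln (1 + m * (A / (a * b))) <= c * (A / a ^+ 2).
Proof.
move=> m0 mc k0 A0 a0 b0 ab; have x0 : 0 < A / (a * b) by rewrite divr_gt0 ?mulr_gt0.
apply: (@le_trans _ _ (m * (A / (a * b)))).
  by apply: le_ln1Dx; apply: lt_trans (mulr_gt0 m0 x0); lra.
apply: (@le_trans _ _ (c / k * (A / (a * b)))); first by rewrite ler_wpM2r// ltW.
have c0 : 0 < c by move: (lt_le_trans m0 mc); rewrite pmulr_lgt0 ?invr_gt0.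
rewrite -mulrA ler_pM2l//.
have -> : k^-1 * (A / (a * b)) = A / a ^+ 2 * (a / (k * b)) by field; rewrite !gt_eqF.
rewrite ler_piMr//; first by rewrite divr_ge0 ?sqr_ge0// ltW.
by rewrite ler_pdivrMr ?mul1r// mulr_gt0.
Qed.

End RealInequalities.

(** * Bumps and truncations at boundary points near p *)

Section PeakFunctions.
Context {R : realType} {d : nat}.
Implicit Types (x y z w p q X v : Cn R d) (D : set (Cn R d)).
Local Open Scope complex_scope.

Lemma cbil_expand B v w : cbil B ->
  B v w = \sum_j \sum_k co v j * co w k * B (xdir j) (xdir k).
Proof.
move=> [D1 D2 Z1 Z2].
have basis X : X = \sum_j co X j *: (xdir j : Cn R d).
  apply: eq_co => i; rewrite /co summxE (bigD1 i)//= big1 ?addr0 => [|j ji].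
    by rewrite !mxE !eqxx /= mulr1.
  by rewrite !mxE eqxx /= [i == j]eq_sym (negbTE ji) mulr0.
have B0l u : B 0 u = 0 by have := Z1 0 0 u; rewrite scaler0 mul0r.
have B0r u : B u 0 = 0 by have := Z2 0 u 0; rewrite scaler0 mul0r.
rewrite {1}[v]basis (big_morph (B^~ w) (fun a b => D1 a b w) (B0l w)); apply: eq_bigr => j _.
rewrite Z1 {1}[w]basis (big_morph (B (xdir j)) (D2 (xdir j)) (B0r _)) mulr_sumr.
by apply: eq_bigr => k _; rewrite Z2 mulrA.
Qed.

Lemma cdiff_vec_co (phi : R[i] -> Cn R d) a q j : cdiff_vec phi a ->
  cdiff (fun z : R[i] => co (phi z - q) j) a.
Proof.
move=> /(_ j) h; have : cdiff (fun z : R[i] => phi z 0 j - co q j) a.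
  by apply: cdiffB => //; exact: cdiff_cst.
by apply: cdiff_near; apply: cnearT => z; rewrite coB.
Qed.

Lemma hol_hd A q N : hol_on A (fun x => hd (x - q) N : R[i]).
Proof.
move=> phi a _ h; have : cdiff (fun z : R[i] => \sum_j co (phi z - q) j * conjc (co N j)) a.
  apply: cdiff_sum => j; apply: cdiffM; last exact: cdiff_cst.
  exact: cdiff_vec_co.
by apply: cdiff_near; apply: cnearT => z; rewrite hdotE.
Qed.

Lemma hol_cbil A q B : cbil B -> hol_on A (fun x => B (x - q) (x - q)).
Proof.
move=> hB phi a _ h.
have : cdiff (fun z : R[i] => \sum_j \sum_k
    co (phi z - q) j * co (phi z - q) k * B (xdir j) (xdir k)) a.
  apply: cdiff_sum => j; apply: cdiff_sum => k; apply: cdiffM; last exact: cdiff_cst.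
  by apply: cdiffM; exact: cdiff_vec_co.
by apply: cdiff_near; apply: cnearT => z; rewrite -cbil_expand.
Qed.

Lemma hol_peak A n B q : cbil B -> hol_on A (peak n B q).
Proof.
move=> hB phi a Aa h; apply: (cdiffN (F := fun z : R[i] => hd (phi z - q) (n q) + B (phi z - q) (phi z - q))).
apply: (cdiffD (F := fun z : R[i] => hd (phi z - q) (n q))); first exact: hol_hd Aa h.
exact: hol_cbil hB phi a Aa h.
Qed.

Context (D : set (Cn R d)) (p : Cn R d) (n : Cn R d -> Cn R d) (B : Cn R d -> Cn R d -> R[i]).
Context (s c C : R).
Hypotheses (oD : open D) (bp : boundary D p) (hB : cbil B).
Hypotheses (s0 : 0 < s) (c0 : 0 < c) (C0 : 0 <= C).
Hypothesis Bb : forall v w, cabs (B v w) <= C * en v * en w.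
Hypothesis hn : forall q, boundary D q -> en (q - p) < s -> c <= en (n q) /\ en (n q) <= C.
Hypothesis hl : forall q q', boundary D q -> en (q - p) < s -> en (q' - p) < s ->
  en (n q - n q') <= C * en (q - q').
Hypothesis hP : forall q x, boundary D q -> en (q - p) < s -> D x -> en (x - q) < s ->
  c * (en (x - q) ^+ 2 + bdist D x) <= complex.Re (peak n B q x).

Let t := c * s ^+ 2 / 12.
Let tp : 0 < t := t_gt0 s0 c0.

Lemma B_diff v w : cabs (B v v - B w w) <= C * en (v - w) * (en v + en w).
Proof.
have [D1 D2 _ _] := hB.
have e1 : B v v = B (v - w) v + B w v by rewrite -D1 subrK.
have e2 : B w v = B w (v - w) + B w w by rewrite -D2 subrK.
rewrite e1 e2 addrA addrK; apply: le_trans (cabsD _ _) _.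
by have := Bb (v - w) v; have := Bb w (v - w); lra.
Qed.

Section AtBoundaryPoint.
Variable q : Cn R d.
Hypotheses (bq : boundary D q) (qs : en (q - p) < s).

Notation g := (peak n B q).

Lemma peak_le x : cabs (g x) <= C * en (x - q) + C * en (x - q) ^+ 2.
Proof.
rewrite cabsN; apply: le_trans (cabsD _ _) _; apply: lerD.
  apply: le_trans (cauchy_schwarz _ _) _; rewrite mulrC ler_wpM2r ?enorm_ge0//.
  by case: (hn bq qs).
by apply: le_trans (Bb _ _) _; rewrite -mulrA -expr2.
Qed.

Lemma peak_le_lin x : en (x - q) <= 1 -> cabs (g x) <= (2 * C + 1) * en (x - q).
Proof.
move=> x1; apply: le_trans (peak_le x) _.
have e0 := enorm_ge0 (x - q).
have e2 : en (x - q) ^+ 2 <= en (x - q) by rewrite expr2 ler_piMr.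
have := ler_wpM2l C0 e2; lra.
Qed.

Lemma notDq : ~ D q.
Proof. by have [] := (boundaryP q oD).1 bq. Qed.

Lemma bdist_ge0 x : D x -> 0 <= bdist D x.
Proof. by move=> Dx; exact/ltW/(bdist_gt0 oD bq). Qed.

Lemma peak_pos x : pball D q s x -> c * en (x - q) ^+ 2 <= complex.Re (g x).
Proof.
move=> [Dx xs]; apply: le_trans (hP bq qs Dx xs).
by rewrite ler_pM2l// lerDl bdist_ge0.
Qed.

Lemma peak_ge_bdist x : pball D q s x -> c * bdist D x <= cabs (g x).
Proof.
move=> [Dx xs]; apply: le_trans (Re_le_cabs _); apply: le_trans (hP bq qs Dx xs).
by rewrite ler_pM2l// lerDr sqr_ge0.
Qed.

Let gh : hol_on (pball D q s) g := @hol_peak (pball D q s) n B q hB.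

Definition qbump eta : Cn R d -> R := bump q g s (4 / t) eta.

Lemma inf_lip_qbump eta : 0 < eta -> eta <= t / 4 -> inf_lip D (qbump eta).
Proof. by move=> e0 et; apply: (inf_lip_bump s0 c0 notDq gh peak_pos). Qed.

Lemma qbump_ge0 eta x : 0 <= qbump eta x.
Proof. exact: bump_ge0. Qed.

Lemma qbump_supp eta x : 0 < eta -> D x -> qbump eta x != 0 ->
  pball D q s x /\ cabs (g x) < eta.
Proof.
move=> e0 Dx h; have k0 : 0 <= 4 / t by rewrite divr_ge0// ltW.
by have [] := bump_supp k0 e0 Dx h.
Qed.

(** As [4 / t <= 1 / eta], the correction costs no more than the factor 2 under the logarithm. *)
Lemma qbump_lower eta x (de : R) : 0 < eta -> eta <= t / 4 -> pball D q s x ->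
  cabs (g x) <= de -> 2^-1 * ln (eta / (2 * de)) <= qbump eta x.
Proof.
move=> e0 et Px gd; rewrite /qbump /bump; case: asboolP; last by case: Px.
move=> _; have gx : 0 < cabs (g x).
  by rewrite (lt_le_trans (g_gt0 c0 notDq peak_pos Px))// Re_le_cabs.
have de0 : 0 < de by exact: lt_le_trans gd.
rewrite le_max; apply/orP; right.
have k0 : 0 <= 4 / t by rewrite divr_ge0// ltW.
have p1 : 0 < eta^-1 + 4 / t by rewrite ltr_pwDl ?invr_gt0.
have p2 : 0 < (cabs (g x))^-1 + 4 / t by rewrite ltr_pwDl ?invr_gt0.
rewrite -mulrBr ler_pM2l ?invr_gt0// -ln_div ?posrE// ler_ln ?posrE ?divr_gt0//; last first.
  by rewrite mulr_gt0.
rewrite ler_pdivrMr ?mulr_gt0// mulrAC ler_pdivlMr//.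
have h1 : de^-1 <= (cabs (g x))^-1 by rewrite lef_pV2.
have h2 : eta * (eta^-1 + 4 / t) <= 2.
  rewrite mulrDr divff ?gt_eqF//.
  have : eta * (4 / t) <= t / 4 * (4 / t) by rewrite ler_wpM2r.
  have -> : t / 4 * (4 / t) = 1 by field; rewrite gt_eqF.
  lra.
apply: le_trans h2 _.
have : 2 <= de^-1 * (2 * de) by rewrite mulrCA mulVf ?gt_eqF// mulr1.
move=> /le_trans; apply; rewrite ler_wpM2r ?mulr_ge0 ?(ltW de0)//.
by rewrite (le_trans h1)// lerDl.
Qed.

(** Below the truncation |g| <= [2 * tau], so the speed in [barrier_step] is at most
    [2 * (2 * tau) * 2]. *)
Lemma trunc_peak z tau : cabs (g z) <= tau -> 0 < tau -> tau <= t / 8 ->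
  inf_lip D (fun x => (if `[< en (x - q) < s >] then
    Num.min (cabs (g x - g z)) tau else tau) / (8 * tau)).
Proof.
move=> gz tau0 taut.
have small x : cabs (g x - g z) <= tau -> cabs (g x) <= 2 * tau.
  by move=> h; have := cabsD (g x - g z) (g z); rewrite subrK; lra.
apply: (inf_lip_trunc (F := fun x => g x - g z) s0 c0 peak_pos).
- by rewrite mulr_gt0.
- move=> phi a Pa h; apply: cdiffB; last exact: cdiff_cst.
  exact: gh Pa h.
- move=> x Px /small h; apply: le_trans (Re_le_cabs _) _.
  by rewrite -/t; lra.
move=> phi hp ps /small gx e e0.
have Rg := Re_le_cabs (g (phi 0)).
have gt4 : complex.Re (g (phi 0)) <= t / 4 by lra.
apply: cnearS (barrier_step s0 c0 notDq gh peak_pos hp e0 ps gt4) => h [h1 hs hg]; split => //.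
have -> : g (phi h) - g z - (g (phi 0) - g z) = g (phi h) - g (phi 0) by ring.
apply: le_trans hg _; rewrite -/t ler_wpM2r ?cabs_ge0// lerD2r.
have P0 : pball D q s (phi 0) by exact: phi0_pball hp ps.
have a0 := g_gt0 c0 notDq peak_pos P0.
move: (complex.Re _) a0 Rg gt4 => a a0 Rg gt4.
have k1 : 1 + 4 / t * a <= 2.
  have : 4 / t * a <= 4 / t * (t / 4) by rewrite ler_wpM2l// divr_ge0// ltW.
  have -> : 4 / t * (t / 4) = 1 by field; rewrite gt_eqF.
  lra.
have k2 : 2 * a <= 4 * tau by lra.
have := ler_pM (_ : 0 <= 2 * a) (_ : 0 <= 1 + 4 / t * a) k2 k1.
have q1 : 0 <= 2 * a by lra.
have q2 : 0 <= 1 + 4 / t * a by rewrite addr_ge0// mulr_ge0 ?(ltW a0)// divr_ge0// ltW.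
by move=> /(_ q1 q2); lra.
Qed.

(** For points not very close to the boundary, where the linear part of [g] need not dominate and
    [g] alone may fail to separate [z] from [w]. *)
Definition lin_peak (ka : R) z e0 x : R[i] := ka%:C * hd (x - z) e0 + (g x - g z).

(** Two points of the ball are at most [2 * s] apart, so this [ka] keeps the linear term within
    [t / 16], and |g| stays well below the level [t] wherever the truncation is not active. *)
Lemma trunc_lin_peak (ka : R) z e0 : `|ka| = t / (32 * s) -> en e0 = 1 ->
  en (z - q) < s -> cabs (g z) <= t / 16 ->
  let M := 2 * (C * s + C * s ^+ 2) + t in
  inf_lip D (fun x => (if `[< en (x - q) < s >] then
    Num.min (cabs (lin_peak ka z e0 x)) (t / 16) else t / 16) / (2 * M ^+ 2 / t)).
Proof.
move=> kaE e01 zs gz M.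
have Mt : t <= M.
  by rewrite /M lerDr mulr_ge0// addr_ge0// mulr_ge0 ?exprn_ge0// ltW.
have M0 : 0 < M by exact: lt_le_trans Mt.
have kab x y : en (x - q) < s -> en (y - q) < s -> cabs (ka%:C * hd (x - y) e0) <= t / 16.
  move=> xs ys; rewrite cabsM cabs_real kaE.
  have xy : en (x - y) <= 2 * s by have := enorm_dist x y q; rewrite (enormB q y); lra.
  have cs := cauchy_schwarz (x - y) e0; rewrite e01 mulr1 in cs.
  have : t / (32 * s) * cabs (hd (x - y) e0) <= t / (32 * s) * (2 * s).
    by rewrite ler_wpM2l ?(le_trans cs)// divr_ge0 ?(ltW tp)// mulr_ge0// ltW.
  have -> // : t / (32 * s) * (2 * s) = t / 16 by field; rewrite gt_eqF.
have diff x y : lin_peak ka z e0 y - lin_peak ka z e0 x = ka%:C * hd (y - x) e0 + (g y - g x).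
  by rewrite /lin_peak !hdotBl; ring.
have lh : hol_on (pball D q s) (lin_peak ka z e0).
  move=> phi a Pa h; apply: cdiffD.
    by apply: cdiffM; [exact: cdiff_cst|exact: (hol_hd z e0 Pa h)].
  by apply: cdiffB; [exact: gh Pa h|exact: cdiff_cst].
have small x : pball D q s x -> cabs (lin_peak ka z e0 x) <= t / 16 -> cabs (g x) <= 3 / 16 * t.
  move=> [Dx xs] h; have h1 := kab x z xs zs.
  have -> : g x = (lin_peak ka z e0 x - ka%:C * hd (x - z) e0) + g z by rewrite /lin_peak; ring.
  apply: le_trans (cabsD _ _) _; have := cabs_subD (lin_peak ka z e0 x) (ka%:C * hd (x - z) e0).
  lra.
apply: (inf_lip_trunc (F := lin_peak ka z e0) s0 c0 peak_pos) => //.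
- by rewrite divr_gt0// mulr_gt0// exprn_gt0.
- move=> x Px /(small _ Px) h; apply: le_trans (Re_le_cabs _) _.
  by rewrite -/t; move: tp; lra.
move=> phi hp ps h0 e e1.
have P0 : pball D q s (phi 0) by exact: phi0_pball hp ps.
have gx := small _ P0 h0; have Rg := Re_le_cabs (g (phi 0)).
have gbd y : pball D q s y -> cabs (g y) <= C * s + C * s ^+ 2.
  move=> [_ ys]; apply: le_trans (peak_le y) _; apply: lerD; apply: ler_wpM2l => //; first exact: ltW.
  by rewrite ler_sqr ?nnegrE ?enorm_ge0 ?(ltW s0)// ltW.
pose F y := (lin_peak ka z e0 y - lin_peak ka z e0 (phi 0)) / M%:C.
have FE y : cabs (F y) = cabs (lin_peak ka z e0 y - lin_peak ka z e0 (phi 0)) / M.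
  by rewrite /F cabsM cabsV cabs_real gtr0_norm.
(* On [Re g = t] the increment of [g] is at least [t - 3 / 16 * t], and the linear term removes at
   most [t / 16], so more than [t / 2] remains before division by [M]. The Lipschitz constant is
   then [M / k]. *)
pose k := t / (2 * M).
have k0 : 0 < k by rewrite divr_gt0// mulr_gt0.
have k1 : k <= 1 by rewrite ler_pdivrMr ?mulr_gt0// mul1r; move: M0; lra.
have g0t : complex.Re (g (phi 0)) < t by move: tp; lra.
have := @barrier_schwarz R d D q g s c s0 c0 notDq gh peak_pos phi hp F k k0 k1 ps g0t.
move=> bs; have {bs} : cnear 0 (fun h => [/\ cabs h < 1, en (phi h - q) < s &
    cabs (F (phi h)) <= cabs h / k]).
  apply: bs.
  - move=> ph a Pa h; apply: cdiffM; last exact: cdiff_cst.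
    by apply: cdiffB; [exact: lh Pa h|exact: cdiff_cst].
  - by rewrite /F subrr mul0r.
  - move=> y Py _; rewrite FE ler_pdivrMr// mul1r diff; apply: le_trans (cabsD _ _) _.
    have := kab y (phi 0) Py.2 ps; have := cabs_subD (g y) (g (phi 0)).
    by have := gbd _ Py; have := gbd _ P0; rewrite /M; move: tp; lra.
  - move=> y Py yt; rewrite FE /k ler_pdivlMr//.
    have -> : t / (2 * M) * M = t / 2 by field; rewrite gt_eqF.
    have h1 := kab y (phi 0) Py.2 ps.
    have h2 : complex.Re (g y - g (phi 0)) <= cabs (g y - g (phi 0)) by exact: Re_le_cabs.
    rewrite ReD (ReN (g (phi 0))) yt -/t in h2.
    have := cabs_subD (lin_peak ka z e0 y - lin_peak ka z e0 (phi 0)) (ka%:C * hd (y - phi 0) e0).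
    rewrite {1}diff [ka%:C * _ + _]addrC addrK; move: tp; lra.
apply: cnearS => h [h1 hs hF]; split => //.
move: hF; rewrite FE ler_pdivrMr// => hF; apply: le_trans hF _.
have -> : cabs h / k * M = 2 * M ^+ 2 / t * cabs h by rewrite /k; field; rewrite !gt_eqF.
by rewrite ler_wpM2r ?cabs_ge0// lerDl ltW.
Qed.

End AtBoundaryPoint.

(** * Lower bounds for a pair of points *)

Section BoundaryPair.
Notation G := (2 * C + 1).
Notation g := (peak n B).

Lemma G_gt0 : 0 < G. Proof. by move: C0; lra. Qed.
Lemma C_le_G : C <= 2 * G. Proof. by move: C0; lra. Qed.

Lemma ratio_expand A (z w q : Cn R d) : boundary D q -> en (q - p) < s ->
  A * en (n q) = cabs (hd (z - w) (n q)) -> 0 <= A -> A * c <= cabs (hd (z - w) (n q)).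
Proof. by move=> bq qs <- A0; rewrite ler_wpM2l//; case: (hn bq qs). Qed.

Lemma hd_le X q : boundary D q -> en (q - p) < s -> cabs (hd X (n q)) <= C * en X.
Proof.
move=> bq qs; apply: le_trans (cauchy_schwarz _ _) _; rewrite mulrC.
by rewrite ler_wpM2r ?enorm_ge0//; case: (hn bq qs).
Qed.

Lemma peak_small (q x : Cn R d) eta : boundary D q -> en (q - p) < s -> (0 < eta :> R) ->
  pball D q s x -> cabs (g q x) < eta ->
  c * en (x - q) ^+ 2 <= eta /\ cabs (hd (x - q) (n q)) <= eta + C * en (x - q) ^+ 2.
Proof.
move=> bq qs eta0 Px gx; split.
  by apply: le_trans (peak_pos bq qs Px) (le_trans (Re_le_cabs _) (ltW gx)).
have -> : hd (x - q) (n q) = - (g q x) - B (x - q) (x - q) by rewrite /peak; ring.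
apply: le_trans (cabs_subD _ _) _; rewrite cabsN; apply: lerD; first exact: ltW.
by apply: le_trans (Bb _ _) _; rewrite -mulrA expr2.
Qed.

(* If [x] were in both supports, it would be close to [q] and [q'], making [hd (z - w) (n q)]
   too small. *)
Lemma qbump_disjoint A eta z w q q' x : boundary D q -> en (q - p) < s ->
  boundary D q' -> en (q' - p) < s -> 0 < eta ->
  A * en (n q) = cabs (hd (z - w) (n q)) -> 0 <= A ->
  (3 + 4 * (C / c)) * eta <= A * c ->
  en (z - q) < eta / (2 * G) -> en (w - q') < eta / (2 * G) -> D x ->
  qbump q eta x = 0 \/ qbump q' eta x = 0.
Proof.
move=> bq qs bq' qs' eta0 AE A0 Aeta zq wq Dx.
have [->|h1] := eqVneq (qbump q eta x) 0; first by left.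
have [->|h2] := eqVneq (qbump q' eta x) 0; [by right|exfalso].
have [P1 g1] := qbump_supp eta0 Dx h1.
have [P2 g2] := qbump_supp eta0 Dx h2.
have [a1 b1] := peak_small bq qs eta0 P1 g1.
have [a2 b2] := peak_small bq' qs' eta0 P2 g2.
have Ac := ratio_expand bq qs AE A0.
have e1 : z - w = (z - q) - (w - q') + ((x - q') - (x - q)).
  by apply: eq_co => j; rewrite !(coD, coB, coN); ring.
have e2 : hd (x - q') (n q) = hd (x - q') (n q') + hd (x - q') (n q - n q').
  by rewrite hdotBr; ring.
have h3 : cabs (hd (z - w) (n q)) <= C * en (z - q) + C * en (w - q') +
    (cabs (hd (x - q') (n q)) + cabs (hd (x - q) (n q))).
  rewrite e1 hdotDl hdotBl [hd (_ - _ - _) _]hdotBl; apply: le_trans (cabsD _ _) _.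
  apply: lerD; last exact: cabs_subD.
  by apply: le_trans (cabs_subD _ _) _; apply: lerD; exact: hd_le.
have h4 : cabs (hd (x - q') (n q)) <= cabs (hd (x - q') (n q')) +
    C * (en (x - q') * (en (x - q) + en (x - q'))).
  rewrite e2; apply: le_trans (cabsD _ _) _; rewrite lerD2l.
  apply: le_trans (cauchy_schwarz _ _) _; rewrite mulrCA ler_wpM2l ?enorm_ge0//.
  apply: le_trans (hl bq qs qs') _; rewrite ler_wpM2l//.
  by have := enorm_dist q q' x; rewrite (enormB q x).
have d1 : C * en (z - q) <= eta / 4.
  have : C * en (z - q) <= C * (eta / (2 * G)) by rewrite ler_wpM2l// ltW.
  have : C * (eta / (2 * G)) <= eta / 4.
    rewrite mulrA ler_pdivrMr ?mulr_gt0 ?G_gt0//; move: (mulr_ge0 C0 (ltW eta0)) (eta0); lra.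
  lra.
have d2 : C * en (w - q') <= eta / 4.
  have : C * en (w - q') <= C * (eta / (2 * G)) by rewrite ler_wpM2l// ltW.
  have : C * (eta / (2 * G)) <= eta / 4.
    rewrite mulrA ler_pdivrMr ?mulr_gt0 ?G_gt0//; move: (mulr_ge0 C0 (ltW eta0)) (eta0); lra.
  lra.
have sq y q0 : c * en (y - q0) ^+ 2 <= eta -> C * en (y - q0) ^+ 2 <= C / c * eta.
  by move=> h; rewrite mulrAC -mulrA ler_wpM2l// ler_pdivlMr// mulrC.
have s1 := sq _ _ a1; have s2 := sq _ _ a2.
have am : C * (en (x - q') * (en (x - q) + en (x - q'))) <= 2 * (C / c * eta).
  have : en (x - q') * (en (x - q) + en (x - q')) <= en (x - q) ^+ 2 / 2 + 3 / 2 * en (x - q') ^+ 2.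
    have := sqr_ge0 (en (x - q) - en (x - q')); move: (en (x - q)) (en (x - q')) => a b.
    rewrite !expr2; lra.
  move=> /(ler_wpM2l C0); move: s1 s2; lra.
(* The contributions add up to [5 / 2 * eta + 4 * (C / c * eta)], strictly less than the assumed
   lower bound. *)
rewrite mulrDl -mulrA in Aeta; move: Aeta Ac h3 h4 d1 d2 b1 b2 s1 s2 am (eta0).
move: (C / c * eta) => u; lra.
Qed.

(** Since |g| >= [c * bdist D x] at [x], a bump cut off at [e] vanishes there; its value at [y] is
    the bound. *)
Lemma kobayashi_bump_one x y q e : boundary D q -> en (q - p) < s -> D x -> pball D q s y ->
  en (y - q) <= 1 -> 0 < e -> e <= t / 4 -> e <= c * bdist D x ->
  ((2^-1 * ln (e / (2 * (G * en (y - q)))))%:E <= kobayashi D x y)%E /\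
  ((2^-1 * ln (e / (2 * (G * en (y - q)))))%:E <= kobayashi D y x)%E.
Proof.
move=> bq qs Dx Py y1 e0 et ed.
have x0 : qbump q e x = 0.
  apply/eqP/negPn/negP => h; have [Px gx] := qbump_supp e0 Dx h.
  by have := lt_le_trans gx (le_trans ed (peak_ge_bdist bq qs Px)); rewrite ltxx.
have lo := qbump_lower bq qs e0 et Py (peak_le_lin bq qs y1).
have il := inf_lip_qbump bq qs e0 et.
have h : 2^-1 * ln (e / (2 * (G * en (y - q)))) <= `|qbump q e y - qbump q e x|.
  by rewrite x0 subr0; apply: le_trans lo (ler_norm _).
split; last by apply: le_trans (kobayashi_ge il Py.1 Dx); rewrite lee_fin.
by apply: le_trans (kobayashi_ge il Dx Py.1); rewrite lee_fin distrC.
Qed.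

Lemma kobayashi_bump_two z w q q' e : boundary D q -> en (q - p) < s ->
  boundary D q' -> en (q' - p) < s -> 0 < e -> e <= t / 4 ->
  pball D q s z -> en (z - q) <= 1 -> pball D q' s w -> en (w - q') <= 1 ->
  en (z - q) < e / (2 * G) -> en (w - q') < e / (2 * G) ->
  (forall x, D x -> qbump q e x = 0 \/ qbump q' e x = 0) ->
  ((2^-1 * ln (e / (2 * (G * en (z - q)))) + 2^-1 * ln (e / (2 * (G * en (w - q')))))%:E
     <= kobayashi D z w)%E.
Proof.
move=> bq qs bq' qs' e0 et Pz z1 Pw w1 zq wq dj.
have lz := qbump_lower bq qs e0 et Pz (peak_le_lin bq qs z1).
have lw := qbump_lower bq' qs' e0 et Pw (peak_le_lin bq' qs' w1).
(* Positivity of each bump at its own point forces the other bump to vanish there. *)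
have pos y q0 : D y -> boundary D q0 -> en (y - q0) < e / (2 * G) ->
    0 < 2^-1 * ln (e / (2 * (G * en (y - q0)))).
  move=> Dy bq0; have y0 : 0 < en (y - q0).
    exact: lt_le_trans (bdist_gt0 oD bp Dy) (bdist_le _ bq0).
  have g0 := G_gt0.
  move=> h; have {}h : en (y - q0) * (2 * G) < e by rewrite -ltr_pdivlMr ?mulr_gt0.
  apply: mulr_gt0; first by rewrite invr_gt0 ltr0Sn.
  apply: ln_gt0.
  by rewrite ltr_pdivlMr ?mul1r ?mulr_gt0//; lra.
have pz := pos _ _ Pz.1 bq zq; have pw := pos _ _ Pw.1 bq' wq.
have T2z : qbump q' e z = 0.
  by case: (dj z Pz.1) => // h; move: (lt_le_trans pz lz); rewrite h ltxx.
have T1w : qbump q e w = 0.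
  by case: (dj w Pw.1) => // h; move: (lt_le_trans pw lw); rewrite h ltxx.
have il := inf_lip_diff (inf_lip_qbump bq qs e0 et) (inf_lip_qbump bq' qs' e0 et)
  (qbump_ge0 q e) (qbump_ge0 q' e) dj.
apply: le_trans (kobayashi_ge il Pz.1 Pw.1).
rewrite lee_fin T2z T1w subr0 sub0r opprK; apply: le_trans (ler_norm _).
exact: lerD.
Qed.

(** [K] is the constant of the linear perturbation. [slope] bounds the ratio of the roots of the
    boundary distances, [scale] bounds A over the distance of [z], both once [c5 * A / (a * b) < 2];
    [near] is the distance below which [quadratic_error] applies. *)
Let K := t / (32 * s) / (2 * (2 * (C * s + C * s ^+ 2) + t) ^+ 2 / t).
Let slope (c5 eps : R) := 1 + 2 / c5 / eps.
Let scale c5 eps := 2 / c5 * slope c5 eps.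
Let near c5 eps := c * eps / (2 * (C + 1) * (2 + scale c5 eps / eps)).
Let lin_const c5 eps := Num.min (Num.min (c / 2) (G / scale c5 eps) / (8 * G)) (K * near c5 eps).

Definition kobayashi_const (c5 eps : R) : R :=
  Num.min (c5 / 2) (lin_const c5 eps / slope c5 eps).

Let K_gt0 : 0 < K.
Proof.
have M0 : 0 < 2 * (C * s + C * s ^+ 2) + t.
  by apply: ltr_wpDl => //; rewrite mulr_ge0// addr_ge0// mulr_ge0 ?exprn_ge0// ltW.
by rewrite /K; apply: divr_gt0; apply: divr_gt0 => //; apply: mulr_gt0 => //; exact: exprn_gt0.
Qed.

Let slope_gt0 c5 eps : 0 < c5 -> 0 < eps -> 0 < slope c5 eps.
Proof. by move=> c50 e0; rewrite /slope addr_gt0// !divr_gt0. Qed.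

Let scale_gt0 c5 eps : 0 < c5 -> 0 < eps -> 0 < scale c5 eps.
Proof. by move=> c50 e0; rewrite /scale mulr_gt0 ?slope_gt0// divr_gt0. Qed.

Lemma kobayashi_const_gt0 c5 eps : 0 < c5 -> 0 < eps -> 0 < kobayashi_const c5 eps.
Proof.
move=> c50 e0; have g0 := G_gt0; have Y0 := scale_gt0 c50 e0.
have C10 : 0 < C + 1 by apply: ltr_wpDl.
have dd0 : 0 < near c5 eps.
  apply: divr_gt0; first exact: mulr_gt0.
  by apply: mulr_gt0; [exact: mulr_gt0|apply: addr_gt0 => //; exact: divr_gt0].
have q0 : 0 < Num.min (c / 2) (G / scale c5 eps) / (8 * G).
  apply: divr_gt0; last exact: mulr_gt0.
  by rewrite lt_min; apply/andP; split; apply: divr_gt0.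
rewrite lt_min divr_gt0// divr_gt0 ?slope_gt0//.
by rewrite lt_min q0 mulr_gt0.
Qed.

Section Pair.
Variables (u c3 c5 A : R) (z w q q' : Cn R d).
Hypotheses (u0 : 0 < u) (u1 : u <= 1) (us : 3 * u <= s) (uG : G * u <= t / 16).
Hypotheses (c30 : 0 < c3) (c3t : c3 <= t / 8) (c3c : (3 + 4 * (C / c)) * c3 <= c).
Hypotheses (c50 : 0 < c5) (c53 : c5 <= c3 / (2 * G)) (c5c : c5 ^+ 2 * (8 * G ^+ 3) <= c * c3 ^+ 2).
Hypotheses (Dz : D z) (Dw : D w) (zu : en (z - p) < u) (wu : en (w - p) < u).
Hypotheses (bq : boundary D q) (bq' : boundary D q').
Hypotheses (qz : en (z - q) = bdist D z) (qw : en (w - q') = bdist D w).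
Hypotheses (A0 : 0 < A) (AE : A * en (n q) = cabs (hd (z - w) (n q))).

Lemma near_closest y q0 : en (y - q0) = bdist D y -> en (y - p) < u ->
  en (y - q0) < u /\ en (q0 - p) < 2 * u.
Proof.
move=> h yu; have h1 : en (y - q0) < u by rewrite h (le_lt_trans (bdist_le _ bp)).
by split => //; have := enorm_dist q0 p y; rewrite (enormB q0 y); move: yu h1; lra.
Qed.

Lemma qs_z : en (q - p) < s.
Proof. have [_] := near_closest qz zu; move: us u0; lra. Qed.

Lemma qs_w : en (q' - p) < s.
Proof. have [_] := near_closest qw wu; move: us u0; lra. Qed.

Lemma dist_zw : en (z - w) < 2 * u.
Proof. have := enorm_dist z w p; rewrite (enormB p w); move: zu wu; lra. Qed.

Lemma A_le : A <= en (z - w).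
Proof.
have [nc _] := hn bq qs_z; have n0 : 0 < en (n q) by exact: lt_le_trans nc.
by rewrite -(ler_pM2r n0) AE cauchy_schwarz.
Qed.

Lemma Pz : pball D q s z.
Proof. by split => //; have [h _] := near_closest qz zu; move: us u0 h; lra. Qed.

Lemma Pw : pball D q' s w.
Proof. by split => //; have [h _] := near_closest qw wu; move: us u0 h; lra. Qed.

Lemma bdist_z0 : 0 < bdist D z. Proof. exact: bdist_gt0 bq Dz. Qed.
Lemma bdist_w0 : 0 < bdist D w. Proof. exact: bdist_gt0 bq Dw. Qed.

(** Bumps cut off at [c3 * A] have disjoint supports if both distances are below [c3 * A / (2 * G)].
    If one is not, the bump at the other point alone gives half the logarithm of A over the other
    distance, which suffices as A is then dominated by the large distance. *)
Lemma kobayashi_ln a b : 0 < a -> 0 < b -> a ^+ 2 = bdist D z -> b ^+ 2 = bdist D w ->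
  ((ln (c5 * A / (a * b)))%:E <= kobayashi D z w)%E.
Proof.
move=> a0 b0 a2 b2.
have dz0 := bdist_z0; have dw0 := bdist_w0; have g0 := G_gt0.
have [zu1 _] := near_closest qz zu; have [wu1 _] := near_closest qw wu.
have A2 : A <= 2.
  by apply: le_trans A_le (le_trans (ltW dist_zw) _); rewrite ger_pMr.
have e0 : 0 < c3 * A by rewrite mulr_gt0.
have et : c3 * A <= t / 4.
  have -> : t / 4 = t / 8 * 2 by field.
  by apply: ler_pM => //; exact: ltW.
have cG : c <= 2 * G.
  have [nc nC] := hn bq qs_z; exact: le_trans nc (le_trans nC C_le_G).
have y0 : 0 < c5 * A / (a * b) := divr_gt0 (mulr_gt0 c50 A0) (mulr_gt0 a0 b0).
have y2 : (c5 * A / (a * b)) ^+ 2 = c5 ^+ 2 * A ^+ 2 / (bdist D z * bdist D w).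
  by rewrite expr_div_n (exprMn 2 c5) (exprMn 2 a) a2 b2.
have G2 : 0 < 2 * G := mulr_gt0 (ltr0Sn R 1) g0.
(* The threshold for the distances times [c]: the largest cut-off for which [kobayashi_bump_one] is
   sure to apply at a point beyond the threshold. *)
pose e2 := c * (c3 * A) / (2 * G).
have e20 : 0 < e2 := divr_gt0 (mulr_gt0 c0 e0) G2.
have e2t : e2 <= t / 4.
  apply: le_trans et; rewrite (ler_pdivrMr _ _ G2) mulrC (ler_pM2l e0).
  exact: cG.
have [hz|hz] := ltP (bdist D z) (c3 * A / (2 * G)); last first.
  have hh : e2 <= c * bdist D z by rewrite /e2 -mulrA (ler_pM2l c0).
  have [h _] := kobayashi_bump_one bq' qs_w Dz Pw (le_trans (ltW wu1) u1) e20 e2t hh.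
  apply: le_trans h; rewrite lee_fin; apply: ln_le_half => //; rewrite y2 qw.
  exact: sqr_ratio_le.
have [hw|hw] := ltP (bdist D w) (c3 * A / (2 * G)); last first.
  have hh : e2 <= c * bdist D w by rewrite /e2 -mulrA (ler_pM2l c0).
  have [_ h] := kobayashi_bump_one bq qs_z Dw Pz (le_trans (ltW zu1) u1) e20 e2t hh.
  apply: le_trans h; rewrite lee_fin; apply: ln_le_half => //; rewrite y2 qz.
  by rewrite [bdist D z * _]mulrC; exact: sqr_ratio_le.
have k1 : (3 + 4 * (C / c)) * (c3 * A) <= A * c.
  by rewrite mulrA [A * c]mulrC (ler_pM2r A0); exact: c3c.
have hz' : en (z - q) < c3 * A / (2 * G) by rewrite qz; exact: hz.
have hw' : en (w - q') < c3 * A / (2 * G) by rewrite qw; exact: hw.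
have dj x (Dx : D x) := qbump_disjoint bq qs_z bq' qs_w e0 AE (ltW A0) k1 hz' hw' Dx.
have h := kobayashi_bump_two bq qs_z bq' qs_w e0 et Pz (le_trans (ltW zu1) u1)
  Pw (le_trans (ltW wu1) u1) hz' hw' dj.
rewrite qz qw in h; apply: le_trans h; rewrite lee_fin.
have gz := mulr_gt0 (ltr0Sn R 1) (mulr_gt0 g0 dz0).
have gw := mulr_gt0 (ltr0Sn R 1) (mulr_gt0 g0 dw0).
apply: (ln_le_half2 y0 (divr_gt0 e0 gz) (divr_gt0 e0 gw)); rewrite y2.
move: (bdist D z) (bdist D w) dz0 dw0 => de de' dz0 dw0.
exact: sqr_ratio_le2.
Qed.

Lemma pball_qw : en (w - q) < s.
Proof.
have [_ h] := near_closest qz zu.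
have : en (w - q) < u + 2 * u.
  by apply: le_lt_trans (enorm_dist w q p) _; rewrite (enormB p q) ltrD.
by move=> h1; apply: (lt_le_trans h1); move: us; lra.
Qed.

(** The first-order part of [g q w - g q z] is [hd (z - w) (n q)], of modulus at least [A * c]; at
    most half of this bound is lost to [B]. *)
Lemma kobayashi_trunc_quad eps Y : 0 < eps -> 0 < Y -> eps * en (z - w) <= A ->
  A <= Y * bdist D z -> bdist D z <= c * eps / (2 * (C + 1) * (2 + Y / eps)) ->
  ((Num.min (c / 2) (G / Y) / (8 * G) * (A / bdist D z))%:E <= kobayashi D z w)%E.
Proof.
move=> eps0 Y0 LA AY dsm.
have dz0 := bdist_z0; have g0 := G_gt0; have qs := qs_z.
have [zu1 _] := near_closest qz zu; have zs := Pz.2; have ws := pball_qw.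
have gz : cabs (g q z) <= G * bdist D z.
  by rewrite -qz; apply: (peak_le_lin bq qs); exact: le_trans (ltW zu1) u1.
have tau0 : 0 < G * bdist D z := mulr_gt0 g0 dz0.
have taut : G * bdist D z <= t / 8.
  have h : G * bdist D z <= t / 16.
    by apply: le_trans uG; rewrite (ler_pM2l g0) -qz; exact: ltW.
  by apply: (le_trans h); move: tp; lra.
have il := trunc_peak bq qs gz tau0 taut.
apply: le_trans (kobayashi_ge il Dz Dw); rewrite lee_fin.
rewrite (asboolT zs) (asboolT ws) subrr cabs0 (min_l (ltW tau0)) mul0r sub0r normrN.
apply: le_trans (ler_norm _).
apply: trunc_lower => //.
have e1 : g q w - g q z = hd (z - w) (n q) - (B (w - q) (w - q) - B (z - q) (z - q)).
  have e0 : z - w = (z - q) - (w - q) by apply: eq_co => j; rewrite !(coD, coN); ring.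
  by rewrite e0 hdotBl /peak; ring.
have h1 := cabs_sub_ge (hd (z - w) (n q)) (B (w - q) (w - q) - B (z - q) (z - q)).
rewrite -e1 in h1.
have h2 := B_diff (w - q) (z - q).
have e2 : w - q - (z - q) = w - z by apply: eq_co => j; rewrite !(coD, coN); ring.
rewrite e2 (enormB w z) in h2.
have h3 : en (w - q) + en (z - q) <= en (z - w) + 2 * bdist D z.
  rewrite -qz mulr_natl mulr2n addrA lerD2r -(enormB w z); exact: enorm_dist.
have h4 : C * en (z - w) * (en (w - q) + en (z - q)) <= c / 2 * A.
  apply: le_trans (quadratic_error c0 C0 Y0 eps0 (enorm_ge0 _) (ltW A0) dz0 LA AY dsm).
  by rewrite ler_wpM2l// mulr_ge0// enorm_ge0.
have h5 := ratio_expand bq qs AE (ltW A0).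
exact: half_lower h1 (le_trans h2 h4) h5.
Qed.

(** The two functions differ by [2 * k * en (w - z)] at [w], so one of the signs works whatever [g]
    does. *)
Lemma lin_peak_lower (k : R) (e0 : Cn R d) : 0 <= k -> hd (w - z) e0 = (en (w - z))%:C ->
  k * en (w - z) <= cabs (lin_peak q k z e0 w) \/
  k * en (w - z) <= cabs (lin_peak q (- k) z e0 w).
Proof.
move=> k0 he; rewrite /lin_peak he; move: (g q w - g q z) (enorm_ge0 (w - z)) => b.
move: (en (w - z)) => L L0.
have h : 2 * (k * L) <= cabs (k%:C * L%:C + b) + cabs ((- k)%:C * L%:C + b).
  apply: le_trans (cabs_subD _ _).
  have -> : k%:C * L%:C + b - ((- k)%:C * L%:C + b) = (2 * (k * L))%:C.
    by apply: eqc; rewrite !ReImE /=; ring.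
  by rewrite cabs_real ler_norm.
have [h1|h1] := leP (k * L) (cabs (k%:C * L%:C + b)); first by left.
right; move: h h1; move: (cabs _) (cabs _) (k * L) => x y v; lra.
Qed.

Lemma kobayashi_trunc_lin :
  ((t / (32 * s) * A / (2 * (2 * (C * s + C * s ^+ 2) + t) ^+ 2 / t))%:E
     <= kobayashi D z w)%E.
Proof.
have [zu1 _] := near_closest qz zu; have zs := Pz.2; have ws := pball_qw; have qs := qs_z.
have g0 := G_gt0.
have gz : cabs (g q z) <= t / 16.
  apply: le_trans (peak_le_lin bq qs _) _; first exact: le_trans (ltW zu1) u1.
  by apply: le_trans uG; rewrite (ler_pM2l g0); exact: ltW.
have L0 : 0 < en (w - z) by rewrite enormB; exact: lt_le_trans A0 A_le.
have LA : A <= en (w - z) by rewrite enormB; exact: A_le.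
have Ls : en (w - z) <= 2 * s.
  rewrite enormB; apply: le_trans (ltW dist_zw) _; rewrite ler_pM2l//.
  by move: us u0; lra.
pose e0 : Cn R d := ((en (w - z))^-1)%:C *: (w - z).
have e01 : en e0 = 1 by rewrite enormZ cabs_real gtr0_norm ?invr_gt0// mulVf ?gt_eqF.
have he : hd (w - z) e0 = (en (w - z))%:C.
  rewrite hdotZr hdot_self; have -> : conjc ((en (w - z))^-1)%:C = ((en (w - z))^-1)%:C :> R[i].
    by apply: eqc; rewrite /= ?oppr0.
  by rewrite -rmorphM expr2 mulKf ?gt_eqF.
have k0 : 0 < t / (32 * s) by rewrite divr_gt0 ?mulr_gt0.
have kL : t / (32 * s) * en (w - z) <= t / 16.
  apply: (@le_trans _ _ (t / (32 * s) * (2 * s))); first by rewrite ler_wpM2l// ltW.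
  by have -> : t / (32 * s) * (2 * s) = t / 16 by field; rewrite gt_eqF.
have concl ka : `|ka| = t / (32 * s) ->
    t / (32 * s) * en (w - z) <= cabs (lin_peak q ka z e0 w) ->
    ((t / (32 * s) * A / (2 * (2 * (C * s + C * s ^+ 2) + t) ^+ 2 / t))%:E
       <= kobayashi D z w)%E.
  move=> kae hk; have il := trunc_lin_peak bq qs kae e01 zs gz.
  apply: le_trans (kobayashi_ge il Dz Dw); rewrite lee_fin.
  rewrite (asboolT zs) (asboolT ws).
  have -> : lin_peak q ka z e0 z = 0 by rewrite /lin_peak !subrr hdot0l mulr0 addr0.
  have t16 : 0 <= t / 16 by move: tp; lra.
  rewrite cabs0 (min_l t16) mul0r sub0r normrN; apply: le_trans (ler_norm _).
  rewrite ler_wpM2r//.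
    by rewrite invr_ge0 divr_ge0 ?(ltW tp)// mulr_ge0 ?sqr_ge0.
  rewrite le_min; apply/andP; split.
    by apply: le_trans hk; rewrite (ler_pM2l k0).
  by apply: le_trans kL; rewrite (ler_pM2l k0).
have [h|h] := lin_peak_lower (ltW k0) he; apply: concl h; first by rewrite gtr0_norm.
by rewrite normrN gtr0_norm.
Qed.

Lemma kobayashi_pair eps a b : 0 < eps -> eps * en (z - w) <= A ->
  0 < a -> 0 < b -> a ^+ 2 = bdist D z -> b ^+ 2 = bdist D w ->
  ((ln (1 + kobayashi_const c5 eps * (A / (a * b))))%:E <= kobayashi D z w)%E.
Proof.
move=> e0 LA a0 b0 a2 b2; have m0 := kobayashi_const_gt0 c50 e0.
have T0 : 0 < 2 / c5 := divr_gt0 (ltr0Sn R 1) c50.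
have k0 := slope_gt0 c50 e0; have Y0 := scale_gt0 c50 e0.
have mc5 : kobayashi_const c5 eps <= c5 / 2 by rewrite /kobayashi_const ge_min lexx.
have mk : kobayashi_const c5 eps <= lin_const c5 eps / slope c5 eps.
  by rewrite /kobayashi_const ge_min lexx orbT.
move: (kobayashi_const _ _) m0 mc5 mk => m m0 mc5 mk.
have x0 : 0 < A / (a * b) := divr_gt0 A0 (mulr_gt0 a0 b0).
(* From 2 on, half of [c5 * (A / (a * b))] absorbs the summand 1, as the constant is at most
   [c5 / 2]. Below 2, ln (1 + x) <= x leaves a linear bound to prove. *)
have [big|small] := leP 2 (c5 * (A / (a * b))).
  have h := kobayashi_ln a0 b0 a2 b2; rewrite -mulrA in h.
  apply: le_trans h; rewrite lee_fin; apply: ln1D_le_log => //.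
  by apply: lt_trans (mulr_gt0 m0 x0); rewrite oppr_lt0.
have AT : A <= 2 / c5 * (a * b).
  rewrite mulrAC (ler_pdivlMr _ _ c50) mulrC -(ler_pdivrMr _ _ (mulr_gt0 a0 b0)) -mulrA.
  exact: ltW.
have ba : b <= slope c5 eps * a.
  apply: (comparable_dist a0 b0 T0 e0 AT LA); rewrite a2 b2 enormB.
  exact: bdist_lip bp.
have ab : a <= slope c5 eps * b.
  rewrite [a * b]mulrC in AT; apply: (comparable_dist b0 a0 T0 e0 AT LA); rewrite a2 b2.
  exact: bdist_lip bp.
have AY : A <= scale c5 eps * bdist D z.
  apply: (le_trans AT); rewrite -a2 /scale -[_ * slope _ _ * _]mulrA (ler_pM2l T0) [a * b]mulrC expr2 mulrA.
  by rewrite (ler_pM2r a0).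
have ln2 := ln1D_le_quot m0 mk k0 A0 a0 b0 ab; rewrite a2 in ln2.
have Ad : 0 < A / bdist D z := divr_gt0 A0 bdist_z0.
(* In the far case the distance of [z] exceeds a constant, so a bound linear in [A] is one linear in
   [A / bdist D z]. *)
have [close|far] := leP (bdist D z) (near c5 eps).
  apply: le_trans (kobayashi_trunc_quad e0 Y0 LA AY close); rewrite lee_fin.
  by apply: (le_trans ln2); rewrite (ler_pM2r Ad) ge_min lexx.
apply: le_trans kobayashi_trunc_lin; rewrite lee_fin; apply: (le_trans ln2).
have -> : t / (32 * s) * A / (2 * (2 * (C * s + C * s ^+ 2) + t) ^+ 2 / t) = K * A.
  by rewrite /K mulrAC.
apply: (@le_trans _ _ (K * near c5 eps * (A / bdist D z))).
  by rewrite (ler_pM2r Ad) ge_min lexx orbT.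
rewrite -mulrA (ler_pM2l K_gt0) mulrCA ger_pMr// (ler_pdivrMr _ _ bdist_z0) mul1r.
exact: ltW.
Qed.

End Pair.
End BoundaryPair.
End PeakFunctions.

Lemma enorm_normal_proj (R : realType) d (D : set (Cn R d)) (q N X : Cn R d) : 0 < en N ->
  outer_unit_normal D q = ((en N)^-1)%:C%C *: N ->
  en (normal_proj D q X) * en N = cabs (hd X N).
Proof.
move=> N0 nuE; rewrite /normal_proj nuE hd_hdot hdotZr !enormZ cabsM cabs_real.
have -> : conjc ((en N)^-1)%:C%C = ((en N)^-1)%:C%C :> R[i] by apply: eqc; rewrite /= ?oppr0.
rewrite cabs_real gtr0_norm ?invr_gt0// mulVf ?gt_eqF// mulr1 mulrC mulrA divff ?gt_eqF//.
by rewrite mul1r.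
Qed.

Lemma inf_lip_cst (R : realType) d (D : set (Cn R d)) (a : R) : inf_lip D (fun=> a).
Proof.
move=> phi _ e e0; apply: cnearT => h; rewrite subrr normr0 mulr_ge0 ?cabs_ge0//.
by rewrite addr_ge0// ltW.
Qed.

Theorem proposition2 (R : realType) (d : nat) (alpha : R)
    (alpha_gt0 : 0 < alpha) (alpha_le1 : alpha <= 1)
    (D : set (Cn R d)) (D_domain : domain D) (p : Cn R d)
    (Dp : strongly_pseudoconvex_bdpt alpha D p) :
  exists U : set (Cn R d), nbhs p U /\
    forall eps : R, 0 < eps -> eps <= 1 ->
    exists c : R, 0 < c /\
      forall z w : Cn R d, (D `&` U) z -> (D `&` U) w ->
        let zwN := enorm (normal_proj D (closest_bdpt D z) (z - w)) in
        eps * enorm (z - w) <= zwN ->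
        ((ln (1 + c * zwN / (Num.sqrt (bdist D z) * Num.sqrt (bdist D w))))%:E
           <= kobayashi D z w)%E.
Proof.
have [_ oD _] := D_domain; have [bp _] := Dp.
have [n [B [s [c [C [hB [s0 c0 C0] Bb nrm hP]]]]]] := local_geometry oD Dp.
have hn q : boundary D q -> en (q - p) < s -> c <= en (n q) /\ en (n q) <= C.
  by move=> bq qs; have [[]] := nrm q bq qs.
have hl q q' : boundary D q -> en (q - p) < s -> en (q' - p) < s ->
    en (n q - n q') <= C * en (q - q').
  by move=> bq qs q's; have [_] := nrm q bq qs; apply.
have t0 : 0 < c * s ^+ 2 / 12 := t_gt0 s0 c0.
have G0 : 0 < 2 * C + 1 := G_gt0 C0.
have [u [u0 u1 us uG]] : exists u : R, [/\ 0 < u, u <= 1, 3 * u <= s &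
    (2 * C + 1) * u <= c * s ^+ 2 / 12 / 16].
  move: (c * s ^+ 2 / 12) t0 => t t0.
  exists (Num.min 1 (Num.min (s / 3) (t / 16 / (2 * C + 1)))); split.
  - by rewrite !lt_min ltr01 !divr_gt0.
  - by rewrite ge_min lexx.
  - by rewrite mulrC -ler_pdivlMr// !ge_min lexx orbT.
  - by rewrite mulrC -ler_pdivlMr// !ge_min lexx !orbT.
have [c3 [c30 c3t c3c]] : exists c3 : R, [/\ 0 < c3, c3 <= c * s ^+ 2 / 12 / 8 &
    (3 + 4 * (C / c)) * c3 <= c].
  move: (c * s ^+ 2 / 12) t0 => t t0.
  have k0 : 0 < 3 + 4 * (C / c) by rewrite ltr_wpDr// mulr_ge0// divr_ge0// ltW.
  exists (Num.min (t / 8) (c / (3 + 4 * (C / c)))); split.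
  - by rewrite lt_min !divr_gt0.
  - by rewrite ge_min lexx.
  - by rewrite mulrC -ler_pdivlMr// ge_min lexx orbT.
have [c5 [c50 c53 c5c]] : exists c5 : R, [/\ 0 < c5, c5 <= c3 / (2 * (2 * C + 1)) &
    c5 ^+ 2 * (8 * (2 * C + 1) ^+ 3) <= c * c3 ^+ 2].
  move: (2 * C + 1) G0 => G G0.
  have q0 : 0 < 8 * G ^+ 3 by rewrite mulr_gt0// exprn_gt0.
  have r0 : 0 < c * c3 ^+ 2 / (8 * G ^+ 3) by rewrite divr_gt0// mulr_gt0// exprn_gt0.
  (* The bound by 1 gives [c5 ^+ 2 <= c5], so the quadratic condition follows from a linear one. *)
  exists (Num.min 1 (Num.min (c3 / (2 * G)) (c * c3 ^+ 2 / (8 * G ^+ 3)))).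
  have m0 : 0 < Num.min 1 (Num.min (c3 / (2 * G)) (c * c3 ^+ 2 / (8 * G ^+ 3))).
    by rewrite !lt_min ltr01 r0 divr_gt0// mulr_gt0.
  split=> //; first by rewrite !ge_min lexx orbT.
  rewrite -ler_pdivlMr// expr2; apply: (@le_trans _ _ (1 * (c * c3 ^+ 2 / (8 * G ^+ 3)))).
    by apply: ler_pM; rewrite ?(ltW m0)// !ge_min lexx ?orbT.
  by rewrite mul1r.
exists [set x | en (x - p) < u]; split.
  by apply/nbhs_enear; exists u.
move=> eps eps0 _.
exists (kobayashi_const s c C c5 eps); split; first exact: kobayashi_const_gt0.
move=> z w [Dz /= zu] [Dw /= wu]; rewrite !en_enorm => LA.
have [bq qz] := closest_bdptP z oD bp; have [bq' qw] := closest_bdptP w oD bp.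
have dz0 := bdist_gt0 oD bp Dz; have dw0 := bdist_gt0 oD bp Dw.
have sz : 0 < Num.sqrt (bdist D z) by rewrite sqrtr_gt0; exact: dz0.
have sw : 0 < Num.sqrt (bdist D w) by rewrite sqrtr_gt0; exact: dw0.
have z2 := sqr_sqrtr (ltW dz0); have w2 := sqr_sqrtr (ltW dw0).
have [_ qp] := near_closest bp qz zu.
have qs : en (closest_bdpt D z - p) < s by apply: (lt_le_trans qp); apply: le_trans us; rewrite (ler_pM2r u0) ler_nat.
have [[nc nC nuE] _] := nrm _ bq qs.
have AE := enorm_normal_proj (z - w) (lt_le_trans c0 nc) nuE.
rewrite -mulrA.
(* For a vanishing normal component only nonnegativity is claimed, and a constant competitor gives
   it. *)
have [A0|A0] := eqVneq (en (normal_proj D (closest_bdpt D z) (z - w))) 0.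
  rewrite A0 mul0r mulr0 addr0 ln1.
  apply: le_trans (kobayashi_ge (@inf_lip_cst R d D 0) Dz Dw).
  by rewrite subrr normr0.
apply: (kobayashi_pair oD bp hB s0 c0 C0 Bb hn hl hP u0 u1 us uG c30 c3t c3c
  c50 c53 c5c Dz Dw zu wu bq bq' qz qw _ AE eps0 LA sz sw z2 w2).
by rewrite lt_def A0 enorm_ge0.
Qed.
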